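(* Suppose that $\mathcal{V}=\mathbb{Q}\{1\}\oplus\mathcal{V}_{>n}$. In a range of degrees tending to infinity with $g$, the graded-commutative ring $R^{\mathcal{V}}$ is generated by the classes (a) $\kappa_c=\kappa_c(1)$ for $c\in\mathcal{V}_{>2n}$, of degree $|c|-2n$, (b) $\kappa_c(v_1)$ for $c\in\mathcal{V}_{>n}$, of degree $|c|-n$, (c) $\kappa_1(v_1\otimes v_2\otimes v_3)$, of degree $n$, (with $c$ homogeneous and $v_i\in H(g)$), with relations given by linearity in $c$ and in each $v_i$ and the following relations, where $x,y$ range over homogeneous elements of $\mathcal{V}_{>n}$: ($\alpha$) $\kappa_1(v_{\sigma(1)}\otimes v_{\sigma(2)}\otimes v_{\sigma(3)})=\mathrm{sign}(\sigma)^n\cdot\kappa_1(v_1\otimes v_2\otimes v_3)$ for $\sigma\in\Sigma_3$; ($\beta$) $\kappa_{x\cdot y}=\sum_i\kappa_x(a_i)\cdot\kappa_y(a_i^\#)$; ($\gamma$) $\kappa_{x\cdot y}(v_1)=\sum_{i,j}\kappa_1(v_1\otimes a_j\otimes a_i)\cdot\kappa_x(a_i^\#)\cdot\kappa_y(a_j^\#)$; ($\delta$) $\sum_i\kappa_1(v_1\otimes a_i\otimes a_i^\#)=\kappa_e(v_1)$; ($\epsilon$) $\sum_i\kappa_1(v_1\otimes v_2\otimes a_i)\cdot\kappa_1(a_i^\#\otimes v_5\otimes v_6)=\sum_i\kappa_1(v_1\otimes v_5\otimes a_i)\cdot\kappa_1(a_i^\#\otimes v_6\otimes v_2)$.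
   Context: ''In a range of degrees tending to infinity with $g$'' means: for every $d$ there is $g_0$ such that for all $g\ge g_0$ the natural map from the graded-commutative ring with the given presentation to $R^{\mathcal{V}}$ is an isomorphism in degrees $\le d$. Fix $n\ge 1$. $\mathcal{V}$ is a (non-negatively) graded $\mathbb{Q}$-algebra of finite type, concentrated in even degrees (commutative), with a chosen element $e\in\mathcal{V}_{2n}$. $H(g)$ is the standard $2g$-dimensional rational representation $H_n(W_g;\mathbb{Q})$, $W_g=\#^g(S^n\times S^n)$, with its nondegenerate $(-1)^n$-symmetric form $\lambda$, of the arithmetic group $G'_g$, the image of the diffeomorphism group of $W_g$ rel a disc in $\mathrm{Sp}_{2g}(\mathbb{Z})$ ($n$ odd) or $\mathrm{O}_{g,g}(\mathbb{Z})$ ($n$ even). A matching is a partition into disjoint ordered pairs. The $\mathbb{Q}$-linear category $\mathsf{d(s)Br}$ has finite sets as objects; morphisms $S\to T$ are spanned by pairs $(f,m)$ of an injection $f:T\hookrightarrow S$ and a matching $m$ of $S\setminus f(T)$, modulo $(f,m)=(-1)^{nr}(f,m')$ if $m'$ arises from $m$ by reversing $r$ pairs; composition is $(h,m')\circ(f,m)=(f\circ h,m\sqcup f(m'))$. $K(S)=H(g)^{\otimes S}$ is the functor $\mathsf{d(s)Br}\to\mathsf{Rep}(G'_g)$ for which $(f,m)$ applies $\lambda$ to the ordered pairs of $m$ and relabels the other factors by $f^{-1}$; $K^\vee$ is its objectwise dual. $\mathcal{P}(S,\mathcal{V})'_{\ge 0}$ is the graded vector space spanned by partitions $\{P_i\}$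 of the finite set $S$ into finitely many possibly empty parts (repetition of empty parts allowed), each labelled by a homogeneous $c_i\in\mathcal{V}$, modulo linearity in the labels, such that parts of size $0$ have label of degree $>2n$, parts of size $1$ have label of degree $\ge n$, and parts of size $2$ have label of degree $>0$; degree $\sum_i(|c_i|+n(|P_i|-2))$. The functor $\mathcal{P}(-,\mathcal{V})'_{\ge 0}\otimes\det^{\otimes n}$ on $\mathsf{d(s)Br}$: $\det(S)$ is the top exterior power of $\mathbb{Q}^S$; bijections relabel; the contraction $S\to S\setminus\{x,y\}$ with matching $(x,y)$ acts on $\det^{\otimes n}$ by the inverse of $(x\wedge y\wedge-)^{\otimes n}$ and on labelled partitions by replacing a part $P_i\supseteq\{x,y\}$ labelled $c_i$ by $P_i\setminus\{x,y\}$ labelled $e\cdot c_i$, or, if $x\in P_i$ and $y\in P_j$ with $i\neq j$, by merging these parts into $(P_i\setminus\{x\})\cup(P_j\setminus\{y\})$ labelled $c_ic_j$. It is lax symmetric monoidal by disjoint union and exterior product. $R^{\mathcal{V}}=K^\vee\otimes^{\mathsf{d(s)Br}}(\mathcal{P}(-,\mathcal{V})'_{\ge 0}\otimes\det^{\otimes n})$ is the coend, i.e. the quotient of $\bigoplus_SK(S)^\vee\otimes A(S)$, with $A=\mathcal{P}(-,\mathcal{V})'_{\ge 0}\otimes\det^{\otimes n}$, by $K^\vee(u)(\varphi)\otimes a=\varphi\otimes A(u)(a)$ for $u:S\to T$, $\varphi\in K(T)^\vee$, $a\in A(S)$; it is a graded-commutative ring with product induced by disjoint union, and has a $G'_g$-action.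 For $c\in\mathcal{V}$ an allowed label for parts of size $k$, $\kappa_c:H(g)^{\otimes k}\to R^{\mathcal{V}}$ sends $v_1\otimes\cdots\otimes v_k$ to the class of $(\lambda(v_1,-)\otimes\cdots\otimes\lambda(v_k,-))\otimes\{(\{1,\dots,k\};c)\}\otimes(e_1\wedge\cdots\wedge e_k)^{\otimes n}$, where $e_1,\dots,e_k$ is the standard basis of $\mathbb{Q}^k$; for $k=0$ write $\kappa_c=\kappa_c(1)$. $\{a_i\}_{1\le i\le 2g}$ is a basis of $H(g)$ and $\{a_i^\#\}$ the dual basis characterised by $\lambda(a_i^\#,a_j)=\delta_{ij}$.
   Formalization: For odd n, K contracts an ordered pair (x,y) by λ(v_y,v_x) instead of λ(v_x,v_y); with the latter and λ(a_i^#,a_j)=δ_ij, relations (β) and (δ) would each need a sign (−1)^n. For even n nothing changes. *)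

(* Defs.v *)
From HB Require Import structures.
From mathcomp Require Import all_boot all_order all_algebra perm generic_quotient.
From mathcomp Require Import finmap.
From mathcomp Require Import zify.
From mathcomp.multinomials Require Import monalg.
From mathcomp Require Import boolp classical_sets functions.

Set Implicit Arguments.
Unset Strict Implicit.
Unset Printing Implicit Defensive.

Import GRing.Theory.
Local Open Scope quotient_scope.
Local Open Scope classical_set_scope.
Local Open Scope ring_scope.

(** * Subspaces, two-sided ideals and quotient algebras *)

Definition subspace (M : lmodType rat) (W : set M) : Prop :=
  W 0 /\ forall q x y, W x -> W y -> W (q *: x + y).

Definition span (M : lmodType rat) (X : set M) : set M :=
  smallest (@subspace M) X.

Definition is_ideal (A : lalgType rat) (W : set A) : Prop :=
  subspace W /\ forall a x, W x -> W (a * x) /\ W (x * a).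

Definition ideal_gen (A : lalgType rat) (X : set A) : set A :=
  smallest (@is_ideal A) X.

Lemma smallest_closed T (C : set T -> Prop) (X : set T) :
  (forall F : set (set T), F `<=` C -> C (\bigcap_(A in F) A)) ->
  C (smallest C X).
Proof. by move=> H; apply: H => A []. Qed.

Lemma span_subspace (M : lmodType rat) (X : set M) : subspace (span X).
Proof.
apply: smallest_closed => F FC; split=> [A /FC[]//|q x y Fx Fy A FA].
by apply: (FC A FA).2; [apply: Fx|apply: Fy].
Qed.

Lemma ideal_gen_ideal (A : lalgType rat) (X : set A) : is_ideal (ideal_gen X).
Proof.
apply: smallest_closed => F FC; split.
  split=> [B /FC[[]]//|q x y Fx Fy B FB].
  by apply: (FC B FB).1.2; [apply: Fx|apply: Fy].
by move=> a x Fx; split=> B FB; have [] := (FC B FB).2 a x (Fx B FB).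
Qed.

Record tsideal (A : lalgType rat) :=
  TSIdeal { ts_set :> A -> Prop; ts_ideal : is_ideal ts_set }.

Module Quot.
Section Quot.
Variables (A : lalgType rat) (I : tsideal A).

Definition eqv (x y : A) : bool := `[< I (x - y) >].

Lemma I0 : I 0. Proof. exact: (ts_ideal I).1.1. Qed.
Lemma IZ q x : I x -> I (q *: x).
Proof. by move=> h; have := (ts_ideal I).1.2 q x 0 h I0; rewrite addr0. Qed.
Lemma ID x y : I x -> I y -> I (x + y).
Proof. by move=> hx hy; have := (ts_ideal I).1.2 1 x y hx hy; rewrite scale1r. Qed.
Lemma IN x : I x -> I (- x).
Proof. by move=> /(IZ (-1)); rewrite scaleN1r. Qed.
Lemma IMl a x : I x -> I (a * x). Proof. by move=> /((ts_ideal I).2 a)[]. Qed.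
Lemma IMr a x : I x -> I (x * a). Proof. by move=> /((ts_ideal I).2 a)[]. Qed.

Lemma eqv_equiv : equiv_class_of eqv.
Proof.
split=> [x|x y|y x z]; rewrite /eqv.
- by apply/asboolP; rewrite subrr; exact: I0.
- by apply/asboolP/asboolP => /IN; rewrite opprB.
- move=> /asboolP h1 /asboolP h2; apply/asboolP.
  by have := ID h1 h2; rewrite addrA subrK.
Qed.

Canonical eqv_canonical := EquivRelPack eqv_equiv.
Canonical eqv_encModRel := defaultEncModRel eqv.

Definition type := {eq_quot eqv}.
#[export] HB.instance Definition _ := Choice.on type.
#[export] HB.instance Definition _ := EqQuotient.on type.

Definition pi (x : A) : type := (\pi_(type) x)%qT.

Lemma pi_eq x y : pi x = pi y <-> I (x - y).
Proof.
split=> [/eqmodP /= h|h]; first by apply/asboolP; exact: h.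
by apply/eqmodP => /=; apply/asboolP.
Qed.

Lemma pi_surj (a : type) : exists x, a = pi x.
Proof. by exists (repr a); rewrite /pi reprK. Qed.

Definition add (a b : type) := pi (repr a + repr b).
Definition opp (a : type) := pi (- repr a).
Definition mul (a b : type) := pi (repr a * repr b).
Definition scale q (a : type) := pi (q *: repr a).

Lemma repr_pi x : I (repr (pi x) - x).
Proof. by apply/pi_eq; rewrite /pi reprK. Qed.

Lemma addE x y : add (pi x) (pi y) = pi (x + y).
Proof.
by apply/pi_eq; rewrite opprD addrACA; apply: ID; exact: repr_pi.
Qed.
Lemma oppE x : opp (pi x) = pi (- x).
Proof. by apply/pi_eq; rewrite -opprD; apply: IN; exact: repr_pi. Qed.
Lemma scaleE q x : scale q (pi x) = pi (q *: x).
Proof. by apply/pi_eq; rewrite -scalerBr; apply: IZ; exact: repr_pi. Qed.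
Lemma mulE x y : mul (pi x) (pi y) = pi (x * y).
Proof.
apply/pi_eq; set x' := repr _; set y' := repr _.
have -> : x' * y' - x * y = (x' - x) * y' + x * (y' - y).
  by rewrite mulrBl mulrBr addrA subrK.
by apply: ID; [apply: IMr|apply: IMl]; exact: repr_pi.
Qed.

Let ind2 := (addE, oppE, scaleE, mulE).

Lemma addA : associative add.
Proof.
by move=> a b c; have [[x ->] [[y ->] [z ->]]] :=
  (pi_surj a, (pi_surj b, pi_surj c)); rewrite !ind2 addrA.
Qed.
Lemma addC : commutative add.
Proof.
by move=> a b; have [[x ->] [y ->]] := (pi_surj a, pi_surj b);
  rewrite !ind2 addrC.
Qed.
Lemma add0 : left_id (pi 0) add.
Proof. by move=> a; have [x ->] := pi_surj a; rewrite !ind2 add0r. Qed.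
Lemma addN : left_inverse (pi 0) opp add.
Proof. by move=> a; have [x ->] := pi_surj a; rewrite !ind2 addNr. Qed.
#[export] HB.instance Definition _ := GRing.isZmodule.Build type addA addC add0 addN.

Lemma mulA : associative mul.
Proof.
by move=> a b c; have [[x ->] [[y ->] [z ->]]] :=
  (pi_surj a, (pi_surj b, pi_surj c)); rewrite !ind2 mulrA.
Qed.
Lemma mul1 : left_id (pi 1) mul.
Proof. by move=> a; have [x ->] := pi_surj a; rewrite !ind2 mul1r. Qed.
Lemma mulr1 : right_id (pi 1) mul.
Proof. by move=> a; have [x ->] := pi_surj a; rewrite !ind2 mulr1. Qed.
Lemma mulDl : left_distributive mul add.
Proof.
by move=> a b c; have [[x ->] [[y ->] [z ->]]] :=
  (pi_surj a, (pi_surj b, pi_surj c)); rewrite !ind2 mulrDl.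
Qed.
Lemma mulDr : right_distributive mul add.
Proof.
by move=> a b c; have [[x ->] [[y ->] [z ->]]] :=
  (pi_surj a, (pi_surj b, pi_surj c)); rewrite !ind2 mulrDr.
Qed.
#[export] HB.instance Definition _ :=
  GRing.Zmodule_isPzRing.Build type mulA mul1 mulr1 mulDl mulDr.

Lemma scaleA p q a : scale p (scale q a) = scale (p * q) a.
Proof. by have [x ->] := pi_surj a; rewrite !ind2 scalerA. Qed.
Lemma scale1 : left_id 1 scale.
Proof. by move=> a; have [x ->] := pi_surj a; rewrite !ind2 scale1r. Qed.
Lemma scaleDr : right_distributive scale +%R.
Proof.
move=> q a b; have [[x ->] [y ->]] := (pi_surj a, pi_surj b).
have plusE (u v : type) : u + v = add u v by [].
by rewrite !plusE !ind2 scalerDr.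
Qed.
Lemma scaleDl a : {morph scale^~ a : p q / p + q}.
Proof.
move=> p q; have [x ->] := pi_surj a.
have plusE (u v : type) : u + v = add u v by [].
by rewrite !plusE !ind2 scalerDl.
Qed.
#[export] HB.instance Definition _ :=
  GRing.Zmodule_isLmodule.Build rat type scaleA scale1 scaleDr scaleDl.

End Quot.
Module Exports. HB.reexport. End Exports.
End Quot.
Export Quot.Exports.

(* [A // I] is the quotient algebra, [\cls_I x] the class of [x] *)
Notation "A '//' I" := (@Quot.type A I) (at level 40) : type_scope.
Notation "'\cls_' I" := (@Quot.pi _ I) (at level 0, I at level 2, format "'\cls_' I").

(** * Monoid algebras (monalg's [monomType] excludes monoids with nontrivial
    units, hence does not apply to the symbols below) *)

Module MonoidAlg.
Section Lext.
Variables (K : choiceType) (M : lmodType rat).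
Implicit Types (f : K -> M) (x y : {malg rat[K]}).

Definition lext f x : M := \sum_(k <- msupp x) x@_k *: f k.

Lemma lextEw f x (d : {fset K}) : (msupp x `<=` d)%fset ->
  lext f x = \sum_(k <- d) x@_k *: f k.
Proof.
move=> le; rewrite /lext (big_fset_incl _ le) // => k _ /mcoeff_outdom ->.
by rewrite scale0r.
Qed.

Lemma lextP f q x y : lext f (q *: x + y) = q *: lext f x + lext f y.
Proof.
pose d := (msupp x `|` msupp y)%fset.
have dx : (msupp x `<=` d)%fset by exact: fsubsetUl.
have dy : (msupp y `<=` d)%fset by exact: fsubsetUr.
have dxy : (msupp (q *: x + y) `<=` d)%fset.
  apply: fsubset_trans (msuppD_le _ _) _.
  by rewrite fsubUset dy andbT (fsubset_trans _ dx) // msuppZ_le.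
rewrite !(lextEw _ dx, lextEw _ dy, lextEw _ dxy) scaler_sumr -big_split /=.
by apply: eq_bigr => k _; rewrite mcoeffD mcoeffZ scalerDl scalerA.
Qed.

Lemma lextU f k : lext f << k >> = f k.
Proof. by rewrite (lextEw _ msuppU_le) big_seq_fset1 mcoeffUU scale1r. Qed.

Lemma lext_fun f1 f2 q x :
  lext (fun k => q *: f1 k + f2 k) x = q *: lext f1 x + lext f2 x.
Proof.
rewrite /lext scaler_sumr -big_split; apply: eq_bigr => k _ /=.
by rewrite scalerDr !scalerA mulrC.
Qed.

End Lext.

Lemma malg_ind (K : choiceType) (P : {malg rat[K]} -> Prop) :
  P 0 -> (forall q k x, P x -> P (q *: << k >> + x)) -> forall x, P x.
Proof.
move=> P0 PD x; rewrite (monalgE x); elim: (X in \sum_(k <- X) _) => [|k s IH].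
  by rewrite big_nil.
rewrite big_cons; have -> : << x@_k *g k >> = x@_k *: (<< k >> : {malg rat[K]}).
  apply/malgP => k'; rewrite mcoeffZ !mcoeffU.
  by case: eqP => _; rewrite ?mulr1n ?mulr1 ?mulr0n ?mulr0.
exact: PD.
Qed.

Section Conv.
Variables (K : choiceType) (op : K -> K -> K) (e : K).
Hypotheses (opA : associative op) (op1k : left_id e op) (opk1 : right_id e op).
Local Notation F := {malg rat[K]}.
Variable c : F -> F -> F.
Hypothesis cPl : forall q x y z, c (q *: x + y) z = q *: c x z + c y z.
Hypothesis cPr : forall q x y z, c x (q *: y + z) = q *: c x y + c x z.
Hypothesis cUU : forall i j, c << i >> << j >> = << op i j >>.

Lemma conv0l z : c 0 z = 0.
Proof. by have := cPl (-1) 0 0 z; rewrite !scaleN1r !addNr. Qed.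
Lemma conv0r z : c z 0 = 0.
Proof. by have := cPr (-1) z 0 0; rewrite !scaleN1r !addNr. Qed.
Lemma convDl : left_distributive c +%R.
Proof. by move=> x y z; have := cPl 1 x y z; rewrite !scale1r. Qed.
Lemma convDr : right_distributive c +%R.
Proof. by move=> x y z; have := cPr 1 x y z; rewrite !scale1r. Qed.
Lemma convZl q x y : q *: c x y = c (q *: x) y.
Proof. by have := cPl q x 0 y; rewrite conv0l !addr0. Qed.

Lemma convA : associative c.
Proof.
move=> x y z; elim/malg_ind: x => [|p i x IHx]; first by rewrite !conv0l.
rewrite !cPl IHx; congr (_ *: _ + _) => {x IHx}.
elim/malg_ind: y => [|p' j y IHy]; first by rewrite !(conv0l, conv0r).
rewrite !(cPl, cPr) IHy; congr (_ *: _ + _) => {y IHy}.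
elim/malg_ind: z => [|r k z IHz]; first by rewrite !conv0r.
by rewrite !cPr IHz !cUU opA.
Qed.

Lemma conv1l : left_id (<< e >> : F) c.
Proof.
by elim/malg_ind => [|r k z IHz]; rewrite ?conv0r // cPr cUU op1k IHz.
Qed.
Lemma conv1r : right_id (<< e >> : F) c.
Proof.
by elim/malg_ind => [|r k z IHz]; rewrite ?conv0l // cPl cUU opk1 IHz.
Qed.
Lemma conv_neq0 : (<< e >> : F) != 0.
Proof. by rewrite monalgU_eq0 oner_eq0. Qed.

End Conv.

Section Product.
Variables (K : choiceType) (op : K -> K -> K).
Local Notation F := {malg rat[K]}.

Definition conv (x y : F) : F :=
  lext (fun i => lext (fun j => << op i j >>) y) x.

Lemma convPl q x y z : conv (q *: x + y) z = q *: conv x z + conv y z.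
Proof. exact: lextP. Qed.
Lemma convPr q x y z : conv x (q *: y + z) = q *: conv x y + conv x z.
Proof.
by rewrite /conv -lext_fun; congr lext; apply/funext => i; rewrite lextP.
Qed.
Lemma convUU i j : conv << i >> << j >> = << op i j >>.
Proof. by rewrite /conv !lextU. Qed.
End Product.
End MonoidAlg.

(** * The symplectic or orthogonal representation *)

Section Form.
Variables (n g : nat).

Definition H := 'rV[rat]_(g + g).

Definition hyp_mx : 'M[rat]_(g + g) :=
  block_mx 0 1%:M ((-1) ^+ n)%:M 0.

Definition lam (u v : H) : rat := (u *m hyp_mx *m v^T) 0 0.

Lemma lamPl q x y v : lam (q *: x + y) v = q * lam x v + lam y v.
Proof. by rewrite /lam !mulmxDl -!scalemxAl !mxE. Qed.

Lemma lamPr q x y u : lam u (q *: x + y) = q * lam u x + lam u y.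
Proof. by rewrite /lam linearP mulmxDr -scalemxAr !mxE. Qed.

(** [mform k] is the dual of the [k]-th tensor power of [H], as the space of
    multilinear forms. *)
Definition upd k (v : 'I_k -> H) (i : 'I_k) (x : H) : 'I_k -> H :=
  fun j => if j == i then x else v j.

Definition multilinear k (phi : ('I_k -> H) -> rat) : Prop :=
  forall v i q x y,
    phi (upd v i (q *: x + y)) = q * phi (upd v i x) + phi (upd v i y).

Record mform k := MForm { mf :> ('I_k -> H) -> rat; mfP : multilinear mf }.

Lemma mform_eq k (phi psi : mform k) : phi =1 psi -> phi = psi.
Proof.
case: phi psi => [f fP] [h hP] /= /funext fh; subst h.
by congr MForm; exact: Prop_irrelevance.
Qed.

Lemma const_multilinear : multilinear (fun _ : 'I_0 -> H => 1).
Proof. by move=> v []. Qed.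
Definition form1 : mform 0 := MForm const_multilinear.

Lemma upd_comp k l (f : 'I_l -> 'I_k) v t x : injective f ->
  (fun j => upd v (f t) x (f j)) = upd (fun j => v (f j)) t x.
Proof. by move=> fI; apply/funext => j; rewrite /upd (inj_eq fI). Qed.

Lemma upd_comp_out k l (f : 'I_l -> 'I_k) v i x : (forall j, f j != i) ->
  (fun j => upd v i x (f j)) = (fun j => v (f j)).
Proof. by move=> fi; apply/funext => j; rewrite /upd (negbTE (fi j)). Qed.

Lemma tensor_multilinear k l (phi : mform k) (psi : mform l) :
  multilinear (fun v : 'I_(k + l) -> H =>
    phi (fun i => v (lshift l i)) * psi (fun j => v (rshift k j))).
Proof.
move=> v i q x y; case: (split_ordP i) => {i} i ->.
- have lE w : (fun j => upd v (lshift l i) w (lshift l j)) =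
    upd (fun j => v (lshift l j)) i w by apply: upd_comp; exact: lshift_inj.
  have rE w : (fun j => upd v (lshift l i) w (rshift k j)) =
    (fun j => v (rshift k j)).
    by apply: upd_comp_out => j; rewrite eq_rlshift.
  by rewrite !lE !rE mfP mulrDl mulrA.
- have lE w : (fun j => upd v (rshift k i) w (lshift l j)) =
    (fun j => v (lshift l j)).
    by apply: upd_comp_out => j; rewrite eq_lrshift.
  have rE w : (fun j => upd v (rshift k i) w (rshift k j)) =
    upd (fun j => v (rshift k j)) i w by apply: upd_comp; exact: rshift_inj.
  by rewrite !lE !rE mfP mulrDr mulrCA.
Qed.
Definition tensor k l (phi : mform k) (psi : mform l) : mform (k + l) :=
  MForm (tensor_multilinear phi psi).

Lemma form_of_multilinear k (v : k.-tuple H) :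
  multilinear (fun u : 'I_k -> H => \prod_i lam (tnth v i) (u i)).
Proof.
move=> u i q x y; pose r := \prod_(j | j != i) lam (tnth v j) (u j).
have E z : \prod_j lam (tnth v j) (upd u i z j) = lam (tnth v i) z * r.
  rewrite (bigD1 i) //= {1}/upd eqxx; congr (_ * _).
  by apply: eq_bigr => j /negbTE ji; rewrite /upd ji.
by rewrite !E lamPr mulrDl mulrA.
Qed.
Definition form_of k (v : k.-tuple H) : mform k := MForm (form_of_multilinear v).

End Form.

(** * The downward (signed) Brauer category *)

(** A spanning morphism [(f, m)] from ['I_k] to ['I_l]: the values of [f]
    and the entries of the ordered pairs in [m] exhaust ['I_k] without
    repetition. The matching [m] is listed in some order, on which nothing
    below depends. *)
Definition bword k l (f : 'I_l -> 'I_k) (m : seq ('I_k * 'I_k)) : seq 'I_k :=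
  flatten [seq [:: p.1; p.2] | p <- m] ++ [seq f t | t <- enum 'I_l].

Record brmor k l := BrMor {
  bf : 'I_l -> 'I_k;
  bm : seq ('I_k * 'I_k);
  brP : forall i, count_mem i (bword bf bm) = 1%N }.

(** In the top exterior power of [Q^k], the standard generator
    [e_0 /\ ... /\ e_(k-1)] is [wsign w] times the product [e_w0 /\ e_w1 /\ ...]
    over a word [w] that enumerates ['I_k]. So [wsign (bword f m)] is the scalar
    by which [(f, m)] maps the standard generator of [det 'I_k] to that of
    [det 'I_l]. *)
Fixpoint inversions (w : seq nat) : nat :=
  if w is x :: w' then (count (fun y => y < x)%N w' + inversions w')%N else 0%N.

Definition wsign k (w : seq 'I_k) : rat := (-1) ^+ inversions (map val w).

Section Dual.
Variables (n g : nat).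

Lemma pairs_const k (m : seq ('I_k * 'I_k)) (v : 'I_k -> H g) i x :
  count_mem i (flatten [seq [:: p.1; p.2] | p <- m]) = 0%N ->
  \prod_(p <- m) lam n (upd v i x p.2) (upd v i x p.1) =
  \prod_(p <- m) lam n (v p.2) (v p.1).
Proof.
elim: m => [|p m IH] /=; first by rewrite !big_nil.
have [//|h1] := eqVneq p.1 i; have [//|h2] := eqVneq p.2 i => /= h.
by rewrite !big_cons IH // /upd (negbTE h1) (negbTE h2).
Qed.

Lemma pairs_linear k (m : seq ('I_k * 'I_k)) (v : 'I_k -> H g) i q x y :
  count_mem i (flatten [seq [:: p.1; p.2] | p <- m]) = 1%N ->
  let P w := \prod_(p <- m) lam n (w p.2) (w p.1) in
  P (upd v i (q *: x + y)) = q * P (upd v i x) + P (upd v i y).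
Proof.
elim: m => [|p m IH] //= h; rewrite !big_cons.
have [h1|h1] := eqVneq p.1 i; have [h2|h2] := eqVneq p.2 i;
  move: h; rewrite ?h1 ?h2 ?eqxx ?(negbTE h1) ?(negbTE h2) //= ?add0n.
- rewrite add1n => -[h]; rewrite !pairs_const // /upd eqxx (negbTE h2).
  by rewrite lamPr mulrDl mulrA.
- rewrite add1n => -[h]; rewrite !pairs_const // /upd eqxx (negbTE h1).
  by rewrite lamPl mulrDl mulrA.
- by move=> /IH ->; rewrite /upd (negbTE h1) (negbTE h2) mulrDr mulrCA.
Qed.

Lemma dual_multilinear k l (u : brmor k l) (phi : mform g l) :
  multilinear (fun v : 'I_k -> H g =>
    phi (fun t => v (bf u t)) * \prod_(p <- bm u) lam n (v p.2) (v p.1)).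
Proof.
move=> v i q x y; have := brP u i; rewrite /bword count_cat.
set c1 := count _ (flatten _); set c2 := count _ _ => h.
have [[h1 h2]|[h1 h2]] : (c1 = 0 /\ c2 = 1 \/ c1 = 1 /\ c2 = 0)%N.
  by case: c1 c2 h => [|[|?]] [|[|?]] //; [left|right].
- have [t ft ut] : exists2 t, bf u t = i & forall t', bf u t' = i -> t' = t.
    move: h2; rewrite /c2 count_map -size_filter; set s := filter _ _.
    have sP z : (z \in s) = (bf u z == i) by rewrite mem_filter mem_enum andbT.
    case: s sP => [|t [|]] //= sP _; exists t => [|t' /eqP]; last first.
      by rewrite -sP inE => /eqP.
    by apply/eqP; rewrite -sP inE.
  rewrite !pairs_const //.
  have updE z : (fun t => upd v i z (bf u t)) = upd (fun t => v (bf u t)) t z.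
    apply/funext => j; rewrite /upd; case: eqP => [/ut ->|ne]; first by rewrite eqxx.
    by case: eqP => // jt; case: ne; rewrite jt.
  by rewrite !updE mfP mulrDl mulrA.
- have updE z : (fun t => upd v i z (bf u t)) = (fun t => v (bf u t)).
    apply: upd_comp_out => j; apply/eqP => ji; move: h2; rewrite /c2 => /eqP.
    rewrite eqn0Ngt -has_count => /hasPn /(_ i); rewrite -ji map_f ?mem_enum //.
    by move=> /(_ isT); rewrite /= eqxx.
  rewrite !updE.
  by rewrite pairs_linear // mulrDr mulrCA.
Qed.

(** The dual of [K(f, m)]. An ordered pair [(x, y)] of the matching is
    contracted by [lam (v_y) (v_x)], which is [(-1)^n] times [lam (v_x) (v_y)].
    The order matters for odd [n] only: with the determinant twist and with the
    dual basis normalised by [lam (ash i) (a j) = (i == j)] below, it is the one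
    for which the relations [rel_beta] and [rel_delta] hold without a sign. *)
Definition dual k l (u : brmor k l) (phi : mform g l) : mform g k :=
  MForm (dual_multilinear u phi).

End Dual.

(** * Graded algebras *)

(** A grading of [V] by homogeneous components [gr d], of finite type and
    concentrated in even degrees. *)
Record even_grading (V : comAlgType rat) (gr : nat -> set V) : Prop := {
  gr_subspace : forall d, subspace (gr d);
  gr_one : gr 0%N 1;
  gr_mul : forall d d' x y, gr d x -> gr d' y -> gr (d + d')%N (x * y);
  gr_dec : forall x, exists N (f : nat -> V),
    (forall d, gr d (f d)) /\ x = \sum_(d < N) f d;
  gr_direct : forall N (f : nat -> V),
    (forall d, gr d (f d)) -> \sum_(d < N) f d = 0 ->
    forall d, (d < N)%N -> f d = 0;
  gr_fin : forall d, exists s : seq V,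
    forall x, gr d x -> exists q : nat -> rat, x = \sum_(i < size s) q i *: s`_i;
  gr_even : forall d x, odd d -> gr d x -> x = 0 }.

Definition gr_gt (V : comAlgType rat) (gr : nat -> set V) (n : nat) : set V :=
  span [set x | exists2 d, (n < d)%N & gr d x].

(** [V] is the direct sum of [Q{1}] and its part of degrees [> n]. *)
Definition unit_plus_gt (V : comAlgType rat) (gr : nat -> set V) (n : nat) :=
  (forall x, exists q y, gr_gt gr n y /\ x = q%:A + y) /\
  (forall q y, gr_gt gr n y -> q%:A + y = 0 -> q = 0 /\ y = 0).

(** * Labelled partitions *)

Section Partitions.
Variables (n : nat) (V : comAlgType rat) (gr : nat -> set V) (e : V).

(** A part of ['I_k] with the degree of its label, and the label. *)
Definition part k : Type := ({set 'I_k} * nat * V)%type.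
Definition psupp k (p : part k) : {set 'I_k} := p.1.1.
Definition pdeg k (p : part k) : nat := p.1.2.
Definition plab k (p : part k) : V := p.2.

Definition admissible k (p : part k) : Prop :=
  gr (pdeg p) (plab p) /\
  match #|psupp p| with
  | 0 => (2 * n < pdeg p)%N
  | 1 => (n <= pdeg p)%N
  | 2 => (0 < pdeg p)%N
  | _ => True
  end.

Definition is_lpart k (s : seq (part k)) : Prop :=
  (forall i : 'I_k, count (fun p => i \in psupp p) s = 1%N) /\
  (forall p, p \in s -> admissible p).

Record lpart k := LPart { lp :> seq (part k); lpP : is_lpart lp }.

(** For admissible parts [2n <= pdeg p + n #|psupp p|], so that the
    subtraction is not truncated. *)
Definition lpdeg k (s : lpart k) : nat :=
  \sum_(p <- s) (pdeg p + n * #|psupp p| - 2 * n)%N.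

Definition contract k (x y : 'I_k) (s : seq (part k)) : seq (part k) :=
  let hit p := (x \in psupp p) || (y \in psupp p) in
  let rest := [seq p <- s | ~~ hit p] in
  match [seq p <- s | hit p] with
  | [:: p] =>
      (psupp p :\: [set x; y], (2 * n + pdeg p)%N, e * plab p) :: rest
  | [:: p; q] =>
      ((psupp p :|: psupp q) :\: [set x; y], (pdeg p + pdeg q)%N,
       plab p * plab q) :: rest
  | _ => s
  end.

Definition act k l (u : brmor k l) (s : seq (part k)) : seq (part l) :=
  [seq (bf u @^-1: psupp p, pdeg p, plab p)
     | p <- foldl (fun s xy => contract xy.1 xy.2 s) s (bm u)].

Definition pmap k l (h : 'I_k -> 'I_l) (p : part k) : part l :=
  (h @: psupp p, pdeg p, plab p).

Definition lcat k l (s : seq (part k)) (t : seq (part l)) : seq (part (k + l)) :=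
  map (pmap (@lshift k l)) s ++ map (pmap (@rshift k l)) t.

Lemma lpart_eq k (s t : lpart k) : s = t :> seq _ -> s = t.
Proof.
case: s t => [s sP] [t tP] /= st; subst t.
by congr LPart; exact: Prop_irrelevance.
Qed.

Lemma mem_pmap k l (h : 'I_k -> 'I_l) i (p : part k) : injective h ->
  (h i \in psupp (pmap h p)) = (i \in psupp p).
Proof. by move=> hI; rewrite /psupp /= mem_imset. Qed.

Lemma mem_pmap_out k l (h : 'I_k -> 'I_l) i (p : part k) :
  (forall j, h j != i) -> i \in psupp (pmap h p) = false.
Proof.
move=> hi; apply/negP => /imsetP [j _ ij].
by have := hi j; rewrite ij eqxx.
Qed.

Lemma admissible_pmap k l (h : 'I_k -> 'I_l) (p : part k) : injective h ->
  admissible (pmap h p) <-> admissible p.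
Proof. by move=> hI; rewrite /admissible /psupp /= card_imset. Qed.

Lemma count_lcatl k l (s : seq (part k)) (t : seq (part l)) i :
  count (fun p => lshift l i \in psupp p) (lcat s t) =
  count (fun p => i \in psupp p) s.
Proof.
rewrite /lcat count_cat !count_map.
rewrite (eq_count (a2 := fun p => i \in psupp p)) => [|p]; last first.
  by rewrite /= mem_pmap //; exact: lshift_inj.
rewrite [X in (_ + X)%N](eq_count (a2 := pred0)) => [|p]; last first.
  by rewrite /= mem_pmap_out // => j; rewrite eq_rlshift.
by rewrite count_pred0 addn0.
Qed.

Lemma count_lcatr k l (s : seq (part k)) (t : seq (part l)) i :
  count (fun p => rshift k i \in psupp p) (lcat s t) =
  count (fun p => i \in psupp p) t.
Proof.
rewrite /lcat count_cat !count_map.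
rewrite [X in (_ + X)%N](eq_count (a2 := fun p => i \in psupp p)) => [|p]; last first.
  by rewrite /= mem_pmap //; exact: rshift_inj.
rewrite (eq_count (a2 := pred0)) => [|p]; last first.
  by rewrite /= mem_pmap_out // => j; rewrite eq_lrshift.
by rewrite count_pred0.
Qed.

Lemma is_lpart_lcat k l (s : seq (part k)) (t : seq (part l)) :
  is_lpart (lcat s t) <-> is_lpart s /\ is_lpart t.
Proof.
split=> [[h1 h2]|[[s1 s2] [t1 t2]]].
  split; split=> [i|p ps].
  - by rewrite -(count_lcatl s t).
  - apply/(admissible_pmap p (@lshift_inj k l)); apply: h2.
    by rewrite mem_cat map_f.
  - by rewrite -(count_lcatr s t).
  - apply/(admissible_pmap p (@rshift_inj k l)); apply: h2.
    by rewrite mem_cat map_f ?orbT.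
split=> [i|p].
  by case: (split_ordP i) => j ->; rewrite ?count_lcatl ?count_lcatr.
rewrite mem_cat => /orP [] /mapP [q qs ->].
  by apply/admissible_pmap; [exact: lshift_inj|exact: s2].
by apply/admissible_pmap; [exact: rshift_inj|exact: t2].
Qed.

Lemma nil_is_lpart : is_lpart (nil : seq (part 0)).
Proof. by split=> // -[]. Qed.
Definition lpart0 : lpart 0 := LPart nil_is_lpart.

Definition lunion k l (s : lpart k) (t : lpart l) : lpart (k + l) :=
  LPart ((is_lpart_lcat s t).2 (conj (lpP s) (lpP t))).

Lemma perm_is_lpart k (s t : seq (part k)) :
  perm_eq s t -> is_lpart s -> is_lpart t.
Proof.
move=> st [h1 h2]; split=> [i|p]; first by rewrite -(seq.permP st).
by rewrite -(perm_mem st); exact: h2.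
Qed.

Lemma contract_perm k x y (s t : seq (part k)) :
  perm_eq s t -> perm_eq (contract x y s) (contract x y t).
Proof.
move=> st; rewrite /contract; set hit := fun p => _.
have rst : perm_eq [seq p <- s | ~~ hit p] [seq p <- t | ~~ hit p].
  exact: perm_filter.
have one (a b : part k) : perm_eq [:: a] [:: b] -> b = a.
  by move=> /perm_mem /(_ b); rewrite !inE eqxx => /eqP.
have two (a b c d : part k) : perm_eq [:: a; b] [:: c; d] ->
    (c = a /\ d = b) \/ (c = b /\ d = a).
  move=> E; have := perm_mem E c; rewrite !inE eqxx => /orP [] /eqP ca; subst c.
    by left; split=> //; apply: one; rewrite perm_cons in E.
  right; split=> //; apply: one; move: E.
  by rewrite (perm_catC [:: a] [:: b]) perm_cons.
have := perm_filter hit st.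
case: [seq p <- s | hit p] => [|p [|q [|r s']]];
  case: [seq p <- t | hit p] => [|p' [|q' [|r' t']]] // E;
  have := perm_size E => //= _.
- by rewrite (one _ _ E) perm_cons.
- case: (two _ _ _ _ E) => -[-> ->]; first by rewrite perm_cons.
  by rewrite finset.setUC addnC mulrC perm_cons.
Qed.

Lemma foldl_contract_perm k (m : seq ('I_k * 'I_k)) (s t : seq (part k)) :
  perm_eq s t ->
  perm_eq (foldl (fun s xy => contract xy.1 xy.2 s) s m)
          (foldl (fun s xy => contract xy.1 xy.2 s) t m).
Proof.
by elim: m s t => [|xy m IH] s t st //=; apply: IH; exact: contract_perm.
Qed.

Lemma contract_lcatl k l x y (s : seq (part k)) (t : seq (part l)) :
  contract (lshift l x) (lshift l y) (lcat s t) = lcat (contract x y s) t.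
Proof.
rewrite /contract /lcat.
pose hit' (p : part (k + l)) := (lshift l x \in psupp p) || (lshift l y \in psupp p).
pose hit (p : part k) := (x \in psupp p) || (y \in psupp p).
have hl p : hit' (pmap (@lshift k l) p) = hit p.
  by rewrite /hit' !mem_pmap //; exact: lshift_inj.
have hr p : hit' (pmap (@rshift k l) p) = false.
  by rewrite /hit' !mem_pmap_out // => j; rewrite eq_rlshift.
have fH : [seq p <- map (pmap (@lshift k l)) s ++ map (pmap (@rshift k l)) t | hit' p] =
    map (pmap (@lshift k l)) [seq p <- s | hit p].
  rewrite filter_cat !filter_map (eq_filter (a2 := hit)) //.
  by rewrite [X in _ ++ map _ X](eq_filter (a2 := pred0)) // filter_pred0 cats0.
have fN : [seq p <- map (pmap (@lshift k l)) s ++ map (pmap (@rshift k l)) t | ~~ hit' p] =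
    map (pmap (@lshift k l)) [seq p <- s | ~~ hit p] ++ map (pmap (@rshift k l)) t.
  rewrite filter_cat !filter_map (eq_filter (a2 := fun p => ~~ hit p)) => [|p].
    rewrite [X in _ ++ map _ X](eq_filter (a2 := predT)) ?filter_predT // => p.
    by rewrite /= hr.
  by rewrite /= hl.
rewrite fH fN.
have setE (A : {set 'I_k}) : (@lshift k l @: A) :\: [set lshift l x; lshift l y] =
    @lshift k l @: (A :\: [set x; y]).
  apply/setP => i; case: (split_ordP i) => j ->.
    rewrite mem_imset; last exact: lshift_inj.
    by rewrite !inE !mem_imset ?eq_lshift //; exact: lshift_inj.
  rewrite !inE; set b := _ \in _; suff /negbTE -> : ~~ b.
    by rewrite andbF; apply/esym/negP => /imsetP [? _ /eqP]; rewrite eq_rlshift.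
  by apply/negP => /imsetP [? _ /eqP]; rewrite eq_rlshift.
case: [seq p <- s | hit p] => [|p [|q [|r s']]] //=.
  by congr cons; rewrite /pmap /psupp /= setE.
by congr cons; rewrite /pmap /psupp /= -imsetU setE.
Qed.
Lemma contract_lcatr k l x y (s : seq (part l)) (t : seq (part k)) :
  perm_eq (contract (rshift k x) (rshift k y) (lcat t s))
          (lcat t (contract x y s)).
Proof.
rewrite /contract /lcat.
pose hit' (p : part (k + l)) := (rshift k x \in psupp p) || (rshift k y \in psupp p).
pose hit (p : part l) := (x \in psupp p) || (y \in psupp p).
have hl p : hit' (pmap (@rshift k l) p) = hit p.
  by rewrite /hit' !mem_pmap //; exact: rshift_inj.
have hr p : hit' (pmap (@lshift k l) p) = false.
  by rewrite /hit' !mem_pmap_out // => j; rewrite eq_lrshift.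
have fH : [seq p <- map (pmap (@lshift k l)) t ++ map (pmap (@rshift k l)) s | hit' p] =
    map (pmap (@rshift k l)) [seq p <- s | hit p].
  rewrite filter_cat !filter_map [in X in _ ++ X](eq_filter (a2 := hit)) //.
  by rewrite (eq_filter (a2 := pred0)) // filter_pred0.
have fN : [seq p <- map (pmap (@lshift k l)) t ++ map (pmap (@rshift k l)) s | ~~ hit' p] =
    map (pmap (@lshift k l)) t ++ map (pmap (@rshift k l)) [seq p <- s | ~~ hit p].
  rewrite filter_cat !filter_map [in X in _ ++ X](eq_filter (a2 := fun p => ~~ hit p)) => [|p].
    rewrite (eq_filter (a2 := predT)) ?filter_predT // => p.
    by rewrite /= hr.
  by rewrite /= hl.
rewrite fH fN.
have setE (A : {set 'I_l}) : (@rshift k l @: A) :\: [set rshift k x; rshift k y] =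
    @rshift k l @: (A :\: [set x; y]).
  apply/setP => i; case: (split_ordP i) => j ->; last first.
    rewrite mem_imset; last exact: rshift_inj.
    by rewrite !inE !mem_imset ?eq_rshift //; exact: rshift_inj.
  rewrite !inE; set b := _ \in _; suff /negbTE -> : ~~ b.
    by rewrite andbF; apply/esym/negP => /imsetP [? _ /eqP]; rewrite eq_lrshift.
  by apply/negP => /imsetP [? _ /eqP]; rewrite eq_lrshift.
have consC (a : part (k + l)) u v : perm_eq (a :: (u ++ v)) (u ++ a :: v).
  by rewrite perm_sym perm_catC /= perm_cons perm_catC.
case: [seq p <- s | hit p] => [|p [|q [|r s']]] //=.
  by rewrite /psupp /= setE; exact: consC.
by rewrite /psupp /= -imsetU setE; exact: consC.
Qed.

End Partitions.

(** * Tensoring morphisms with identities *)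

Section TensorMor.
Variables (k l p : nat) (u : brmor k l).

Lemma inversions_cat a b : inversions (a ++ b) =
  (inversions a + inversions b + \sum_(x <- a) count (fun y => y < x)%N b)%N.
Proof.
elim: a => [|x a IH] /=; first by rewrite big_nil addn0.
by rewrite IH big_cons count_cat; lia.
Qed.

Lemma inversions_shift d w : inversions (map (addn d) w) = inversions w.
Proof.
elim: w => //= x w ->; congr (_ + _)%N; rewrite count_map.
by apply: eq_count => y /=; rewrite ltn_add2l.
Qed.

Lemma inversions_iota a b : inversions (iota a b) = 0%N.
Proof.
elim: b a => //= b IH a; rewrite IH addn0; apply/eqP.
rewrite eqn0Ngt -has_count; apply/hasPn => y; rewrite mem_iota => /andP[ay _].
by rewrite -leqNgt ltnW.
Qed.

Lemma enum_ordD a b : enum 'I_(a + b) =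
  map (@lshift a b) (enum 'I_a) ++ map (@rshift a b) (enum 'I_b).
Proof.
apply: (inj_map val_inj); rewrite map_cat val_enum_ord iotaD add0n.
congr (_ ++ _).
  by rewrite -[LHS]val_enum_ord -[RHS]map_comp; apply: eq_map.
rewrite -[in LHS](addn0 a) iotaDl -val_enum_ord -[LHS]map_comp -[RHS]map_comp.
by apply: eq_map.
Qed.

Definition shiftm_l (m : seq ('I_k * 'I_k)) : seq ('I_(k + p) * 'I_(k + p)) :=
  [seq (lshift p xy.1, lshift p xy.2) | xy <- m].
Definition shiftm_r (m : seq ('I_k * 'I_k)) : seq ('I_(p + k) * 'I_(p + k)) :=
  [seq (rshift p xy.1, rshift p xy.2) | xy <- m].
Definition fun_l (f : 'I_l -> 'I_k) (i : 'I_(l + p)) : 'I_(k + p) :=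
  match fintype.split i with inl a => lshift p (f a) | inr b => rshift k b end.
Definition fun_r (f : 'I_l -> 'I_k) (i : 'I_(p + l)) : 'I_(p + k) :=
  match fintype.split i with inl a => lshift k a | inr b => rshift p (f b) end.

Lemma fun_l_l f a : fun_l f (lshift p a) = lshift p (f a).
Proof. by rewrite /fun_l (unsplitK (inl a : 'I_l + 'I_p)). Qed.
Lemma fun_l_r f b : fun_l f (rshift l b) = rshift k b.
Proof. by rewrite /fun_l (unsplitK (inr b : 'I_l + 'I_p)). Qed.
Lemma fun_r_l f a : fun_r f (lshift l a) = lshift k a.
Proof. by rewrite /fun_r (unsplitK (inl a : 'I_p + 'I_l)). Qed.
Lemma fun_r_r f b : fun_r f (rshift p b) = rshift p (f b).
Proof. by rewrite /fun_r (unsplitK (inr b : 'I_p + 'I_l)). Qed.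

Lemma flatten_l m : flatten [seq [:: xy.1; xy.2] | xy <- shiftm_l m] =
  map (@lshift k p) (flatten [seq [:: xy.1; xy.2] | xy <- m]).
Proof. by elim: m => //= xy m ->. Qed.
Lemma flatten_r m : flatten [seq [:: xy.1; xy.2] | xy <- shiftm_r m] =
  map (@rshift p k) (flatten [seq [:: xy.1; xy.2] | xy <- m]).
Proof. by elim: m => //= xy m ->. Qed.

Lemma bword_l f m : bword (fun_l f) (shiftm_l m) =
  map (@lshift k p) (bword f m) ++ map (@rshift k p) (enum 'I_p).
Proof.
rewrite /bword flatten_l enum_ordD !map_cat -catA; congr (_ ++ (_ ++ _)).
  by rewrite -!map_comp; apply: eq_map => i /=; rewrite fun_l_l.
by rewrite -map_comp; apply: eq_map => i /=; rewrite fun_l_r.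
Qed.

Lemma bword_r f m : bword (fun_r f) (shiftm_r m) =
  map (@rshift p k) (flatten [seq [:: xy.1; xy.2] | xy <- m]) ++
  map (@lshift p k) (enum 'I_p) ++
  map (@rshift p k) [seq f t | t <- enum 'I_l].
Proof.
rewrite /bword flatten_r enum_ordD !map_cat; congr (_ ++ (_ ++ _)).
  by rewrite -map_comp; apply: eq_map => i /=; rewrite fun_r_l.
by rewrite -!map_comp; apply: eq_map => i /=; rewrite fun_r_r.
Qed.

Lemma count_enum q (i : 'I_q) : count_mem i (enum 'I_q) = 1%N.
Proof. by rewrite count_uniq_mem ?enum_uniq // mem_enum. Qed.

Lemma count_mem_map (T U : eqType) (h : T -> U) x s : injective h ->
  count_mem (h x) (map h s) = count_mem x s.
Proof.
by move=> hI; rewrite count_map; apply: eq_count => y /=; rewrite inj_eq.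
Qed.

Lemma count_mem_map0 (T U : eqType) (h : T -> U) x s :
  (forall y, h y != x) -> count_mem x (map h s) = 0%N.
Proof.
move=> hx; rewrite count_map; apply/eqP; rewrite eqn0Ngt -has_count.
by apply/hasPn => y _ /=; exact: hx.
Qed.

Lemma brP_l i : count_mem i (bword (fun_l (bf u)) (shiftm_l (bm u))) = 1%N.
Proof.
rewrite bword_l count_cat; case: (split_ordP i) => j ->.
  rewrite count_mem_map ?brP; last exact: lshift_inj.
  by rewrite count_mem_map0 // => y; rewrite eq_rlshift.
rewrite count_mem_map0 => [|y]; last by rewrite eq_lrshift.
by rewrite count_mem_map ?count_enum //; exact: rshift_inj.
Qed.

Lemma brP_r i : count_mem i (bword (fun_r (bf u)) (shiftm_r (bm u))) = 1%N.
Proof.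
rewrite bword_r !count_cat; case: (split_ordP i) => j ->.
  have r0 (w : seq 'I_k) : count_mem (lshift k j) (map (@rshift p k) w) = 0%N.
    by apply: count_mem_map0 => y; rewrite eq_rlshift.
  by rewrite !r0 count_mem_map ?count_enum ?addn0 //; exact: lshift_inj.
rewrite (@count_mem_map0 _ _ (@lshift p k)) => [|y]; last by rewrite eq_lrshift.
rewrite add0n !count_mem_map; [|exact: rshift_inj|exact: rshift_inj].
by rewrite -count_cat -[RHS](brP u j).
Qed.

Definition br_l : brmor (k + p) (l + p) := BrMor brP_l.
Definition br_r : brmor (p + k) (p + l) := BrMor brP_r.

Lemma map_val_l q r (w : seq 'I_q) : map val (map (@lshift q r) w) = map val w.
Proof. by rewrite -map_comp; apply: eq_map. Qed.
Lemma map_val_r q r (w : seq 'I_r) :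
  map val (map (@rshift q r) w) = map (addn q) (map val w).
Proof. by rewrite -!map_comp; apply: eq_map. Qed.

Lemma wsign_l :
  wsign (bword (bf br_l) (bm br_l)) = wsign (bword (bf u) (bm u)).
Proof.
rewrite /wsign /= bword_l map_cat map_val_l map_val_r inversions_cat.
rewrite inversions_shift val_enum_ord inversions_iota addn0 big1_seq ?addn0 //.
move=> x /= /mapP [j _ ->]; apply/eqP; rewrite eqn0Ngt -has_count.
apply/hasPn => y /mapP [z _ ->]; rewrite -leqNgt.
by rewrite (leq_trans (ltnW (ltn_ord j))) // leq_addr.
Qed.

Lemma wsign_r :
  wsign (bword (bf br_r) (bm br_r)) = wsign (bword (bf u) (bm u)).
Proof.
rewrite /wsign /= bword_r !map_cat !map_val_r map_val_l val_enum_ord.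
set a := map val (flatten _); set b := map val (map _ _).
rewrite !inversions_cat !inversions_shift inversions_iota add0n !big_map.
rewrite [X in (_ + (_ + X))%N]big1_seq => [|x]; last first.
  rewrite /= mem_iota => xp; apply/eqP; rewrite eqn0Ngt -has_count.
  apply/hasPn => y /mapP [z _ ->]; rewrite -leqNgt.
  by move: xp => /andP[_ xp]; rewrite (leq_trans (ltnW xp)) ?leq_addr.
rewrite addn0.
set w := flatten _ in a *.
have -> : (\sum_(j <- w) count (fun y => y < p + val j)
      (iota 0 p ++ [seq p + i | i <- b]) =
    2 * (size (bm u) * p) + \sum_(j <- w) count (fun y => y < val j) b)%N.
  have -> : (2 * (size (bm u) * p) = size w * p)%N.
    by rewrite mulnA; congr (_ * _)%N; rewrite /w; elim: (bm u) => //= xy m /= <-; lia.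
  elim: w {a} => [|x w IH]; first by rewrite !big_nil.
  rewrite !big_cons IH count_cat count_map /=.
  rewrite [X in (_ + X + _)%N](eq_count (a2 := fun y => y < x)%N) => [|y]; last first.
    by rewrite /= ltn_add2l.
  have -> : count (fun y => y < p + x)%N (iota 0 p) = p.
    rewrite -[RHS](size_iota 0); apply/eqP; rewrite -all_count.
    by apply/allP => y; rewrite mem_iota => /andP[_ yp]; rewrite ltn_addr.
  by rewrite mulSn; lia.
by rewrite addnCA exprD exprM sqrrN !expr1n mul1r.
Qed.

End TensorMor.

(** * The ring R^V *)

Section Ring.
Variables (n g : nat) (V : comAlgType rat) (gr : nat -> set V) (e : V).

(** The coend is taken over the skeleton of the sets ['I_k], with
    ['I_k] followed by ['I_l] as disjoint union.
    A symbol is a spanning element of the direct sum over [k] of the tensor products of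
    the dual of [K('I_k)] with labelled partitions and with [det^n 'I_k], the
    latter trivialised by its standard generator. *)
Record sym := Sym { sk : nat; sf : mform g sk; sl : lpart n gr sk }.

HB.instance Definition _ := gen_eqMixin sym.
HB.instance Definition _ := gen_choiceMixin sym.

Definition mulsym (x y : sym) : sym :=
  Sym (tensor (sf x) (sf y)) (lunion (sl x) (sl y)).
Definition onesym : sym := Sym (form1 g) (lpart0 n gr).

Lemma pmap_id k (p : part V k) (h : 'I_k -> 'I_k) : h =1 id -> pmap h p = p.
Proof.
move=> hE; case: p => -[A d] c; rewrite /pmap /psupp /=; congr (_, _, _).
by rewrite (eq_imset A hE) imset_id.
Qed.

Lemma pmap_comp k l q (h : 'I_k -> 'I_l) (h' : 'I_l -> 'I_q) (p : part V k) :
  pmap h' (pmap h p) = pmap (h' \o h) p.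
Proof. by rewrite /pmap /psupp /= -imset_comp. Qed.

Lemma eq_pmap k l (h h' : 'I_k -> 'I_l) (p : part V k) :
  h =1 h' -> pmap h p = pmap h' p.
Proof. by move=> hE; rewrite /pmap (eq_imset _ hE). Qed.

Lemma sym_eq (x y : sym) (E : sk x = sk y) :
  (forall v, sf x (fun i => v (cast_ord E i)) = sf y v) ->
  map (pmap (cast_ord E)) (sl x) = sl y :> seq _ -> x = y.
Proof.
case: x y E => [k f s] [l h t] /= E; subst l => fh st.
have -> : f = h.
  apply: mform_eq => v; rewrite -fh; congr mf.
  by apply/funext => i; rewrite cast_ord_id.
suff -> : s = t by [].
apply: lpart_eq; rewrite -st -[LHS]map_id; apply: eq_map => p.
by rewrite pmap_id // => i; rewrite cast_ord_id.
Qed.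

Lemma mulsymA : associative mulsym.
Proof.
move=> x y z; apply: (@sym_eq (mulsym x (mulsym y z)) (mulsym (mulsym x y) z) (addnA _ _ _)) => [v|] /=.
  rewrite mulrA; congr (_ * _ * _); congr mf; apply/funext => i;
    congr v; apply: val_inj => //=; by rewrite addnA.
rewrite /lcat !map_cat -!map_comp catA; congr ((_ ++ _) ++ _);
  apply: eq_map => p /=; rewrite !pmap_comp; apply: eq_pmap => i;
  apply: val_inj => //=; by rewrite addnA.
Qed.

Lemma mul1sym : left_id onesym mulsym.
Proof.
move=> x; apply: (@sym_eq (mulsym onesym x) x (add0n _)) => [v|] /=.
  by rewrite mul1r; congr mf; apply/funext => i; congr v; apply: val_inj.
rewrite /lcat /= -map_comp -[RHS]map_id; apply: eq_map => p /=.
by rewrite pmap_comp pmap_id // => i; apply: val_inj.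
Qed.

Lemma mulsym1 : right_id onesym mulsym.
Proof.
move=> x; apply: (@sym_eq (mulsym x onesym) x (addn0 _)) => [v|] /=.
  by rewrite mulr1; congr mf; apply/funext => i; congr v; apply: val_inj.
rewrite /lcat /= cats0 -map_comp -[RHS]map_id; apply: eq_map => p /=.
by rewrite pmap_comp pmap_id // => i; apply: val_inj.
Qed.

(** The vector space spanned by the symbols, with the product induced by
    disjoint union. *)
Definition symalg : Type := {malg rat[sym]}.
HB.instance Definition _ := GRing.Lmodule.on symalg.
Definition usym (x : sym) : symalg := << x >>.

Definition sym_mul : symalg -> symalg -> symalg := MonoidAlg.conv mulsym.

Lemma sym_mulPl q x y z :
  sym_mul (q *: x + y) z = q *: sym_mul x z + sym_mul y z.
Proof. exact: MonoidAlg.convPl. Qed.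
Lemma sym_mulPr q x y z :
  sym_mul x (q *: y + z) = q *: sym_mul x y + sym_mul x z.
Proof. exact: MonoidAlg.convPr. Qed.
Lemma sym_mulU i j : sym_mul (usym i) (usym j) = usym (mulsym i j).
Proof. exact: MonoidAlg.convUU. Qed.

HB.instance Definition _ := GRing.Zmodule_isNzRing.Build symalg
  (MonoidAlg.convA mulsymA sym_mulPl sym_mulPr sym_mulU)
  (MonoidAlg.conv1l mul1sym sym_mulPr sym_mulU)
  (MonoidAlg.conv1r mulsym1 sym_mulPl sym_mulU)
  (MonoidAlg.convDl sym_mulPl) (MonoidAlg.convDr sym_mulPr)
  (MonoidAlg.conv_neq0 onesym).
HB.instance Definition _ := GRing.Lmodule_isLalgebra.Build rat symalg
  (MonoidAlg.convZl sym_mulPl).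

Lemma usymM i j : usym i * usym j = usym (mulsym i j).
Proof. exact: sym_mulU. Qed.
Lemma sym_mulZr q (x y : symalg) : x * (q *: y) = q *: (x * y).
Proof.
by have := sym_mulPr q x y 0; rewrite addr0 (MonoidAlg.conv0r sym_mulPr) addr0.
Qed.

(** [usym] on possibly inadmissible labelled partitions, which vanish. *)
Definition usym0 k (phi : mform g k) (s : seq (part V k)) : symalg :=
  if pselect (is_lpart n gr s) is left sP then usym (Sym phi (LPart sP)) else 0.

(** The first three families of relations express linearity in the form and in
    the labels, and that labelled partitions are unordered; the last one is the
    coend relation. *)
Inductive coend_rel : symalg -> Prop :=
| rel_form k (phi phi1 phi2 : mform g k) q s :
    (forall v, phi v = q * phi1 v + phi2 v) ->
    coend_rel (usym (Sym phi s) - (q *: usym (Sym phi1 s) + usym (Sym phi2 s)))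
| rel_label k (phi : mform g k) (s s1 s2 : lpart n gr k) l r A d c1 c2 q :
    s = l ++ (A, d, q *: c1 + c2) :: r :> seq _ ->
    s1 = l ++ (A, d, c1) :: r :> seq _ ->
    s2 = l ++ (A, d, c2) :: r :> seq _ ->
    coend_rel (usym (Sym phi s) - (q *: usym (Sym phi s1) + usym (Sym phi s2)))
| rel_order k (phi : mform g k) (s t : lpart n gr k) :
    perm_eq s t -> coend_rel (usym (Sym phi s) - usym (Sym phi t))
| rel_coend k l (u : brmor k l) (phi : mform g l) (s : lpart n gr k) :
    coend_rel (usym (Sym (dual n u phi) s) -
      wsign (bword (bf u) (bm u)) ^+ n *: usym0 phi (act n e u s)).

Let W : symalg -> Prop := span coend_rel.

Lemma W0 : W 0. Proof. exact: (span_subspace _).1. Qed.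
Lemma WP q x y : W x -> W y -> W (q *: x + y).
Proof. exact: (span_subspace _).2. Qed.
Lemma WZ q x : W x -> W (q *: x).
Proof. by move=> h; rewrite -[_ *: _]addr0; apply: WP => //; exact: W0. Qed.
Lemma WD x y : W x -> W y -> W (x + y).
Proof. by move=> hx hy; rewrite -[x]scale1r; exact: WP. Qed.
Lemma WR x : coend_rel x -> W x.
Proof. by move=> h; exact: sub_gen_smallest. Qed.

Lemma usym0_cat_l k l phi (psi : mform g l) (s : seq (part V k)) (t : lpart n gr l) :
  usym0 phi s * usym (Sym psi t) = usym0 (tensor phi psi) (lcat s t).
Proof.
rewrite /usym0; case: pselect => sP; case: pselect => stP.
- by rewrite usymM; congr usym; congr Sym; exact: lpart_eq.
- by case: stP; apply/is_lpart_lcat; split=> //; exact: lpP.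
- by case: sP; case/is_lpart_lcat: stP.
- by rewrite mul0r.
Qed.

Lemma usym0_cat_r k l phi (psi : mform g l) (s : seq (part V k)) (t : lpart n gr l) :
  usym (Sym psi t) * usym0 phi s = usym0 (tensor psi phi) (lcat t s).
Proof.
rewrite /usym0; case: pselect => sP; case: pselect => stP.
- by rewrite usymM; congr usym; congr Sym; exact: lpart_eq.
- by case: stP; apply/is_lpart_lcat; split=> //; exact: lpP.
- by case: sP; case/is_lpart_lcat: stP.
- by rewrite mulr0.
Qed.

Lemma usym0_perm k (phi : mform g k) (s t : seq (part V k)) :
  perm_eq s t -> W (usym0 phi s - usym0 phi t).
Proof.
move=> st; rewrite /usym0; case: pselect => sP; case: pselect => tP.
- by apply: WR; exact: rel_order.
- by case: tP; exact: perm_is_lpart sP.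
- by case: sP; apply: perm_is_lpart tP; rewrite perm_sym.
- by rewrite subr0; exact: W0.
Qed.

Lemma foldl_map (T1 T2 S : Type) (f : S -> T2 -> S) (h : T1 -> T2) z s :
  foldl f z (map h s) = foldl (fun a b => f a (h b)) z s.
Proof. by elim: s z => //= x s IH z. Qed.

Lemma act_l k l p (u : brmor k l) (s : seq (part V k)) (t : seq (part V p)) :
  act n e (br_l p u) (lcat s t) = lcat (act n e u s) t.
Proof.
rewrite /act /= foldl_map /=.
have -> : foldl (fun s0 xy => contract n e (lshift p xy.1) (lshift p xy.2) s0)
    (lcat s t) (bm u) =
  lcat (foldl (fun s xy => contract n e xy.1 xy.2 s) s (bm u)) t.
  by elim: (bm u) s => //= xy m IH s; rewrite contract_lcatl IH.
rewrite /lcat map_cat -!map_comp; congr (_ ++ _); apply: eq_map => q /=.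
  rewrite /pmap /psupp /=; congr (_, _, _); apply/setP => i.
  rewrite inE; case: (split_ordP i) => j ->.
    rewrite fun_l_l !mem_imset ?inE //; exact: lshift_inj.
  rewrite fun_l_r; apply/idP/idP => /imsetP [x _ /eqP];
    by rewrite eq_rlshift.
rewrite /pmap /psupp /=; congr (_, _, _); apply/setP => i.
rewrite inE; case: (split_ordP i) => j ->.
  by rewrite fun_l_l; apply/idP/idP => /imsetP [x _ /eqP]; rewrite eq_lrshift.
by rewrite fun_l_r !mem_imset //; exact: rshift_inj.
Qed.

Lemma act_r k l p (u : brmor k l) (s : seq (part V k)) (t : seq (part V p)) :
  perm_eq (act n e (br_r p u) (lcat t s)) (lcat t (act n e u s)).
Proof.
rewrite /act /= foldl_map /=.
have fE : perm_eq
    (foldl (fun s0 xy => contract n e (rshift p xy.1) (rshift p xy.2) s0)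
      (lcat t s) (bm u))
    (lcat t (foldl (fun s xy => contract n e xy.1 xy.2 s) s (bm u))).
  elim: (bm u) s => //= xy m IH s; apply: perm_trans (IH _).
  rewrite -!(foldl_map (fun s0 xy => contract n e xy.1 xy.2 s0)
                       (fun xy => (rshift p xy.1, rshift p xy.2))).
  by apply: foldl_contract_perm; exact: contract_lcatr.
apply: perm_trans (perm_map _ fE) _; apply/permEl.
suff E (s' : seq (part V k)) :
    [seq (bf (br_r p u) @^-1: psupp q, pdeg q, plab q) | q <- lcat t s'] =
    lcat t [seq (bf u @^-1: psupp q, pdeg q, plab q) | q <- s'] by rewrite -E.
rewrite /lcat map_cat -!map_comp; congr (_ ++ _); apply: eq_map => q /=.
  rewrite /pmap /psupp /=; congr (_, _, _); apply/setP => i.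
  rewrite inE; case: (split_ordP i) => j ->.
    rewrite fun_r_l !mem_imset //; exact: lshift_inj.
  rewrite fun_r_r; apply/idP/idP => /imsetP [x _ /eqP];
    by rewrite eq_rlshift.
rewrite /pmap /psupp /=; congr (_, _, _); apply/setP => i.
rewrite inE; case: (split_ordP i) => j ->.
  by rewrite fun_r_l; apply/idP/idP => /imsetP [x _ /eqP]; rewrite eq_lrshift.
by rewrite fun_r_r !mem_imset ?inE //; exact: rshift_inj.
Qed.

Lemma coend_rel_mulr r z : coend_rel r -> W (r * usym z).
Proof.
case: z => p psi t; case.
- move=> k phi phi1 phi2 q s E; rewrite mulrBl mulrDl -scalerAl !usymM.
  by apply: WR; apply: rel_form => v /=; rewrite E mulrDl mulrA.
- move=> k phi s s1 s2 l r' A d c1 c2 q E E1 E2.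
  rewrite mulrBl mulrDl -scalerAl !usymM.
  apply: WR; apply: (@rel_label _ _ _ _ _ (map (pmap (@lshift k p)) l)
    (map (pmap (@lshift k p)) r' ++ map (pmap (@rshift k p)) t)
    (@lshift k p @: A) d c1 c2 q) => /=;
  by rewrite /lcat ?E ?E1 ?E2 map_cat -catA.
- move=> k phi s s' ss'; rewrite mulrBl !usymM.
  by apply: WR; apply: rel_order; rewrite /= /lcat perm_cat2r perm_map.
- move=> k l u phi s; rewrite mulrBl -scalerAl usym0_cat_l usymM.
  have -> : mulsym (Sym (dual n u phi) s) (Sym psi t) =
    Sym (dual n (br_l p u) (tensor phi psi)) (lunion s t).
    rewrite /mulsym /=; congr Sym; apply: mform_eq => v /=.
    rewrite big_map mulrAC; congr (_ * _ * _); congr mf; apply/funext => i.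
      by rewrite fun_l_l.
    by rewrite fun_l_r.
  have := WR (rel_coend (br_l p u) (tensor phi psi) (lunion s t)).
  by rewrite wsign_l act_l.
Qed.

Lemma coend_rel_mull r z : coend_rel r -> W (usym z * r).
Proof.
case: z => p psi t; case.
- move=> k phi phi1 phi2 q s E; rewrite mulrBr mulrDr sym_mulZr !usymM.
  by apply: WR; apply: rel_form => v /=; rewrite E mulrDr mulrCA.
- move=> k phi s s1 s2 l r' A d c1 c2 q E E1 E2.
  rewrite mulrBr mulrDr sym_mulZr !usymM.
  apply: WR; apply: (@rel_label _ _ _ _ _
    (map (pmap (@lshift p k)) t ++ map (pmap (@rshift p k)) l)
    (map (pmap (@rshift p k)) r')
    (@rshift p k @: A) d c1 c2 q) => /=;
  by rewrite /lcat ?E ?E1 ?E2 map_cat catA.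
- move=> k phi s s' ss'; rewrite mulrBr !usymM.
  by apply: WR; apply: rel_order; rewrite /= /lcat perm_cat2l perm_map.
- move=> k l u phi s; rewrite mulrBr sym_mulZr usym0_cat_r usymM.
  have -> : mulsym (Sym psi t) (Sym (dual n u phi) s) =
    Sym (dual n (br_r p u) (tensor psi phi)) (lunion t s).
    rewrite /mulsym /=; congr Sym; apply: mform_eq => v /=.
    rewrite big_map mulrA; congr (_ * _ * _); congr mf; apply/funext => i.
      by rewrite fun_r_l.
    by rewrite fun_r_r.
  set w := wsign _ ^+ n.
  have := WR (rel_coend (br_r p u) (tensor psi phi) (lunion t s)).
  rewrite wsign_r -/w => h1.
  have /(WZ w) h2 := usym0_perm (tensor psi phi) (act_r u s t).
  by have := WD h1 h2; rewrite scalerBr addrA subrK.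
Qed.

(** The subspace of relations is an ideal for the product of disjoint unions. *)
Lemma coend_rel_ideal : is_ideal (span coend_rel).
Proof.
split; first exact: span_subspace.
have indr (P : symalg -> Prop) : P 0 ->
    (forall q z x, P x -> P (q *: usym z + x)) -> forall x, P x.
  exact: MonoidAlg.malg_ind.
have Wl z : span coend_rel `<=` [set x | W (usym z * x)].
  apply: smallest_sub => [|x]; last exact: coend_rel_mull.
  split=> [|q x y hx hy] /=; first by rewrite mulr0; exact: W0.
  by rewrite mulrDr sym_mulZr; exact: WP.
have Wr z : span coend_rel `<=` [set x | W (x * usym z)].
  apply: smallest_sub => [|x]; last exact: coend_rel_mulr.
  split=> [|q x y hx hy] /=; first by rewrite mul0r; exact: W0.
  by rewrite mulrDl -scalerAl; exact: WP.
move=> a x Wx; split; elim/indr: a => [|q z a IH].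
- by rewrite mul0r; exact: W0.
- by rewrite mulrDl -scalerAl; apply: WP => //; exact: Wl.
- by rewrite mulr0; exact: W0.
- by rewrite mulrDr sym_mulZr; apply: WP => //; exact: Wr.
Qed.

Definition coend_ideal : tsideal symalg := TSIdeal coend_rel_ideal.

Definition RV : Type := (symalg // coend_ideal)%type.
HB.instance Definition _ := GRing.PzRing.on RV.
HB.instance Definition _ := GRing.Lmodule.on RV.

Definition cls_RV : symalg -> RV := \cls_coend_ideal.

Definition RV_deg (m : nat) : set RV :=
  span [set a | exists2 x : sym, lpdeg (sl x) = m & a = cls_RV (usym x)].

Definition kappa k (v : k.-tuple (H g)) (d : nat) (c : V) : RV :=
  cls_RV (usym0 (form_of n v) [:: ([set: 'I_k]%SET, d, c)]).

End Ring.

(** * The presented ring *)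

Section Presentation.
Variables (n g : nat) (V : comAlgType rat) (gr : nat -> set V) (e : V).
Variables (a ash : 'I_(g + g) -> H g).

Inductive gen : Type :=
| Gen0 d c of gr d c & (2 * n < d)%N
| Gen1 d c of gr d c & (n < d)%N & H g
| Gen3 of 3.-tuple (H g).

HB.instance Definition _ := gen_eqMixin gen.
HB.instance Definition _ := gen_choiceMixin gen.

Definition gdeg (x : gen) : nat :=
  match x with
  | Gen0 d _ _ _ => d - 2 * n
  | Gen1 d _ _ _ _ => d - n
  | Gen3 _ => n
  end.

(** The free associative algebra on the generators. *)
Definition freealg : Type := {malg rat[{fmonom gen}]}.
HB.instance Definition _ := GRing.Lalgebra.on freealg.

Definition ugen (x : gen) : freealg := << fmu x >>.

Definition k0 d c (hc : gr d c) (hd : (2 * n < d)%N) := ugen (Gen0 hc hd).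
Definition k1 d c (hc : gr d c) (hd : (n < d)%N) v := ugen (Gen1 hc hd v).
Definition k3 v1 v2 v3 := ugen (Gen3 [tuple v1; v2; v3]).

Inductive pres_rel : freealg -> Prop :=
| rel_comm x y :
    pres_rel (ugen x * ugen y - (-1) ^+ (gdeg x * gdeg y) *: (ugen y * ugen x))
| rel_lin0 d c c' q (h : gr d c) (h' : gr d c') (h'' : gr d (q *: c + c')) hd :
    pres_rel (k0 h'' hd - (q *: k0 h hd + k0 h' hd))
| rel_lin1 d c c' q (h : gr d c) (h' : gr d c') (h'' : gr d (q *: c + c')) hd v :
    pres_rel (k1 h'' hd v - (q *: k1 h hd v + k1 h' hd v))
| rel_lin1v d c (h : gr d c) hd q v w :
    pres_rel (k1 h hd (q *: v + w) - (q *: k1 h hd v + k1 h hd w))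
| rel_lin31 q v w v2 v3 :
    pres_rel (k3 (q *: v + w) v2 v3 - (q *: k3 v v2 v3 + k3 w v2 v3))
| rel_lin32 q v w v1 v3 :
    pres_rel (k3 v1 (q *: v + w) v3 - (q *: k3 v1 v v3 + k3 v1 w v3))
| rel_lin33 q v w v1 v2 :
    pres_rel (k3 v1 v2 (q *: v + w) - (q *: k3 v1 v2 v + k3 v1 v2 w))
| rel_alpha (s : 'S_3) (v : 3.-tuple (H g)) :
    pres_rel (ugen (Gen3 [tuple tnth v (s i) | i < 3]) -
              ((-1) ^+ s) ^+ n *: ugen (Gen3 v))
| rel_beta d x (hx : gr d x) hd d' y (hy : gr d' y) hd'
    (hxy : gr (d + d')%N (x * y)) hdd' :
    pres_rel (k0 hxy hdd' - \sum_i k1 hx hd (a i) * k1 hy hd' (ash i))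
| rel_gamma d x (hx : gr d x) hd d' y (hy : gr d' y) hd'
    (hxy : gr (d + d')%N (x * y)) hdd' v1 :
    pres_rel (k1 hxy hdd' v1 -
      \sum_i \sum_j k3 v1 (a j) (a i) * k1 hx hd (ash i) * k1 hy hd' (ash j))
| rel_delta (he : gr (2 * n)%N e) hn v1 :
    pres_rel (\sum_i k3 v1 (a i) (ash i) - k1 he hn v1)
| rel_epsilon v1 v2 v5 v6 :
    pres_rel (\sum_i k3 v1 v2 (a i) * k3 (ash i) v5 v6 -
              \sum_i k3 v1 v5 (a i) * k3 (ash i) v6 v2).

Definition pres_ideal : tsideal freealg := TSIdeal (ideal_gen_ideal pres_rel).

Definition Pres : Type := (freealg // pres_ideal)%type.
HB.instance Definition _ := GRing.PzRing.on Pres.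
HB.instance Definition _ := GRing.Lmodule.on Pres.

Definition cls_Pres : freealg -> Pres := \cls_pres_ideal.

Definition Pres_deg (m : nat) : set Pres :=
  span [set x | exists2 w : seq gen, (\sum_(y <- w) gdeg y)%N = m &
                  x = cls_Pres (\prod_(y <- w) ugen y)].

(** Ring maps out of a [Q]-algebra are [Q]-linear, and a ring map with these
    values is unique. *)
Definition natural_map (Phi : Pres -> RV n g gr e) : Prop :=
  [/\ forall d c (hc : gr d c) (hd : (2 * n < d)%N),
        Phi (cls_Pres (k0 hc hd)) = kappa n gr e [tuple] d c,
      forall d c (hc : gr d c) (hd : (n < d)%N) v1,
        Phi (cls_Pres (k1 hc hd v1)) = kappa n gr e [tuple v1] d c &
      forall v1 v2 v3,
        Phi (cls_Pres (k3 v1 v2 v3)) = kappa n gr e [tuple v1; v2; v3] 0 1].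

End Presentation.

(* Main.v *)
(** A labelled part with legs [v_1, ..., v_k] is evaluated in the presented ring
    as a trivalent tree: copies of [kappa_1(v (x) v' (x) v'')] are glued along
    [sum_i a_i (x) ash_i], with [kappa_c] or [kappa_c(v)] at the root when the
    label is [c] of degree [> n]. By (alpha) and (epsilon) the value is
    [(-1)^n]-symmetric in the legs, by (beta) and (gamma) gluing two trees along
    an edge multiplies their labels, and by (delta) closing up two legs
    multiplies the label by [e]. These are the coend relations, so that the
    evaluation is defined on [R^V]; as the form is nondegenerate, every element
    of [R^V] is a polynomial in the [kappa]s, which themselves satisfy the same
    gluing rules, and the evaluation is inverse to the natural map. This works in
    all degrees for all [g]. *)

From HB Require Import structures.
Require Import Defs.
From mathcomp Require Import all_boot all_order all_algebra perm generic_quotient.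
From mathcomp Require Import finmap.
From mathcomp Require Import zify ring.
From mathcomp.multinomials Require Import monalg.
From mathcomp Require Import boolp classical_sets functions.

Set Implicit Arguments.
Unset Strict Implicit.
Unset Printing Implicit Defensive.

Import GRing.Theory.
Local Open Scope classical_set_scope.
Local Open Scope ring_scope.

(** * Signs and the form *)

(** Two features shape the construction. The first is signs. For odd [n] the values of parts with an
    odd number of legs anticommute, and so do the legs in the determinant. Every evaluation is
    therefore multiplied by the sign of the word formed by all legs, part after part: exchanging two
    legs or two parts changes this sign and the product of the values alike, so the result depends
    only on the labelled partition. The second is admissibility. The splitting of V forces a
    homogeneous label of degree at most n to be a scalar, and to vanish unless its degree is 0; a
    nonzero label is thus a multiple of 1 or has degree above n. A matching is contracted one pair
    at a time, and partitions on the way can become inadmissible. The condition that survives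
    contraction bounds the degrees of nonzero labels only. An inadmissible partition that satisfies
    it contains the label 0, and both the coend and the evaluation send it to 0. *)

Lemma perm_swap_ind (T : eqType) (R : seq T -> seq T -> Prop) :
  (forall s, R s s) ->
  (forall s t u, R s t -> R t u -> R s u) ->
  (forall l x y r, R (l ++ x :: y :: r) (l ++ y :: x :: r)) ->
  forall s t, perm_eq s t -> R s t.
Proof.
move=> Rxx Rtr Rsw s t st.
(* The prefix is generalised because [R] is not assumed stable under adding letters in front. *)
suff H l : R (l ++ s) (l ++ t) by exact: (H [::]).
elim: t s st l => [|x t IH] s st l; first by move/perm_nilP: st => ->.
have [u [v Es]] : exists u v, s = u ++ x :: v.
  have xs : x \in s by rewrite (perm_mem st) mem_head.
  by case/splitPr: xs => u v; exists u, v.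
have uvt : perm_eq (u ++ v) t.
  by rewrite -(perm_cons x) -(perm_catCA u [:: x] v) -Es.
apply: (Rtr _ (l ++ x :: u ++ v)); last first.
  by rewrite -!(cat_rcons x l); exact: IH.
rewrite {}Es {st IH uvt t s}; elim: u l => [|y u IHu] l /=; first exact: Rxx.
apply: (Rtr _ (l ++ y :: x :: u ++ v)); last exact: Rsw.
by rewrite -!(cat_rcons y l); exact: IHu.
Qed.

Lemma inversions_swap l x y r : x != y ->
  odd (inversions (l ++ x :: y :: r)) = ~~ odd (inversions (l ++ y :: x :: r)).
Proof.
move=> xy; elim: l => [|z l IH] /=; last first.
  rewrite !oddD IH !count_cat /= addbN; congr (~~ (odd _ (+) _)).
  by rewrite (addnCA (x < z)%N).
have := xy; rewrite !oddD !addbA.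
move: (odd (count _ _)) (odd (count _ _)) (odd (inversions r)) => b1 b2 b3.
by case: (ltngtP x y) => //= _ _; case: b1; case: b2; case: b3.
Qed.

Section Sign.
Variable n : nat.

Local Notation eps := ((-1) ^+ n : rat).

Lemma eps_sq : eps * eps = 1.
Proof. by rewrite -expr2 sqrr_sign. Qed.

Definition esgn (w : seq nat) : rat := eps ^+ inversions w.

Lemma esgn_sq w : esgn w * esgn w = 1.
Proof. by rewrite /esgn -exprMn eps_sq expr1n. Qed.

Lemma esgn_swap l x y r : x != y ->
  esgn (l ++ x :: y :: r) = eps * esgn (l ++ y :: x :: r).
Proof.
move=> xy; rewrite /esgn -!exprM -exprD -signr_odd -[in RHS]signr_odd.
congr (_ ^+ nat_of_bool _); rewrite oddM inversions_swap // oddD oddM.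
by case: (odd n); case: (odd _).
Qed.

End Sign.

Section Lam.
Variables (n g : nat).
Implicit Types u v w : H g.

Local Notation eps := ((-1) ^+ n : rat).
Local Notation lam := (@lam n g).

Lemma lamC u v : lam u v = eps * lam v u.
Proof.
have E : (hyp_mx n g)^T = eps *: hyp_mx n g.
  rewrite /hyp_mx tr_block_mx !trmx0 trmx1 tr_scalar_mx scale_block_mx !scaler0.
  by rewrite !scale_scalar_mx eps_sq mulr1.
have -> : lam u v = (u *m hyp_mx n g *m v^T)^T 0 0 by rewrite mxE.
by rewrite !trmx_mul trmxK E -scalemxAl -scalemxAr mxE mulmxA.
Qed.

Lemma lam_nondegenerate u : (forall v, lam u v = 0) -> u = 0.
Proof.
move=> u0.
have [B AB] : exists B, hyp_mx n g *m B = 1%:M.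
  (* The inverse of [hyp_mx], since (-1)^n squares to 1. *)
  exists (block_mx 0 eps%:M 1%:M 0).
  rewrite /hyp_mx mulmx_block !(mul0mx, mulmx0, mul1mx, mulmx1, addr0, add0r).
  by rewrite -scalar_mxM eps_sq -scalar_mx_block.
rewrite -[u]mulmx1 -AB mulmxA; suff -> : u *m hyp_mx n g = 0 by rewrite mul0mx.
apply/rowP => j; have := u0 (delta_mx 0 j).
by rewrite /lam trmx_delta -colE !mxE.
Qed.

Lemma lam0l v : lam 0 v = 0.
Proof. by have := lamPl n (-1) 0 0 v; rewrite scaler0 addr0 mulN1r addNr. Qed.

Lemma lam_suml (I : Type) (r : seq I) (q : I -> rat) (x : I -> H g) v :
  lam (\sum_(i <- r) q i *: x i) v = \sum_(i <- r) q i * lam (x i) v.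
Proof.
elim: r => [|i r IH]; first by rewrite !big_nil lam0l.
by rewrite !big_cons lamPl IH.
Qed.

Section DualBases.
Variables a ash : 'I_(g + g) -> H g.
Hypothesis (ab : basis_of fullv [tuple a i | i < g + g]).
Hypothesis (adual : forall i j, lam (ash i) (a j) = (i == j)%:R).

Lemma expand_a u : u = \sum_i lam (ash i) u *: a i.
Proof.
have [q uE] : exists q : 'I_(g + g) -> rat, u = \sum_i q i *: a i.
  exists (fun i => coord [tuple a i | i < g + g] i u).
  rewrite {1}(coord_basis ab (memvf u)); apply: eq_bigr => i _.
  by rewrite -tnth_nth tnth_mktuple.
rewrite {1}uE; apply: eq_bigr => i _; congr (_ *: _).
rewrite {1}uE lamC lam_suml mulr_sumr (bigD1 i) //= big1 => [|j ji].
  by rewrite addr0 mulrCA -lamC adual eqxx mulr1.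
by rewrite mulrCA -lamC adual eq_sym (negbTE ji) mulr0.
Qed.

(** Nothing but [adual] is assumed of [ash]: the difference of the two sides pairs to 0 with every
    [a i], and nondegeneracy concludes. *)
Lemma expand_ash u : u = \sum_i lam u (a i) *: ash i.
Proof.
apply/eqP; rewrite -subr_eq0; apply/eqP/lam_nondegenerate => v.
rewrite (expand_a v) lamC lam_suml big1 ?mulr0 // => i _.
rewrite [lam (a i) _]lamC -[u in u - _]scale1r addrC -scaleN1r.
rewrite lamPl scale1r lam_suml (bigD1 i) //= adual eqxx mulr1 big1.
  by rewrite addr0 mulN1r addNr !mulr0.
by move=> j ji; rewrite adual (negbTE ji) mulr0.
Qed.

(** The tensor of the dual bases represents the form with its arguments exchanged. Contracting a
    matched pair [(x, y)] by [lam (v_y) (v_x)] therefore inserts [a i] at [x] and [ash i] at [y],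
    without a sign. *)
Lemma sum_lam_dual u v : \sum_i lam (a i) u * lam (ash i) v = lam v u.
Proof.
rewrite {2}(expand_a v) lam_suml; apply: eq_bigr => i _; exact: mulrC.
Qed.

End DualBases.
End Lam.

(** * Trees *)

Section Homogeneous.
Variables (P : algType rat) (isgen : bool -> P -> Prop).
Hypothesis isgenC : forall b b' x y, isgen b x -> isgen b' y ->
  x * y = (-1) ^+ (b && b') *: (y * x).

(* The boolean is the parity of the degree. *)
Inductive hom : bool -> P -> Prop :=
| hom_gen b x : isgen b x -> hom b x
| hom1 : hom false 1
| homM b b' x y : hom b x -> hom b' y -> hom (b (+) b') (x * y)
| homP b q x y : hom b x -> hom b y -> hom b (q *: x + y)
| hom0 b : hom b 0.

(** Commutation passes from factors to a product on the left by [mul]; [flip] transfers this rule to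
    the other side, so one computation serves both inductions. *)
Lemma hom_comm b b' x y : hom b x -> hom b' y ->
  x * y = (-1) ^+ (b && b') *: (y * x).
Proof.
have sq (b1 : bool) : (-1) ^+ b1 * (-1) ^+ b1 = 1 :> rat by case: b1; rewrite /= ?mulNr ?mul1r ?opprK.
have flip b1 b2 (u v : P) : u * v = (-1) ^+ (b1 && b2) *: (v * u) ->
    v * u = (-1) ^+ (b2 && b1) *: (u * v).
  by move=> ->; rewrite scalerA andbC sq scale1r.
have mul b0 b1 b2 (u v w : P) : u * w = (-1) ^+ (b0 && b2) *: (w * u) ->
    v * w = (-1) ^+ (b1 && b2) *: (w * v) ->
    u * v * w = (-1) ^+ ((b0 (+) b1) && b2) *: (w * (u * v)).
  move=> uw vw; rewrite -mulrA vw -scalerAr (mulrA u) uw -scalerAl scalerA -mulrA.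
  congr (_ *: _); case: b0 {uw}; case: b1 {vw}; case: b2 => //=;
    by rewrite ?mulNr ?mul1r ?opprK.
move=> hx; elim: hx b' y => {b x} [b x gx||b b1 x x' _ IH _ IH'|b q x x' _ IH _ IH'|b] b' y hy.
- elim: hy => {b' y} [b' y gy||b1 b2 y y' _ IH _ IH'|b1 q y y' _ IH _ IH'|b1].
  + exact: isgenC.
  + by rewrite andbF scale1r mulr1 mul1r.
  + by apply: (flip); apply: (mul); apply: (flip).
  + by rewrite mulrDr -scalerAr IH IH' mulrDl -scalerAl scalerDr !scalerA mulrC.
  + by rewrite mulr0 mul0r scaler0.
- by rewrite scale1r mulr1 mul1r.
- by apply: (mul); [exact: IH|exact: IH'].
- rewrite mulrDl -scalerAl (IH _ _ hy) (IH' _ _ hy) mulrDr -scalerAr scalerDr.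
  by rewrite !scalerA mulrC.
- by rewrite mulr0 mul0r scaler0.
Qed.

Lemma hom_sum b (I : Type) (r : seq I) (F : I -> P) :
  (forall i, hom b (F i)) -> hom b (\sum_(i <- r) F i).
Proof.
move=> hF; elim: r => [|i r IH]; first by rewrite big_nil; exact: hom0.
by rewrite big_cons -[F i]scale1r; apply: homP.
Qed.

End Homogeneous.

Lemma linear_sumZ (U W : lmodType rat) (f : U -> W) :
  (forall q x y, f (q *: x + y) = q *: f x + f y) ->
  forall (I : Type) (r : seq I) (q : I -> rat) (x : I -> U),
  f (\sum_(i <- r) q i *: x i) = \sum_(i <- r) q i *: f (x i).
Proof.
move=> fP I r q x; elim: r => [|i r IH].
  by rewrite !big_nil; have := fP (-1) 0 0; rewrite !scaleN1r !addNr.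
by rewrite !big_cons fP IH.
Qed.

(** * The scalar part of a label *)

Section Augmentation.
Variables (n : nat) (V : comAlgType rat) (gr : nat -> set V).
Hypotheses (hgr : even_grading gr) (hV : unit_plus_gt gr n).

(** The coordinate of 1 in the splitting of V, picked by choice; [aug_unique] pins it down. *)
Definition aug (c : V) : rat := projT1 (cid (hV.1 c)).

Lemma augP c : gr_gt gr n (c - (aug c)%:A).
Proof.
have [y [hy cE]] := projT2 (cid (hV.1 c)).
by have -> : c - (aug c)%:A = y by rewrite {1}cE -/(aug c) addrC addKr.
Qed.

Lemma aug_unique c q y : gr_gt gr n y -> c = q%:A + y -> aug c = q.
Proof.
move=> hy cE; apply/eqP; rewrite -subr_eq0; apply/eqP.
have sub := span_subspace [set x | exists2 d, (n < d)%N & gr d x].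
have h : gr_gt gr n ((-1) *: y + (c - (aug c)%:A)) by apply: sub.2 => //; exact: augP.
have E : (aug c - q)%:A + ((-1) *: y + (c - (aug c)%:A)) = 0.
  by rewrite scalerBl scaleN1r; set u := (aug c)%:A; rewrite cE; ring.
by have [-> _] := hV.2 _ _ h E.
Qed.

Lemma aug_linear q c c' : aug (q *: c + c') = q * aug c + aug c'.
Proof.
have sub := span_subspace [set x | exists2 d, (n < d)%N & gr d x].
apply: (aug_unique (y := q *: (c - (aug c)%:A) + (c' - (aug c')%:A))).
  by apply: sub.2; exact: augP.
by rewrite scalerDl -scalerA addrACA -scalerDr !(addrC _%:A) !subrK.
Qed.

Lemma aug_scalar q : aug q%:A = q.
Proof.
apply: (aug_unique (y := 0)); last by rewrite addr0.
exact: (span_subspace _).1.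
Qed.

(** [gr_gt] is only a span; this recovers homogeneous components. The equation is required for all
    larger [M] too, so that decompositions of different lengths can be added. *)
Lemma gr_gt_sum z : gr_gt gr n z -> exists N (f : nat -> V),
  [/\ forall d, gr d (f d), forall d, (d <= n)%N -> f d = 0 &
      forall M, (N <= M)%N -> z = \sum_(d < M) f d].
Proof.
pose Y : set V := fun y => exists N (f : nat -> V),
  [/\ forall d, gr d (f d), forall d, (d <= n)%N -> f d = 0 &
      forall M, (N <= M)%N -> y = \sum_(d < M) f d].
suff : gr_gt gr n `<=` Y by exact.
apply: smallest_sub => [|y [d0 nd0 yd0]].
  split=> [|q x y [N [f [f1 f2 f3]]] [N' [f' [f1' f2' f3']]]].
    exists 0%N, (fun=> 0); split=> // [d|M _]; first exact: (gr_subspace hgr d).1.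
    by rewrite big1.
  exists (maxn N N'), (fun d => q *: f d + f' d); split=> [d|d dn|M].
  - exact: (gr_subspace hgr d).2.
  - by rewrite f2 // f2' // scaler0 addr0.
  - rewrite geq_max => /andP[h h'].
    by rewrite (f3 _ h) (f3' _ h') scaler_sumr -big_split.
exists d0.+1, (fun d => if d == d0 then y else 0); split=> [d|d dn|M].
- by case: eqP => [->|_] //; exact: (gr_subspace hgr d).1.
- by case: eqP => // dd; move: nd0; rewrite -dd ltnNge dn.
- move=> h; rewrite (bigD1 (Ordinal h)) //= eqxx big1 ?addr0 // => i.
  by rewrite -val_eqE /= => /negbTE ->.
Qed.

Lemma gr_low d c : gr d c -> (d <= n)%N -> c = (aug c)%:A /\ (d = 0%N \/ c = 0).
Proof.
move=> hc dn; set q := aug c.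
have [N [f [f1 f2 f3]]] := gr_gt_sum (augP c).
(* Degree by degree, [c] minus its scalar part minus its part above degree [n]. These terms are
   homogeneous and sum to 0, so each of them vanishes; degrees 0 and [d] are then compared. *)
pose h k : V := (if k == d then c else 0) - (if k == 0%N then q%:A else 0) - f k.
have hP k : gr k (h k).
  have sk := gr_subspace hgr k.
  have B x y : gr k x -> gr k y -> gr k (x - y).
    by move=> hx hy; rewrite addrC -scaleN1r; apply: sk.2.
  apply: (B) => //; apply: (B); case: eqP => [->|_] //; try exact: sk.1.
  have := (gr_subspace hgr 0%N).2 q 1 0 (gr_one hgr) (gr_subspace hgr 0%N).1.
  by rewrite addr0.
pose M := maxn N n.+1.
have M0 k : (k <= n)%N -> (k < M)%N by move=> kn; rewrite leq_max ltnS kn orbT.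
have s0 : \sum_(k < M) h k = 0.
  rewrite !sumrB -f3 ?leq_maxl //.
  rewrite (bigD1 (Ordinal (M0 _ dn))) //= eqxx big1 => [|i]; last first.
    by rewrite -val_eqE /= => /negbTE ->.
  rewrite (bigD1 (Ordinal (M0 0%N isT))) //= big1 => [|i]; last first.
    by rewrite -val_eqE /= => /negbTE ->.
  by rewrite !addr0 subrr.
have h0 k : (k <= n)%N -> h k = 0 by move=> kn; apply: (gr_direct hgr hP s0 (M0 _ kn)).
have := h0 0%N isT; have := h0 d dn; rewrite /h eqxx !f2 // !subr0.
case: (d =P 0%N) => [->|d0] /=; first by move=> /eqP; rewrite subr_eq0 => /eqP <- _; split=> //; left.
rewrite subr0 => c0; rewrite eq_sym; case: eqP => // _.
by rewrite sub0r => /eqP; rewrite oppr_eq0 => /eqP ->; split=> //; right.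
Qed.

End Augmentation.

(** * Trivalent trees and their gluing rules *)

Section Trees.
Variables (n g : nat) (V : comAlgType rat) (gr : nat -> set V) (e : V).
Hypothesis (n_gt0 : (0 < n)%N).
Hypothesis (hgr : even_grading gr) (he : gr (2 * n)%N e).
Variables a ash : 'I_(g + g) -> H g.
Hypothesis (ab : basis_of fullv [tuple a i | i < g + g]).
Hypothesis (adual : forall i j, lam n (ash i) (a j) = (i == j)%:R).

Local Notation eps := ((-1) ^+ n : rat).
Local Notation lam := (@lam n g).

Variables (P : algType rat) (K0 : nat -> V -> P) (K1 : nat -> V -> H g -> P).
Variables (K3 : H g -> H g -> H g -> P) (isgen : bool -> P -> Prop).
Hypothesis isgenC : forall b b' x y, isgen b x -> isgen b' y ->
  x * y = (-1) ^+ (b && b') *: (y * x).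
Local Notation hom := (hom isgen).
Hypothesis K0hom : forall d c, gr d c -> ~~ odd d -> hom false (K0 d c).
Hypothesis K1hom : forall d c v, gr d c -> (n < d)%N -> ~~ odd d ->
  hom (odd n) (K1 d c v).
Hypothesis K3hom : forall x y z, hom (odd n) (K3 x y z).
Hypothesis K0lin : forall d c c' q, gr d c -> gr d c' ->
  K0 d (q *: c + c') = q *: K0 d c + K0 d c'.
Hypothesis K1lin : forall d c c' q v, gr d c -> gr d c' ->
  K1 d (q *: c + c') v = q *: K1 d c v + K1 d c' v.
Hypothesis K1linv : forall d c q v w,
  K1 d c (q *: v + w) = q *: K1 d c v + K1 d c w.
Hypothesis K3lin1 : forall q v w y z,
  K3 (q *: v + w) y z = q *: K3 v y z + K3 w y z.
Hypothesis K3lin2 : forall q v w x z,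
  K3 x (q *: v + w) z = q *: K3 x v z + K3 x w z.
Hypothesis K3lin3 : forall q v w x y,
  K3 x y (q *: v + w) = q *: K3 x y v + K3 x y w.
Hypothesis K3C12 : forall x y z, K3 x y z = eps *: K3 y x z.
Hypothesis K3C23 : forall x y z, K3 x y z = eps *: K3 x z y.
Hypothesis Kbeta : forall d x d' y,
  gr d x -> (n < d)%N -> gr d' y -> (n < d')%N ->
  K0 (d + d') (x * y) = \sum_i K1 d x (a i) * K1 d' y (ash i).
Hypothesis Kgamma : forall d x d' y v,
  gr d x -> (n < d)%N -> gr d' y -> (n < d')%N ->
  K1 (d + d') (x * y) v =
  \sum_i \sum_j K3 v (a j) (a i) * K1 d x (ash i) * K1 d' y (ash j).
Hypothesis Kdelta : forall v, \sum_i K3 v (a i) (ash i) = K1 (2 * n) e v.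
Hypothesis Keps : forall v1 v2 v5 v6,
  \sum_i K3 v1 v2 (a i) * K3 (ash i) v5 v6 =
  \sum_i K3 v1 v5 (a i) * K3 (ash i) v6 v2.

(* [None] is the label [1], [Some (d, c)] a label of degree [d > n]. *)
Definition vlabel : Type := option (nat * V).

Definition okl (l : vlabel) : Prop :=
  if l is Some dc then [/\ gr dc.1 dc.2, (n < dc.1)%N & ~~ odd dc.1] else True.

Definition mull (l l' : vlabel) : vlabel :=
  match l, l' with
  | Some dc, Some dc' => Some ((dc.1 + dc'.1)%N, dc.2 * dc'.2)
  | None, _ => l'
  | _, None => l
  end.

(** The label 1 on a single leg is never admissible. Its value 0 is a default, which [deep] keeps
    out of the gluing rules. *)
Definition root (l : vlabel) (h : H g) : P :=
  if l is Some dc then K1 dc.1 dc.2 h else 0.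

(* The label [1] on two legs is not allowed in the coend; giving it the value
   [lam] makes it a unit for gluing, so that all trees obey one recursion. *)
Fixpoint tr (l : vlabel) (h : H g) (w : seq (H g)) : P :=
  match w with
  | [::] => root l h
  | x :: w' =>
      if (w' == [::]) && (l == None) then lam h x *: 1
      else \sum_i K3 h x (a i) * tr l (ash i) w'
  end.

Definition tree (l : vlabel) (w : seq (H g)) : P :=
  if w is h :: w' then tr l h w'
  else if l is Some dc then K0 dc.1 dc.2 else 0.

(** False only for the label 1 without legs. So [deep l w] ensures that the tree on [x :: y :: w] is
    not the unit [lam x y], and that the tree on [x :: w] is not the default 0. *)
Definition deep (l : vlabel) (w : seq (H g)) : bool := (l != None) || (w != [::]).

Lemma tree2 x y : tree None [:: x; y] = lam x y *: 1.
Proof. by []. Qed.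

Lemma treeE l x y w : deep l w ->
  tree l (x :: y :: w) = \sum_i K3 x y (a i) * tree l (ash i :: w).
Proof. by rewrite /deep /= andbC; case: l; case: w. Qed.

Lemma tree_linear l u r q v w :
  tree l (u ++ (q *: v + w) :: r) =
  q *: tree l (u ++ v :: r) + tree l (u ++ w :: r).
Proof.
have headP r' : forall q v w,
    tree l ((q *: v + w) :: r') = q *: tree l (v :: r') + tree l (w :: r').
  case: r' => [|x r'] q' v' w'.
    by case: l => [[d c]|] /=; rewrite ?K1linv // scaler0 addr0.
  have [dp|] := boolP (deep l r'); last first.
    by case: l r' => [[d c]|] [|y r'] //= _; rewrite lamPl scalerDl scalerA.
  rewrite !treeE // scaler_sumr -big_split; apply: eq_bigr => i _ /=.
  by rewrite K3lin1 mulrDl scalerAl.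
case: u => [|h u]; first exact: headP.
elim: u h => [|x u IH] h; rewrite !cat_cons ?cat0s.
  have [dp|] := boolP (deep l r); last first.
    by case: l r {headP} => [[d c]|] [|y r'] //= _; rewrite lamPr scalerDl scalerA.
  rewrite !treeE //.
  rewrite scaler_sumr -big_split; apply: eq_bigr => i _ /=.
  by rewrite K3lin2 mulrDl scalerAl.
have dp z : deep l (u ++ z :: r) by rewrite /deep -size_eq0 size_cat addnS orbT.
rewrite !(treeE h x (dp _)) scaler_sumr -big_split; apply: eq_bigr => i _.
by rewrite -!cat_cons IH mulrDr scalerAr.
Qed.

Lemma tree_sum l u r (I : Type) (s : seq I) q v :
  tree l (u ++ (\sum_(i <- s) q i *: v i) :: r) =
  \sum_(i <- s) q i *: tree l (u ++ v i :: r).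
Proof. by apply: (linear_sumZ (f := fun v => tree l (u ++ v :: r))) => *; exact: tree_linear. Qed.

Lemma tree_contract_l l u r v :
  \sum_i lam v (a i) *: tree l (u ++ ash i :: r) = tree l (u ++ v :: r).
Proof. by rewrite -tree_sum -(expand_ash ab adual v). Qed.

Let Q x y z t := \sum_i K3 x y (a i) * K3 (ash i) z t.

Lemma tree3 x y z : tree None [:: x; y; z] = K3 x y z.
Proof.
rewrite treeE //; under eq_bigr do rewrite tree2 -scalerAr mulr1.
rewrite -(linear_sumZ (f := K3 x y)) => [|*]; last exact: K3lin3.
by rewrite -(expand_a ab adual).
Qed.

(** The recursion exposes the first two legs, which the symmetry of [K3] exchanges. The second and
    third legs hang on two adjacent vertices, which form [Q]: (epsilon) rotates its last three
    arguments, and a swap at the second vertex then yields the exchange. Later pairs are reached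
    through the recursion. *)
Lemma tree_swap l u x y r :
  tree l (u ++ x :: y :: r) = eps *: tree l (u ++ y :: x :: r).
Proof.
have swap01 x' y' r' : tree l (x' :: y' :: r') = eps *: tree l (y' :: x' :: r').
  have [dp|] := boolP (deep l r'); last first.
    by case: l r' => [[d c]|] [|z r'] //= _; rewrite lamC scalerA.
  rewrite !treeE // scaler_sumr; apply: eq_bigr => i _.
  by rewrite [in LHS]K3C12 scalerAl.
have swap12 z x' y' r' :
    tree l (z :: x' :: y' :: r') = eps *: tree l (z :: y' :: x' :: r').
  rewrite !treeE; [|by rewrite /deep orbT|by rewrite /deep orbT].
  have [dp|] := boolP (deep l r'); last first.
    case: l r' {swap01} => [[d c]|] [|t r'] //= _.
    by have := K3C23 z x' y'; rewrite -!tree3 !treeE.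
  have QE v w : \sum_i K3 z v (a i) * tree l (ash i :: w :: r') =
      \sum_j Q z v w (a j) * tree l (ash j :: r').
    under eq_bigr do rewrite treeE // mulr_sumr.
    rewrite exchange_big; apply: eq_bigr => j _ /=.
    by rewrite mulr_suml; apply: eq_bigr => i _; rewrite mulrA.
  rewrite !QE scaler_sumr; apply: eq_bigr => j _; rewrite scalerAl.
  congr (_ * _); rewrite /Q Keps scaler_sumr; apply: eq_bigr => i _.
  by rewrite [in LHS](K3C23 (ash i)) scalerAr.
case: u => [|h u]; first exact: swap01.
elim: u h => [|z u IH] h; first exact: swap12.
have dp v w : deep l (u ++ v :: w) by rewrite /deep -size_eq0 size_cat addnS orbT.
rewrite !cat_cons !(treeE h z (dp _ _)) scaler_sumr; apply: eq_bigr => i _.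
by rewrite -!cat_cons IH scalerAr.
Qed.

(** Labels have even degree, so only the legs contribute to the parity, each of them [n]. *)
Lemma tree_hom l w : okl l -> hom (odd n && odd (size w)) (tree l w).
Proof.
move=> okll; case: w => [|h w].
  by rewrite andbF; case: l okll => [[d c]|] /=; [case=> *; exact: K0hom|move=> _; exact: hom0].
elim: w h => [|x w IH] h.
  rewrite /= andbT; case: l okll => [[d c]|] /=; last by move=> _; exact: hom0.
  by case=> *; exact: K1hom.
have [dp|] := boolP (deep l w); last first.
  case: l w {okll IH} => [[d c]|] [|z w] //= _; rewrite andbF -[_ *: _]addr0.
  by apply: homP; [exact: hom1|exact: hom0].
rewrite treeE //; apply: hom_sum => i.
have -> : odd n && odd (size (h :: x :: w)) =
    odd n (+) (odd n && odd (size (ash i :: w))).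
  by rewrite /=; case: (odd n); case: (odd (size w)).
by apply: homM => //; exact: IH.
Qed.

Lemma tree_comm l l' w w' : okl l -> okl l' ->
  tree l w * tree l' w' = eps ^+ (size w * size w') *: (tree l' w' * tree l w).
Proof.
move=> ok ok'; rewrite (hom_comm isgenC (tree_hom w ok) (tree_hom w' ok')).
congr (_ *: _); rewrite -exprM -[RHS]signr_odd !oddM.
by case: (odd n); rewrite ?andbF.
Qed.

Lemma tree_perm1 l u x w r :
  tree l (u ++ x :: w ++ r) = eps ^+ size w *: tree l (u ++ w ++ x :: r).
Proof.
elim: w u => [|y w IH] u; first by rewrite scale1r.
by rewrite /= tree_swap -cat_rcons IH scalerA exprS cat_rcons.
Qed.

Lemma tree_block l p u w r : tree l (p ++ u ++ w ++ r) =
  eps ^+ (size u * size w) *: tree l (p ++ w ++ u ++ r).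
Proof.
elim: u p => [|x u IH] p; first by rewrite scale1r.
rewrite !cat_cons -cat_rcons IH cat_rcons tree_perm1 scalerA -exprD.
by rewrite mulSn addnC.
Qed.

(** Expanding [ash] in [a] on both sides gives the Gram matrix of [ash] with its indices exchanged,
    hence the sign of the form. *)
Lemma dual_swap (B : H g -> H g -> P) :
  (forall q x y v, B (q *: x + y) v = q *: B x v + B y v) ->
  (forall q x y v, B v (q *: x + y) = q *: B v x + B v y) ->
  \sum_i B (a i) (ash i) = eps *: \sum_i B (ash i) (a i).
Proof.
move=> Bl Br.
have El i : B (ash i) (a i) = \sum_j lam (ash j) (ash i) *: B (a j) (a i).
  rewrite -(linear_sumZ (f := fun v => B v (a i))) => [|*]; last exact: Bl.
  by rewrite -(expand_a ab adual).
have Er i : B (a i) (ash i) = \sum_j lam (ash j) (ash i) *: B (a i) (a j).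
  rewrite -(linear_sumZ (f := B (a i))) => [|*]; last exact: Br.
  by rewrite -(expand_a ab adual).
under eq_bigr do rewrite Er; under [in RHS]eq_bigr do rewrite El.
rewrite exchange_big scaler_sumr; apply: eq_bigr => i _ /=.
by rewrite scaler_sumr; apply: eq_bigr => j _; rewrite scalerA -lamC.
Qed.

Arguments tree l w : simpl never.

Let Gl l l' w1 w2 :=
  \sum_i tree l (rcons w1 (a i)) * tree l' (ash i :: w2) =
  tree (mull l l') (w1 ++ w2).

Lemma mullC l l' : mull l l' = mull l' l.
Proof. by case: l l' => [[d c]|] [[d' c']|] //=; rewrite addnC mulrC. Qed.

(** Only the last leg of the first tree is glued, so its leading vertices are carried along and one
    free leg suffices. *)
Let Gl_ind l l' w2 : deep l' w2 -> (forall v, Gl l l' [:: v] w2) ->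
  forall v w1, Gl l l' (v :: w1) w2.
Proof.
move=> dp base v w1; elim: w1 v => [|y w1 IH] v //.
have dp2 : deep (mull l l') (w1 ++ w2).
  move: dp; rewrite /deep -!size_eq0 size_cat addn_eq0.
  by case: l' {base IH} l => [[d c]|] [[d' c']|] //= /negbTE ->; rewrite andbF.
rewrite /Gl !cat_cons treeE //; under [RHS]eq_bigr do rewrite -cat_cons -IH mulr_sumr.
rewrite exchange_big; apply: eq_bigr => i _ /=.
rewrite treeE; last by rewrite /deep -size_eq0 size_rcons orbT.
by rewrite mulr_suml; apply: eq_bigr => j _; rewrite mulrA.
Qed.

(** Signs arise from commuting the two trees, from moving each glued leg to the other end of its
    list, from exchanging the dual bases and from exchanging the blocks of free legs. They
    cancel. *)
Let Gl_flip l l' w1 w2 : okl l -> okl l' -> Gl l' l w2 w1 -> Gl l l' w1 w2.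
Proof.
move=> ok ok'; rewrite /Gl => G.
have E i : tree l (rcons w1 (a i)) * tree l' (ash i :: w2) =
    eps ^+ ((size w1).+1 * (size w2).+1 + size w2 + size w1) *:
      (tree l' (rcons w2 (ash i)) * tree l (a i :: w1)).
  rewrite tree_comm // size_rcons /=.
  have := tree_perm1 l' [::] (ash i) w2 [::]; rewrite !cat0s cats0 cats1 => ->.
  have := tree_perm1 l [::] (a i) w1 [::]; rewrite !cat0s cats0 cats1 => ->.
  rewrite -scalerAl -!scalerAr !scalerA -!exprD; congr (_ *: _).
  rewrite -exprM -[RHS]exprM -signr_odd -[RHS]signr_odd; congr (_ ^+ nat_of_bool _).
  by rewrite !(oddM, oddD) /=; case: (odd n); case: (odd (size w1)); case: (odd (size w2)).
under eq_bigr do rewrite E.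
rewrite -scaler_sumr (dual_swap (B := fun u v => tree l' (rcons w2 v) * tree l (u :: w1))).
- rewrite G scalerA -[w2 ++ w1]cats0 -catA -[w2 ++ w1 ++ _]cat0s tree_block.
  rewrite cat0s cats0 scalerA mullC -{2}[eps]expr1 -!exprD -[RHS]scale1r.
  congr (_ *: _); rewrite -exprM -signr_odd oddM.
  set m := (_ + _)%N; suff -> : odd m = false by rewrite andbF.
  by rewrite /m !(oddD, oddM) /=; case: (odd (size w1)); case: (odd (size w2)).
- move=> q x y v; have := tree_linear l [::] w1 q x y.
  by rewrite !cat0s => ->; rewrite mulrDr scalerAr.
- move=> q x y v; have := tree_linear l' w2 [::] q x y.
  by rewrite !cats1 => ->; rewrite mulrDl scalerAl.
Qed.

Lemma tree_glue l l' w1 w2 : okl l -> okl l' -> deep l w1 -> deep l' w2 ->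
  \sum_i tree l (rcons w1 (a i)) * tree l' (ash i :: w2) =
  tree (mull l l') (w1 ++ w2).
Proof.
(* A tree with label 1 is reduced to the one with two legs, whose value [lam] is a unit for
   gluing. *)
have GN l0 v w w0 : deep l0 w0 -> Gl None l0 (v :: w) w0.
  move=> dp; apply: Gl_ind => // {}v; rewrite /Gl /=.
  under eq_bigr do rewrite tree2 -scalerAl mul1r.
  exact: (tree_contract_l l0 [::] w0 v).
move=> ok ok'; rewrite -/(Gl l l' w1 w2).
case: l' ok' => [[d' c']|] ok' dp dp'; last first.
  by case: w2 dp' => // v w _; apply: Gl_flip => //; apply: GN.
case: l ok dp => [[d c]|] ok dp; last by case: w1 dp => // v w _; apply: GN.
have [cd nd _] := ok; have [cd' nd' _] := ok'.
(* Both labels have degree above [n]. Each leg of [w2] is passed to the first tree: the top vertex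
   of the second tree is itself a tree with label 1, and can be glued to the first one. When [w2] is
   empty, (beta) and (gamma) are the starting cases. *)
elim: w2 w1 {dp dp'} => [|y w2 IH] w1.
  case: w1 => [|v w1]; first by rewrite /Gl /tree /= -Kbeta.
  apply: Gl_ind => // {}v; rewrite /Gl /tree /= Kgamma // exchange_big.
  by apply: eq_bigr => i _; rewrite mulr_suml.
have := IH (rcons w1 y); rewrite /Gl cat_rcons => <-.
under eq_bigr do rewrite treeE // mulr_sumr.
rewrite exchange_big; apply: eq_bigr => j _ /=.
under eq_bigr do rewrite mulrA; rewrite -mulr_suml; congr (_ * _).
under eq_bigr do rewrite -tree3.
rewrite -[X in tree _ X]cats1 cat_rcons.
by apply: Gl_flip => //; apply: GN.
Qed.

(** The two legs meet at the top vertex; by (delta) closing it leaves [K1 (2 * n) e], which is then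
    glued to the rest. *)
Lemma tree_loop l w : okl l -> deep l w ->
  \sum_i tree l (a i :: ash i :: w) = tree (mull (Some ((2 * n)%N, e)) l) w.
Proof.
move=> ok dp; have ok2 : okl (Some ((2 * n)%N, e)).
  by split=> //=; [lia|rewrite oddM].
rewrite -[w in RHS]cat0s -(tree_glue (w1 := [::])) //.
under eq_bigr do rewrite treeE //.
rewrite exchange_big; apply: eq_bigr => j _ /=; rewrite -mulr_suml; congr (_ * _).
rewrite -[RHS]/(K1 (2 * n) e (a j)) -Kdelta; apply: eq_bigr => i _.
by rewrite K3C23 K3C12 scalerA eps_sq scale1r.
Qed.

Hypothesis (hV : unit_plus_gt gr n).

(** In degrees at most [n] a homogeneous label is a scalar, and its tree is that multiple of the
    tree with label 1. *)
Definition ptree d c w : P :=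
  if (n < d)%N then tree (Some (d, c)) w else aug hV c *: tree None w.

Lemma tree_label d c c' q w : gr d c -> gr d c' -> (n < d)%N ->
  tree (Some (d, q *: c + c')) w =
  q *: tree (Some (d, c)) w + tree (Some (d, c')) w.
Proof.
move=> hc hc' nd; case: w => [|h w]; first exact: K0lin.
elim: w h => [|x w IH] h; first exact: K1lin.
rewrite !treeE // scaler_sumr -big_split; apply: eq_bigr => i _.
by rewrite IH mulrDr scalerAr.
Qed.

Lemma ptree_label d c c' q w : gr d c -> gr d c' ->
  ptree d (q *: c + c') w = q *: ptree d c w + ptree d c' w.
Proof.
rewrite /ptree; case: ifP => nd hc hc'; first exact: tree_label.
by rewrite aug_linear scalerDl scalerA.
Qed.

Lemma ptree0 d w : ptree d 0 w = 0.
Proof.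
have h := (gr_subspace hgr d).1.
by have := ptree_label (-1) w h h; rewrite !scaleN1r !addNr.
Qed.

Lemma ptree_linear d c u r q v w :
  ptree d c (u ++ (q *: v + w) :: r) =
  q *: ptree d c (u ++ v :: r) + ptree d c (u ++ w :: r).
Proof.
rewrite /ptree; case: ifP => _; rewrite tree_linear //.
by rewrite scalerDr !scalerA mulrC.
Qed.

Lemma ptree_swap d c u x y r :
  ptree d c (u ++ x :: y :: r) = eps *: ptree d c (u ++ y :: x :: r).
Proof.
by rewrite /ptree; case: ifP => _; rewrite tree_swap // !scalerA mulrC.
Qed.

Variant label_spec d c : Prop :=
| LabelZero of c = 0
| LabelUnit of d = 0%N & c = (aug hV c)%:A
| LabelPos of (n < d)%N & okl (Some (d, c)).

Lemma labelP d c : gr d c -> label_spec d c.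
Proof.
move=> hc; have [nd|dn] := ltnP n d; last first.
  by have [cE [d0|c0]] := gr_low hgr hV hc dn; [apply: LabelUnit|apply: LabelZero].
have [od|od] := boolP (odd d); first exact/LabelZero/(gr_even hgr od hc).
exact: LabelPos.
Qed.

Lemma ptree_unit c w : ptree 0 c w = aug hV c *: tree None w.
Proof. by []. Qed.

Lemma ptree_pos d c w : (n < d)%N -> ptree d c w = tree (Some (d, c)) w.
Proof. by rewrite /ptree => ->. Qed.

Lemma ptree_comm d c d' c' w w' : gr d c -> gr d' c' ->
  ptree d c w * ptree d' c' w' =
  eps ^+ (size w * size w') *: (ptree d' c' w' * ptree d c w).
Proof.
move=> /labelP[->|-> _|nd ok] /labelP[->|-> _|nd' ok'];
  rewrite ?ptree0 ?(mul0r, mulr0, scaler0) ?ptree_unit ?ptree_pos //.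
- rewrite -!scalerAl -!scalerAr tree_comm // !scalerA; congr (_ *: _).
  by rewrite mulrC (mulrC (aug _ _)) mulrA.
- by rewrite -!scalerAl -!scalerAr tree_comm // !scalerA mulrC.
- by rewrite -!scalerAl -!scalerAr tree_comm // !scalerA mulrC.
- exact: tree_comm.
Qed.

(** The side conditions exclude the label 1 on a single leg, where the tree is the default 0. They
    concern nonzero labels only, because the label 0 of degree [n] is admissible on one leg. *)
Lemma ptree_glue d c d' c' w1 w2 : gr d c -> gr d' c' ->
  (c <> 0 -> (n < d)%N || (w1 != [::])) ->
  (c' <> 0 -> (n < d')%N || (w2 != [::])) ->
  \sum_i ptree d c (rcons w1 (a i)) * ptree d' c' (ash i :: w2) =
  ptree (d + d') (c * c') (w1 ++ w2).
Proof.
have [->|/eqP c0] := eqVneq c 0.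
  by rewrite mul0r ptree0 big1 // => i _; rewrite ptree0 mul0r.
have [->|/eqP c0'] := eqVneq c' 0.
  by rewrite mulr0 ptree0 big1 // => i _; rewrite ptree0 mulr0.
move=> hc hc' /(_ c0) dp /(_ c0') dp'; move: dp dp'; case: (labelP hc) => [|d0 cE|nd ok] // dp;
  case: (labelP hc') => [|d0' cE'|nd' ok'] // dp'.
- rewrite d0 d0' in dp dp' *; rewrite /= ptree_unit cE cE' -scalerAl mul1r scalerA.
  under eq_bigr do rewrite !ptree_unit -scalerAl -scalerAr scalerA.
  rewrite -scaler_sumr tree_glue //; congr (_ *: _).
  by rewrite !aug_scalar.
- rewrite d0 in dp *; rewrite add0n cE -scalerAl mul1r ptree_pos //.
  have := tree_label (aug hV c) (w1 ++ w2) hc' (gr_subspace hgr d').1 nd'.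
  rewrite addr0 => ->; have := ptree0 d' (w1 ++ w2); rewrite ptree_pos // => ->.
  rewrite addr0 -(tree_glue (l := None)) // scaler_sumr; apply: eq_bigr => i _.
  by rewrite ptree_unit ptree_pos // aug_scalar scalerAl.
- rewrite d0' in dp' *; rewrite addn0 cE' -scalerAr mulr1 ptree_pos //.
  have := tree_label (aug hV c') (w1 ++ w2) hc (gr_subspace hgr d).1 nd.
  rewrite addr0 => ->; have := ptree0 d (w1 ++ w2); rewrite ptree_pos // => ->.
  rewrite addr0 -(tree_glue (l := Some (d, c)) (l' := None)) // scaler_sumr; apply: eq_bigr => i _.
  by rewrite ptree_unit ptree_pos // aug_scalar scalerAr.
- rewrite ptree_pos ?ltn_addr // -(tree_glue ok ok') //.
  by apply: eq_bigr => i _; rewrite !ptree_pos.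
Qed.

Lemma ptree_loop d c w : gr d c -> (c <> 0 -> (n < d)%N || (w != [::])) ->
  \sum_i ptree d c (a i :: ash i :: w) = ptree (2 * n + d) (e * c) w.
Proof.
have [->|/eqP c0] := eqVneq c 0.
  by rewrite mulr0 ptree0 big1 // => i _; rewrite ptree0.
move=> hc /(_ c0); have n2 : (n < 2 * n)%N by lia.
case: (labelP hc) => [|d0 cE|nd ok] // dp.
- rewrite d0 in dp *; rewrite addn0 ptree_pos // cE -scalerAr mulr1.
  have := tree_label (aug hV c) w he (gr_subspace hgr (2 * n)%N).1 n2.
  rewrite addr0 => ->; have := ptree0 (2 * n) w; rewrite ptree_pos // => ->.
  rewrite addr0 -(tree_loop (l := None)) // scaler_sumr; apply: eq_bigr => i _.
  by rewrite ptree_unit aug_scalar.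
- rewrite (ptree_pos (d := (2 * n + d)%N)) ?(ltn_addr d n2) //; have <- := tree_loop (w := w) ok isT.
  by apply: eq_bigr => i _; rewrite ptree_pos.
Qed.

Variable D : nat -> P -> Prop.
Hypotheses (D0 : forall m, D m 0) (D1 : D 0%N 1).
Hypothesis DP : forall m q x y, D m x -> D m y -> D m (q *: x + y).
Hypothesis DM : forall m m' x y, D m x -> D m' y -> D (m + m')%N (x * y).
Hypothesis DK0 : forall d c, gr d c -> D (d - 2 * n)%N (K0 d c).
Hypothesis DK1 : forall d c v, gr d c -> (n < d)%N -> D (d - n)%N (K1 d c v).
Hypothesis DK3 : forall x y z, D n (K3 x y z).

Lemma D_scale m q x : D m x -> D m (q *: x).
Proof. by move=> h; rewrite -[_ *: _]addr0; apply: DP. Qed.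

Lemma D_sum m (I : Type) (r : seq I) (F : I -> P) :
  (forall i, D m (F i)) -> D m (\sum_(i <- r) F i).
Proof.
move=> hF; elim: r => [|i r IH]; first by rewrite big_nil.
by rewrite big_cons -[F i]scale1r; apply: DP.
Qed.

Lemma tree_deg l w : okl l ->
  D ((if l is Some dc then dc.1 else 0%N) + n * size w - 2 * n)%N (tree l w).
Proof.
move=> okll; case: w => [|h w].
  rewrite muln0 addn0; case: l okll => [[d c]|] /=; last by move=> _; exact: D0.
  by case=> *; exact: DK0.
elim: w h => [|x w IH] h.
  rewrite muln1; case: l okll => [[d c]|] /=; last by move=> _; exact: D0.
  case=> /= hd nd _; have -> : (d + n - 2 * n = d - n)%N by lia.
  exact: DK1.
have [dp|] := boolP (deep l w); last first.
  case: l w {okll IH} => [[d c]|] [|z w] //= _; rewrite tree2.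
  have -> : (0 + n * 2 - 2 * n = 0)%N by lia.
  exact: D_scale.
rewrite treeE //; apply: D_sum => i.
have := DM (DK3 h x (a i)) (IH (ash i)); congr D; rewrite /=.
case: l w okll dp {IH} => [[d c]|] [|z w] //= okll _; last by nia.
  by case: okll => /= _ nd _; lia.
by case: okll => /= _ nd _; nia.
Qed.

Lemma ptree_deg d c w : gr d c -> D (d + n * size w - 2 * n)%N (ptree d c w).
Proof.
move=> /labelP[->|-> _|nd ok]; first by rewrite ptree0.
- by rewrite ptree_unit; apply: D_scale; exact: (@tree_deg None).
- by rewrite ptree_pos //; exact: (tree_deg w ok).
Qed.

End Trees.

(** * Evaluation of labelled partitions *)

Lemma perm_swap2 (T : eqType) (l : seq T) x y r :
  perm_eq (l ++ x :: y :: r) (l ++ y :: x :: r).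
Proof.
by rewrite perm_cat2l -[x :: _]/([:: x] ++ [:: y] ++ r) perm_catCA.
Qed.

Lemma uniq_neq2 (T : eqType) (l : seq T) x y r : uniq (l ++ x :: y :: r) -> x != y.
Proof.
by rewrite cat_uniq => /and3P[_ _]; rewrite cons_uniq inE negb_or -andbA => /and3P[].
Qed.

(** * Signs of words in the legs *)

Section Words.
Variable n : nat.
Local Notation eps := ((-1) ^+ n : rat).

Definition wsgn k (w : seq 'I_k) : rat := esgn n (map val w).

Lemma wsgnE k (w : seq 'I_k) : wsign w ^+ n = wsgn w.
Proof. by rewrite /wsgn /esgn /wsign exprAC. Qed.

Lemma wsgn_sq k (w : seq 'I_k) : wsgn w * wsgn w = 1.
Proof. exact: esgn_sq. Qed.

Lemma wsgn_enum k : wsgn (enum 'I_k) = 1.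
Proof. by rewrite /wsgn val_enum_ord /esgn inversions_iota expr0. Qed.

Lemma wsgn_swap k l x y (r : seq 'I_k) : x != y ->
  wsgn (l ++ x :: y :: r) = eps * wsgn (l ++ y :: x :: r).
Proof. by move=> xy; rewrite /wsgn !map_cat /= esgn_swap. Qed.

(** A swap of neighbours in [w] changes both signs, so the product depends only on the set of
    letters. With [w'] the standard enumeration, the second sign on the right is 1. *)
Lemma wsgn_map k l (f : 'I_l -> 'I_k) (u : seq 'I_k) (w w' : seq 'I_l) :
  injective f -> uniq w -> perm_eq w w' ->
  wsgn (u ++ map f w) * wsgn w = wsgn (u ++ map f w') * wsgn w'.
Proof.
move=> fI; pose R w w' := uniq w -> uniq w' /\
  wsgn (u ++ map f w) * wsgn w = wsgn (u ++ map f w') * wsgn w'.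
move=> + ww'; suff : R w w' by move=> h /h[].
move: w w' ww'; apply: perm_swap_ind => [s|s t v IH1 IH2 us|s x y r us].
- by [].
- by have [ut ->] := IH1 us; exact: IH2.
have xy := uniq_neq2 us.
split.
  by rewrite -(perm_uniq (perm_swap2 s x y r)).
rewrite !map_cat /= !(catA u (map f s)) wsgn_swap ?inj_eq //.
by rewrite (wsgn_swap s r xy) mulrACA eps_sq mul1r.
Qed.

Lemma wsgn_block k p u w (r : seq 'I_k) : uniq (u ++ w) ->
  wsgn (p ++ u ++ w ++ r) = eps ^+ (size u * size w) * wsgn (p ++ w ++ u ++ r).
Proof.
have one p' x w' r' : x \notin w' ->
    wsgn (p' ++ x :: w' ++ r') = eps ^+ size w' * wsgn (p' ++ w' ++ x :: r').
  elim: w' p' => [|y w' IH] p'; first by rewrite mul1r.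
  rewrite inE negb_or => /andP[xy xw].
  by rewrite /= wsgn_swap // -cat_rcons IH // cat_rcons mulrA exprS.
elim: u p => [|x u IH] p; first by rewrite mul1r.
rewrite cat_cons cons_uniq mem_cat negb_or => /andP[/andP[_ xw] uw].
rewrite !cat_cons -cat_rcons IH // cat_rcons one // mulrA -exprD.
by rewrite mulSn addnC.
Qed.

End Words.

(** * Iterated sums over assignments of basis vectors to legs *)

Section IteratedSums.
Variables (I : finType) (k : nat) (M : lmodType rat) (A : lmodType rat).
Variable b : I -> A.

Definition upf (h : 'I_k -> A) (x : 'I_k) (v : A) : 'I_k -> A :=
  fun j => if j == x then v else h j.

Lemma upfC h x y v w : x != y -> upf (upf h x v) y w = upf (upf h y w) x v.
Proof.
move=> xy; apply/funext => j; rewrite /upf.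
by case: (j =P y) => // ->; rewrite eq_sym (negbTE xy).
Qed.

(* The first name of the list is summed innermost. *)
Fixpoint isum (w : seq 'I_k) (F : ('I_k -> A) -> M) (h : 'I_k -> A) : M :=
  if w is x :: w' then isum w' (fun h => \sum_i F (upf h x (b i))) h else F h.

(** The reason for iterated sums: the legs of a matching can be summed first, with the other legs
    held fixed. *)
Lemma isum_cat w w' F h : isum (w ++ w') F h = isum w' (isum w F) h.
Proof. by elim: w F => //= x w IH F; rewrite IH. Qed.

Lemma isum0 w h : isum w (fun=> 0) h = 0.
Proof.
elim: w => //= x w IH; rewrite -[RHS]IH; congr isum; apply/funext => h'.
exact: big1_eq.
Qed.

Lemma isumP w q F G h :
  isum w (fun h => q *: F h + G h) h = q *: isum w F h + isum w G h.
Proof.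
elim: w F G => //= x w IH F G; rewrite -IH; congr isum; apply/funext => h'.
by rewrite scaler_sumr -big_split.
Qed.

Lemma isumZ w q F h : isum w (fun h => q *: F h) h = q *: isum w F h.
Proof.
have := isumP w q F (fun=> 0) h; rewrite isum0 addr0 => <-.
by congr isum; apply/funext => h'; rewrite addr0.
Qed.

Lemma isum_perm w w' F h : uniq w -> perm_eq w w' -> isum w F h = isum w' F h.
Proof.
pose R w w' := uniq w -> uniq w' /\ forall F h, isum w F h = isum w' F h.
move=> + ww'; suff : R w w' by move=> H /H[].
move: w w' ww' {F h}; apply: perm_swap_ind => [s|s t v IH1 IH2 us|s x y r us].
- by [].
- have [ut E1] := IH1 us; have [uv E2] := IH2 ut.
  by split=> // F h; rewrite E1.
have xy := uniq_neq2 us.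
split.
  by rewrite -(perm_uniq (perm_swap2 s x y r)).
move=> F h; rewrite !isum_cat /=; congr isum; apply/funext => h'.
rewrite exchange_big; apply: eq_bigr => i _; apply: eq_bigr => j _.
by rewrite upfC // eq_sym.
Qed.

(** Legs in [w] are overwritten by the sums, so the starting assignment is arbitrary when [w] lists
    all legs. *)
Lemma isum_eq_in w F h h' : (forall i, i \notin w -> h i = h' i) ->
  isum w F h = isum w F h'.
Proof.
elim/last_ind: w F h h' => [|w x IH] F h h' E /=.
  by congr F; apply/funext => i; apply: E.
rewrite -cats1 !isum_cat /=; apply: eq_bigr => i _; apply: IH => j jw.
rewrite /upf; case: eqP => // /eqP jx; apply: E.
by rewrite mem_rcons inE negb_or jx.
Qed.

Lemma isum_scale w (c : ('I_k -> A) -> rat) F h :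
  (forall h x v, x \in w -> c (upf h x v) = c h) ->
  isum w (fun h => c h *: F h) h = c h *: isum w F h.
Proof.
elim: w F => //= x w IH F cE; rewrite -IH => [|h' y v yw]; last first.
  by rewrite cE // inE yw orbT.
congr isum; apply/funext => h'; rewrite scaler_sumr; apply: eq_bigr => i _.
by rewrite cE // mem_head.
Qed.

End IteratedSums.

Lemma isum_map (I : finType) k l (M A : lmodType rat) (b : I -> A)
    (f : 'I_l -> 'I_k) (w : seq 'I_l) (F : ('I_l -> A) -> M) h :
  injective f -> isum b (map f w) (fun h => F (h \o f)) h = isum b w F (h \o f).
Proof.
move=> fI; elim: w F => //= x w IH F; rewrite -IH; congr isum.
apply/funext => h'; apply: eq_bigr => i _; congr F; apply/funext => j.
by rewrite /= /upf inj_eq.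
Qed.

(** * The evaluation of the coend, for any [T] that obeys the gluing rules *)

Section States.
Variables (n g : nat) (V : comAlgType rat) (gr : nat -> set V) (e : V).
Hypothesis (n_gt0 : (0 < n)%N).
Hypothesis (hgr : even_grading gr) (he : gr (2 * n)%N e) (hV : unit_plus_gt gr n).
Variables a ash : 'I_(g + g) -> H g.
Hypothesis (ab : basis_of fullv [tuple a i | i < g + g]).
Hypothesis (adual : forall i j, lam n (ash i) (a j) = (i == j)%:R).

Local Notation eps := ((-1) ^+ n : rat).
Local Notation lam := (@lam n g).

Variables (P : algType rat) (T : nat -> V -> seq (H g) -> P).
Hypothesis T_linear : forall d c u r q v w,
  T d c (u ++ (q *: v + w) :: r) = q *: T d c (u ++ v :: r) + T d c (u ++ w :: r).
Hypothesis T_zero : forall d w, T d 0 w = 0.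
Hypothesis T_swap : forall d c u x y r,
  T d c (u ++ x :: y :: r) = eps *: T d c (u ++ y :: x :: r).
Hypothesis T_comm : forall d c d' c' w w', gr d c -> gr d' c' ->
  T d c w * T d' c' w' = eps ^+ (size w * size w') *: (T d' c' w' * T d c w).
Hypothesis T_glue : forall d c d' c' w1 w2,
  (c <> 0 -> (n < d)%N || (w1 != [::])) ->
  (c' <> 0 -> (n < d')%N || (w2 != [::])) ->
  gr d c -> gr d' c' ->
  \sum_i T d c (rcons w1 (a i)) * T d' c' (ash i :: w2) =
  T (d + d') (c * c') (w1 ++ w2).
Hypothesis T_loop : forall d c w,
  (c <> 0 -> (n < d)%N || (w != [::])) -> gr d c ->
  \sum_i T d c (a i :: ash i :: w) = T (2 * n + d) (e * c) w.

(* The first component is an argument of the form, the second one decorates the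
   corresponding leg. *)
Definition vpair : lmodType rat := (H g * H g)%type.
Definition bpair (i : 'I_(g + g)) : vpair := (a i, ash i).

Section OrderedParts.
Variable k : nat.

(** The order of the legs is kept, since for odd [n] it affects the sign. *)
Definition opart : Type := (seq 'I_k * nat * V)%type.
Implicit Types (S : seq opart) (h : 'I_k -> vpair) (u : seq 'I_k).

Definition word S : seq 'I_k := flatten [seq p.1.1 | p <- S].
Definition value S h : P :=
  \prod_(p <- S) T p.1.2 p.2 [seq (h i).2 | i <- p.1.1].
(** The prefix [u] lists legs that are already contracted. The sign of the whole word is the
    determinant factor. *)
Definition svalue u S h : P := wsgn n (u ++ word S) *: value S h.

Lemma svalue_cons u p S h :
  svalue u (p :: S) h =
  T p.1.2 p.2 [seq (h i).2 | i <- p.1.1] * svalue (u ++ p.1.1) S h.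
Proof. by rewrite /svalue /word /value /= big_cons catA scalerAr. Qed.

Lemma value_upf S h x v : x \notin word S -> value S (upf h x v) = value S h.
Proof.
move=> xS; apply: eq_big_seq => p pS; congr T.
apply/eq_in_map => i ip; rewrite /upf; case: eqP => // ix.
case/negP: xS; rewrite -ix; apply/flattenP; exists p.1.1 => //.
by apply/mapP; exists p.
Qed.

Lemma svalue_legs u w w' d c S h : uniq (u ++ w ++ word S) -> perm_eq w w' ->
  svalue u ((w, d, c) :: S) h = svalue u ((w', d, c) :: S) h.
Proof.
pose R w w' := uniq (u ++ w ++ word S) -> uniq (u ++ w' ++ word S) /\
  svalue u ((w, d, c) :: S) h = svalue u ((w', d, c) :: S) h.
move=> + ww'; suff : R w w' by move=> H /H[].
move: w w' ww'; apply: perm_swap_ind => [s|s t v IH1 IH2 us|s x y r us].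
- by [].
- by have [ut ->] := IH1 us; exact: IH2.
have xy : x != y by move: us; rewrite -!catA /= catA => /uniq_neq2.
split.
  rewrite -(perm_uniq (s1 := u ++ (s ++ [:: x, y & r]) ++ word S)) // perm_cat2l.
  by rewrite perm_cat2r perm_swap2.
rewrite /svalue /value /word !big_cons /= -/(word S) -!catA /= !(catA u s).
rewrite wsgn_swap // !map_cat /= T_swap -scalerAl scalerA; congr (_ *: _).
by rewrite mulrAC eps_sq mul1r.
Qed.

(** Exchanging two neighbouring parts produces the same power of (-1)^n twice, from commuting their
    values and from exchanging their blocks in the word. *)
Lemma svalue_perm u S S' h : uniq (u ++ word S) -> perm_eq S S' ->
  (forall p, p \in S -> gr p.1.2 p.2) -> svalue u S h = svalue u S' h.
Proof.
pose R S S' := uniq (u ++ word S) -> (forall p, p \in S -> gr p.1.2 p.2) ->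
  [/\ uniq (u ++ word S'), (forall p, p \in S' -> gr p.1.2 p.2) &
      svalue u S h = svalue u S' h].
move=> + SS'; suff : R S S' by move=> H hu hg; case: (H hu hg).
move: S S' SS'; apply: perm_swap_ind => [s|s t v IH1 IH2 us gs|s x y r us gs].
- by [].
- by have [ut gt ->] := IH1 us gs; exact: IH2.
split.
- rewrite -(perm_uniq (s1 := u ++ word (s ++ [:: x, y & r]))) // perm_cat2l.
  by rewrite /word; apply/perm_flatten/perm_map/perm_swap2.
- by move=> p; rewrite -(perm_mem (perm_swap2 s x y r)); exact: gs.
rewrite /svalue /value /word !map_cat !flatten_cat /= !big_cat !big_cons /=.
set ws := flatten _; set wr := flatten _; set ps := \prod_(p <- s) _.
set pr := \prod_(p <- r) _; set tx := T x.1.2 _ _; set ty := T y.1.2 _ _.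
have uxy : uniq (x.1.1 ++ y.1.1).
  move: us; rewrite /word map_cat flatten_cat /= catA cat_uniq => /and3P[_ _].
  by rewrite catA cat_uniq => /andP[].
have E : tx * (ty * pr) = eps ^+ (size x.1.1 * size y.1.1) *: (ty * (tx * pr)).
  rewrite mulrA T_comm ?size_map ?scalerAl -?mulrA // -?scalerAl -?mulrA //;
    by apply: gs; rewrite mem_cat !inE eqxx ?orbT.
rewrite E -scalerAr scalerA !(catA u) wsgn_block //; congr (_ *: _).
by rewrite mulrAC -exprMn eps_sq expr1n mul1r.
Qed.

End OrderedParts.
Definition cnt k (s : seq (part V k)) (i : 'I_k) : nat :=
  count (fun p => i \in psupp p) s.

Variant contract_spec k (x y : 'I_k) (s : seq (part V k)) : seq (part V k) -> Prop :=
| ContractLoop p r of perm_eq s (p :: r) & x \in psupp p & y \in psupp p &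
    cnt r x = 0%N & cnt r y = 0%N :
    contract_spec x y s
      ((psupp p :\: [set x; y]%SET, (2 * n + pdeg p)%N, e * plab p) :: r)
| ContractMerge p q r of perm_eq s (p :: q :: r) &
    x \in psupp p & y \notin psupp p & x \notin psupp q & y \in psupp q &
    cnt r x = 0%N & cnt r y = 0%N :
    contract_spec x y s
      (((psupp p :|: psupp q) :\: [set x; y]%SET, (pdeg p + pdeg q)%N,
        plab p * plab q) :: r).

(** As [x] and [y] each lie in exactly one part, the default branch of [contract] is not reached.
    For a merger the parts can be named so that [x] lies in the first one, because union, product
    and sum of degrees are commutative. *)
Lemma contractP k (x y : 'I_k) (s : seq (part V k)) :
  cnt s x = 1%N -> cnt s y = 1%N -> contract_spec x y s (contract n e x y s).
Proof.
rewrite /contract; set hit := fun p : part V k => (x \in psupp p) || (y \in psupp p).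
set rest := [seq p <- s | ~~ hit p] => cx cy.
have sE : perm_eq s ([seq p <- s | hit p] ++ rest) by rewrite perm_sym perm_filterC.
have r0 z : (z == x) || (z == y) -> cnt rest z = 0%N.
  move=> zxy; apply/eqP; rewrite eqn0Ngt -has_count; apply/hasPn => p.
  rewrite mem_filter /hit => /andP[hp _]; apply: contra hp.
  by case/orP: zxy => /eqP -> ->; rewrite ?orbT.
have rx : cnt rest x = 0%N by rewrite r0 ?eqxx.
have ry : cnt rest y = 0%N by rewrite r0 ?eqxx ?orbT.
have hE z : cnt rest z = 0%N -> cnt s z = cnt [seq p <- s | hit p] z.
  by move=> z0; rewrite /cnt (seq.permP sE) count_cat -/(cnt rest z) z0 addn0.
move: cx cy; rewrite !hE //; have : all hit [seq p <- s | hit p] by exact: filter_all.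
move: sE; case: [seq p <- s | hit p] => [|p [|q [|q' t]]] sE //=.
- rewrite /cnt /= andbT !addn0 => _ xp yp; apply: (@ContractLoop _ _ _ _ p rest) => //.
  + by case: (x \in _) xp.
  + by case: (y \in _) yp.
- rewrite /cnt /= andbT !addn0 /hit.
  case xp: (x \in psupp p); case yp: (y \in psupp p);
  case xq: (x \in psupp q); case yq: (y \in psupp q) => //= _ _ _.
    by apply: (ContractMerge sE); rewrite ?xp ?yp ?xq ?yq.
  rewrite (finset.setUC (psupp p)) (addnC (pdeg p)) (mulrC (plab p)).
  have sE' := perm_trans sE (perm_swap2 [::] p q rest).
  by apply: (ContractMerge sE'); rewrite ?xp ?yp ?xq ?yq.
- rewrite /cnt /= /hit => /and4P[hp hq hq' _].
  move: hp hq hq'; case: (x \in psupp p); case: (y \in psupp p);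
  case: (x \in psupp q); case: (y \in psupp q) => //=;
  by case: (x \in psupp q'); case: (y \in psupp q').
Qed.

Lemma cnt_perm k (s t : seq (part V k)) i : perm_eq s t -> cnt s i = cnt t i.
Proof. by move=> st; rewrite /cnt (seq.permP st). Qed.

Lemma cnt_contract k (x y : 'I_k) (s : seq (part V k)) i :
  cnt s x = 1%N -> cnt s y = 1%N ->
  (forall j, cnt s j <= 1)%N ->
  cnt (contract n e x y s) i = if (i == x) || (i == y) then 0%N else cnt s i.
Proof.
move=> cx cy cj; have := cj i; case: (contractP cx cy) => [p r|p q r] /cnt_perm sE.
  move=> xp yp rx ry; rewrite sE {1}/cnt /= -/(cnt r i) !inE.
  case: eqP => [->|_] /=; first by rewrite rx.
  by case: eqP => [->|_] /=; first by rewrite ry.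
move=> xp yp xq yq rx ry; rewrite sE {1}/cnt /= -/(cnt r i) !inE.
case: eqP => [->|_] /=; first by rewrite rx.
case: eqP => [->|_] /=; first by rewrite ry.
by rewrite /cnt /=; case: (i \in psupp p); case: (i \in psupp q).
Qed.

(* Unlike [admissible] this is preserved by contractions: two parts of size [1]
   with label [0] of degree [n] merge to an inadmissible part with label [0]. *)
Definition wadm k (p : part V k) : Prop :=
  gr (pdeg p) (plab p) /\
  (plab p <> 0 -> ((#|psupp p| < 3)%N -> (n < pdeg p)%N) /\
                  (#|psupp p| = 0%N -> (2 * n < pdeg p)%N)).

Lemma admissible_wadm k (p : part V k) : admissible n gr p -> wadm p.
Proof.
case=> hp adm; split=> // p0; move: adm.
(* A nonzero label of degree at most [n] is a scalar of degree 0, so any positive lower bound on the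
   degree improves to a degree above [n]. *)
have H : (pdeg p <= n)%N -> pdeg p = 0%N.
  by move=> h; have [_ []] := gr_low hgr hV hp h.
have nd : (0 < pdeg p)%N -> (n < pdeg p)%N.
  by move=> d0; rewrite ltnNge; apply: contraL d0 => /H ->.
case: #|_| => [|[|[|m]]] h; split=> // _.
- by apply: nd; apply: leq_ltn_trans h.
- by apply: nd; apply: leq_trans h.
- exact: nd.
Qed.

Lemma wadm_admissible k (p : part V k) : plab p <> 0 -> wadm p -> admissible n gr p.
Proof.
move=> p0 [hp /(_ p0)[h3 h0]]; split=> //.
case: #|_| h3 h0 => [|[|[|m]]] // h3 h0.
- exact: h0.
- exact/ltnW/h3.
- by apply: leq_ltn_trans (h3 _).
Qed.

(** A loop adds [2 * n] to the degree, and a part that it empties had two legs, hence a label of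
    degree above [n]. If a merger leaves at most two legs, the two parts had at most four together,
    so one of them had fewer than three and degree above [n]; if it leaves none, each had a single
    leg, and both degrees exceed [n]. *)
Lemma wadm_contract k (x y : 'I_k) (s : seq (part V k)) : x != y ->
  cnt s x = 1%N -> cnt s y = 1%N -> (forall j, cnt s j <= 1)%N ->
  (forall p, p \in s -> wadm p) -> forall p, p \in contract n e x y s -> wadm p.
Proof.
move=> xy cx cy c1 sP p; case: (contractP cx cy) => [q r|q q' r] sE.
  move=> xq yq _ _; rewrite inE => /orP[/eqP->|pr]; last first.
    by apply: sP; rewrite (perm_mem sE) inE pr orbT.
  have [hq aq] : wadm q by apply: sP; rewrite (perm_mem sE) mem_head.
  have cE : #|psupp q| = (#|psupp q :\: [set x; y]%SET| + 2)%N.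
    rewrite -(cardsID [set x; y]%SET (psupp q)) addnC; congr (_ + _)%N.
    rewrite (finset.setIidPr _) ?cards2 ?xy //.
    by apply/fintype.subsetP => z; rewrite !inE => /orP[] /eqP ->.
  split; rewrite /plab /pdeg /psupp /=; first exact: gr_mul.
  move=> ec0; have c0 : plab q <> 0 by move=> c0; apply: ec0; rewrite -/(plab q) c0 mulr0.
  have [a3 a0] := aq c0; split=> [_|z0]; first by lia.
  have : (n < pdeg q)%N by apply: a3; rewrite cE z0.
  by rewrite -/(pdeg q); lia.
move=> xq yq xq' yq' _ _; rewrite inE => /orP[/eqP->|pr]; last first.
  by apply: sP; rewrite (perm_mem sE) !inE pr !orbT.
have [hq aq] : wadm q by apply: sP; rewrite (perm_mem sE) mem_head.
have [hq' aq'] : wadm q' by apply: sP; rewrite (perm_mem sE) !inE eqxx orbT.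
have dis : #|psupp q :&: psupp q'| = 0%N.
  apply/eqP; rewrite cards_eq0; apply/eqP/setP => z; rewrite !inE.
  have := c1 z; rewrite (cnt_perm _ sE) /cnt /=.
  by case: (z \in psupp q); case: (z \in psupp q').
have cE : (#|psupp q| + #|psupp q'| =
    #|(psupp q :|: psupp q') :\: [set x; y]%SET| + 2)%N.
  rewrite -cardsUI dis addn0 -(cardsID [set x; y]%SET (_ :|: _)) addnC; congr (_ + _)%N.
  rewrite (finset.setIidPr _) ?cards2 ?xy //.
  by apply/fintype.subsetP => z; rewrite !inE => /orP[] /eqP ->; rewrite ?xq ?yq' ?orbT.
have q1 : (0 < #|psupp q|)%N by apply/card_gt0P; exists x.
have q1' : (0 < #|psupp q'|)%N by apply/card_gt0P; exists y.
set m := #|_ :\: _| in cE.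
split; rewrite /plab /pdeg /psupp /=; first exact: gr_mul.
move=> cc0; have c0 : plab q <> 0 by move=> c0; apply: cc0; rewrite -/(plab q) c0 mul0r.
have c0' : plab q' <> 0 by move=> c0'; apply: cc0; rewrite -/(plab q') c0' mulr0.
have [a3 _] := aq c0; have [a3' _] := aq' c0'.
change (((m < 3)%N -> (n < pdeg q + pdeg q')%N) /\
        (m = 0%N -> (2 * n < pdeg q + pdeg q')%N)).
split=> h.
  have [q3|q3] := ltnP #|psupp q| 3; first by rewrite ltn_addr // a3.
  by rewrite ltn_addl // a3' //; lia.
have h1 : (n < pdeg q)%N by apply: a3; lia.
have h2 : (n < pdeg q')%N by apply: a3'; lia.
by lia.
Qed.

Definition ordered k (s : seq (part V k)) : seq (opart k) :=
  [seq (enum (psupp p), pdeg p, plab p) | p <- s].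

Lemma count_word k (s : seq (part V k)) i : count_mem i (word (ordered s)) = cnt s i.
Proof.
rewrite /word /cnt; elim: s => //= p s IH; rewrite count_cat IH; congr (_ + _)%N.
by rewrite count_uniq_mem ?enum_uniq // mem_enum.
Qed.

Lemma word_uniq k (s : seq (part V k)) : (forall i, cnt s i <= 1)%N -> uniq (word (ordered s)).
Proof.
move=> s1; apply: count_mem_uniq => i; rewrite count_word.
have := s1 i; rewrite -count_word -has_pred1 has_count.
by case: (count_mem i _) => [|[|m]].
Qed.

Lemma ordered_perm k (s t : seq (part V k)) :
  perm_eq s t -> perm_eq (ordered s) (ordered t).
Proof. exact: perm_map. Qed.

Lemma word_perm k (s t : seq (part V k)) :
  perm_eq s t -> perm_eq (word (ordered s)) (word (ordered t)).
Proof. by move=> /ordered_perm st; apply/perm_flatten/perm_map. Qed.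

(** Summing over [i] restores the vector [a j], so contracting two independent sums over dual bases
    yields the tensor that glues legs. *)
Lemma sum_pair (B : H g -> H g -> P) :
  (forall q x y v, B (q *: x + y) v = q *: B x v + B y v) ->
  \sum_j \sum_i lam (a j) (a i) *: B (ash i) (ash j) = \sum_j B (a j) (ash j).
Proof.
move=> Bl; apply: eq_bigr => j _.
rewrite -(linear_sumZ (f := fun v => B v (ash j))) => [|*]; last exact: Bl.
by rewrite -(expand_ash ab adual).
Qed.

Lemma map_upf k (h : 'I_k -> vpair) x v w : x \notin w ->
  [seq (upf h x v i).2 | i <- w] = [seq (h i).2 | i <- w].
Proof.
move=> xw; apply/eq_in_map => i iw; rewrite /upf; case: eqP => // ix.
by rewrite -ix iw in xw.
Qed.

(** After reordering, [x] and [y] are the first two legs of one part, or the last leg of one part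
    and the first leg of the next; [T_loop] or [T_glue] then applies. *)
Lemma svalue_contract k (x y : 'I_k) (s : seq (part V k)) (h : 'I_k -> vpair) :
  x != y -> cnt s x = 1%N -> cnt s y = 1%N -> (forall i, cnt s i <= 1)%N ->
  (forall p, p \in s -> wadm p) ->
  \sum_j \sum_i lam (a j) (a i) *:
    svalue [::] (ordered s) (upf (upf h y (bpair j)) x (bpair i)) =
  svalue [:: x; y] (ordered (contract n e x y s)) h.
Proof.
move=> xy cx cy c1 sP.
have us := word_uniq c1.
have hg p : p \in ordered s -> gr p.1.2 p.2.
  by move=> /mapP[q /sP[gq _] ->].
have notin r z : cnt r z = 0%N -> z \notin word (ordered r).
  by move=> z0; rewrite -has_pred1 has_count count_word z0.
case: (contractP cx cy) => [p r|p q r] sE.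
  move=> xp yp rx ry; set B := _ :\: _.
  have xB : x \notin enum B by rewrite mem_enum !inE eqxx.
  have yB : y \notin enum B by rewrite mem_enum !inE eqxx orbT.
  have BE : perm_eq (enum (psupp p)) (x :: y :: enum B).
    apply: uniq_perm; first exact: enum_uniq.
      by rewrite /= inE negb_or xy xB yB enum_uniq.
    move=> z; rewrite !inE !mem_enum !inE; case: (z =P x) => [->|_] //=.
    by case: (z =P y) => [->|_].
  have pin : p \in s by rewrite (perm_mem sE) mem_head.
  have [gp ap] := sP p pin.
  have u2 : uniq ([::] ++ enum (psupp p) ++ word (ordered r)).
    by have := us; rewrite (perm_uniq (word_perm sE)).
  have E h' : svalue [::] (ordered s) h' =
      svalue [::] ((x :: y :: enum B, pdeg p, plab p) :: ordered r) h'.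
    by rewrite (svalue_perm (u := [::]) h' us (ordered_perm sE) hg) /= (svalue_legs _ _ _ u2 BE).
  have T2 i j : svalue [::] (ordered s) (upf (upf h y (bpair j)) x (bpair i)) =
     T (pdeg p) (plab p) (ash i :: ash j :: [seq (h i).2 | i <- enum B]) *
     svalue (x :: y :: enum B) (ordered r) h.
    rewrite E svalue_cons /svalue !value_upf ?notin //=.
    by rewrite !map_upf // /upf eqxx eq_sym (negbTE xy) eqxx.
  under eq_bigr do under eq_bigr do rewrite T2 scalerAl.
  under eq_bigr do rewrite -mulr_suml.
  rewrite -mulr_suml svalue_cons; congr (_ * _).
  rewrite (sum_pair (B := fun u v => T _ _ (u :: v :: _))) => [|q u v w].
    (* If no leg is left, the part had two legs, and [wadm] puts its nonzero label above degree
       [n]. *)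
    apply: T_loop gp => p0; have [a3 _] := ap p0.
    rewrite -size_eq0 size_map -cardE.
    have [//|dn] := ltnP n (pdeg p); rewrite cards_eq0.
    apply: contraTneq dn => B0; rewrite -ltnNge; apply: a3.
    rewrite cardE (perm_size BE) /= -cardE B0 cards0 //.
  exact: (T_linear _ _ [::]).
move=> xp yp xq yq rx ry; set C := _ :\: _.
set A1 := enum (psupp p :\ x); set B1 := enum (psupp q :\ y).
have us' : uniq (enum (psupp p) ++ enum (psupp q) ++ word (ordered r)).
  by have := us; rewrite (perm_uniq (word_perm sE)).
have xA : x \notin A1 by rewrite mem_enum !inE eqxx.
have yA : y \notin A1 by rewrite mem_enum !inE (negbTE yp) andbF.
have yB : y \notin B1 by rewrite mem_enum !inE eqxx.
have xB : x \notin B1 by rewrite mem_enum !inE (negbTE xq) andbF.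
have AE : perm_eq (enum (psupp p)) (rcons A1 x).
  apply: uniq_perm; first exact: enum_uniq.
    by rewrite rcons_uniq xA enum_uniq.
  by move=> z; rewrite mem_rcons inE !mem_enum !inE; case: eqP => [->|].
have BE : perm_eq (enum (psupp q)) (y :: B1).
  apply: uniq_perm; first exact: enum_uniq.
    by rewrite /= yB enum_uniq.
  by move=> z; rewrite inE !mem_enum !inE; case: eqP => [->|].
have u1 : uniq (rcons A1 x ++ (y :: B1) ++ word (ordered r)).
  rewrite -(perm_uniq (s1 := enum (psupp p) ++ enum (psupp q) ++ word (ordered r))) //.
  by apply: perm_cat => //; rewrite perm_cat2r.
have u2 : uniq (rcons A1 x ++ enum (psupp q) ++ word (ordered r)).
  rewrite -(perm_uniq (s1 := enum (psupp p) ++ enum (psupp q) ++ word (ordered r))) //.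
  by rewrite perm_cat2r.
have u3 : uniq ([:: x; y] ++ (A1 ++ B1) ++ word (ordered r)).
  rewrite -(perm_uniq (s1 := rcons A1 x ++ (y :: B1) ++ word (ordered r))) //.
  by rewrite -cats1 -!catA; apply/permEl/(perm_catCA A1 [:: x; y]).
have CE : perm_eq (A1 ++ B1) (enum C).
  apply: uniq_perm; last first.
  - move=> z; rewrite mem_cat !mem_enum !inE negb_or.
    case: (z =P x) => [->|_] /=; first by rewrite (negbTE xq) andbF.
    by case: (z =P y) => [->|_] //=; rewrite (negbTE yp).
  - exact: enum_uniq.
  by move: u3; rewrite cat_uniq => /and3P[_ _]; rewrite cat_uniq => /and3P[].
have pin : p \in s by rewrite (perm_mem sE) mem_head.
have qin : q \in s by rewrite (perm_mem sE) !inE eqxx orbT.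
have [gp ap] := sP p pin; have [gq aq] := sP q qin.
have T2 i j : svalue [::] (ordered s) (upf (upf h y (bpair j)) x (bpair i)) =
    T (pdeg p) (plab p) (rcons [seq (h i).2 | i <- A1] (ash i)) *
    T (pdeg q) (plab q) (ash j :: [seq (h i).2 | i <- B1]) *
    svalue (x :: y :: A1 ++ B1) (ordered r) h.
  rewrite (svalue_perm (u := [::]) _ us (ordered_perm sE) hg) /=.
  rewrite (@svalue_legs _ [::] (enum (psupp p)) _ _ _
    ((enum (psupp q), pdeg q, plab q) :: ordered r) _ us' AE).
  rewrite svalue_cons /= (svalue_legs _ _ _ u2 BE).
  rewrite svalue_cons /= map_rcons !map_upf //= mulrA /upf !eqxx eq_sym (negbTE xy).
  congr (_ * _); rewrite /svalue !value_upf ?notin //; congr (_ *: _).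
  rewrite -cats1 -!catA /= -[LHS]/(wsgn n ([::] ++ A1 ++ [:: x; y] ++ B1 ++ word (ordered r))).
  (* The block [x], [y] has even length and moves past [A1] without a sign. *)
  rewrite wsgn_block; last first.
    rewrite (perm_uniq (permEl (perm_catC A1 [:: x; y]))).
    rewrite -(catA A1) (catA [:: x; y] A1) cat_uniq in u3; by case/andP: u3.
  by rewrite /= -exprM mulnA exprM sqrr_sign mul1r -catA.
under eq_bigr do under eq_bigr do rewrite T2 scalerAl.
under eq_bigr do rewrite -mulr_suml.
rewrite -mulr_suml (sum_pair (B := fun u v => T _ _ (rcons _ u) * T _ _ (v :: _))); last first.
  move=> c u v w; rewrite -!cats1 scalerAl -mulrDl; congr (_ * _).
  exact: (T_linear _ _ _ [::]).
have dE (p' : part V k) w : (plab p' <> 0 -> ((#|psupp p'| < 3)%N -> (n < pdeg p')%N) /\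
      (#|psupp p'| = 0%N -> (2 * n < pdeg p')%N)) ->
    #|psupp p'| = (size w).+1 -> plab p' <> 0 ->
    (n < pdeg p')%N || ([seq (h i).2 | i <- w] != [::]).
  move=> ap' sw p0; have [a3 _] := ap' p0.
  by case: w sw => [|z w] sw; rewrite ?orbT // a3 // sw.
rewrite T_glue //; last first.
- by apply: (dE q) => //; rewrite cardE (perm_size BE).
- by apply: (dE p) => //; rewrite cardE (perm_size AE) size_rcons.
rewrite /= -(svalue_legs _ _ _ _ CE) // svalue_cons /= map_cat.
by congr (_ * svalue _ _ _); rewrite /= catA.
Qed.

Definition flat k (m : seq ('I_k * 'I_k)) : seq 'I_k :=
  flatten [seq [:: p.1; p.2] | p <- m].

Let contracts k (m : seq ('I_k * 'I_k)) (s : seq (part V k)) :=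
  foldl (fun s xy => contract n e xy.1 xy.2 s) s m.

Lemma contracts_inv k (m : seq ('I_k * 'I_k)) r (s : seq (part V k)) :
  uniq (flat m ++ r) -> (forall i, cnt s i = count_mem i (flat m ++ r)) ->
  (forall p, p \in s -> wadm p) ->
  (forall i, cnt (contracts m s) i = count_mem i r) /\
  (forall p, p \in contracts m s -> wadm p).
Proof.
elim: m s => [|[x y] m IH] s //= /and3P[]; rewrite inE negb_or.
move=> /andP[xy xw] yw uw c1 sP.
have c1' i : cnt s i = ((x == i) + (y == i) + count_mem i (flat m ++ r))%N by rewrite c1 /= addnA.
have cx : cnt s x = 1%N by rewrite c1' eqxx eq_sym (negbTE xy) (count_memPn xw).
have cy : cnt s y = 1%N by rewrite c1' eqxx (negbTE xy) (count_memPn yw).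
have cj i : (cnt s i <= 1)%N.
  rewrite c1' count_uniq_mem //; case: (x =P i) => [<-|_].
    by rewrite eq_sym (negbTE xy) (negbTE xw).
  by case: (y =P i) => [<-|_]; rewrite ?(negbTE yw) ?leq_b1.
apply: IH => // [i|]; last exact: wadm_contract.
rewrite cnt_contract // c1' ![i == _]eq_sym.
case: (x =P i) => [<-|_] /=; first by rewrite (count_memPn xw).
by case: (y =P i) => [<-|_] //=; rewrite (count_memPn yw).
Qed.

(** Pairs are contracted one at a time: the first pair is summed innermost by [isum] and contracted
    first by [foldl]. *)
Lemma svalue_contracts k (m : seq ('I_k * 'I_k)) r (s : seq (part V k)) h :
  uniq (flat m ++ r) -> (forall i, cnt s i = count_mem i (flat m ++ r)) ->
  (forall p, p \in s -> wadm p) ->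
  isum bpair (flat m) (fun h => (\prod_(p <- m) lam (h p.2).1 (h p.1).1) *:
    svalue [::] (ordered s) h) h = svalue (flat m) (ordered (contracts m s)) h.
Proof.
elim: m s => [|[x y] m IH] s; first by rewrite /= big_nil scale1r.
move=> uw c1 sP; have /and3P[xyw yw uw'] : uniq [:: x, y & flat m ++ r] := uw.
have {xyw} /andP[xy xw] : (x != y) && (x \notin flat m ++ r).
  by move: xyw; rewrite inE negb_or.
have c1' i : cnt s i = ((x == i) + (y == i) + count_mem i (flat m ++ r))%N by rewrite c1 /= addnA.
have cx : cnt s x = 1%N by rewrite c1' eqxx eq_sym (negbTE xy) (count_memPn xw).
have cy : cnt s y = 1%N by rewrite c1' eqxx (negbTE xy) (count_memPn yw).
have cj i : (cnt s i <= 1)%N.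
  rewrite c1' count_uniq_mem //; case: (x =P i) => [<-|_].
    by rewrite eq_sym (negbTE xy) (negbTE xw).
  by case: (y =P i) => [<-|_]; rewrite ?(negbTE yw) ?leq_b1.
set s' := contract n e x y s.
have s'P : forall p, p \in s' -> wadm p by exact: wadm_contract.
have c's i : cnt s' i = count_mem i (flat m ++ r).
  rewrite cnt_contract // c1' ![i == _]eq_sym.
  case: (x =P i) => [<-|_] /=; first by rewrite (count_memPn xw).
  by case: (y =P i) => [<-|_] //=; rewrite (count_memPn yw).
(* The sign for putting [x], [y] in front. By [wsgn_map] it can be computed from any order of the
   remaining legs, so it is still the right factor after the later contractions. *)
pose rho := wsgn n ([:: x; y] ++ word (ordered s')) * wsgn n (word (ordered s')).
have rhoE h' : svalue [:: x; y] (ordered s') h' = rho *: svalue [::] (ordered s') h'.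
  by rewrite /svalue scalerA -mulrA wsgn_sq mulr1.
have lamE h' i j : (\prod_(p <- (x, y) :: m)
      lam (upf (upf h' y (bpair j)) x (bpair i) p.2).1
          (upf (upf h' y (bpair j)) x (bpair i) p.1).1) =
    (\prod_(p <- m) lam (h' p.2).1 (h' p.1).1) * lam (a j) (a i).
  set h2 := upf _ x _; have hx : h2 x = bpair i by rewrite /h2 /upf eqxx.
  have hy : h2 y = bpair j by rewrite /h2 /upf eq_sym (negbTE xy) eqxx.
  rewrite big_cons /= hx hy mulrC; congr (_ * _).
  have fm z : z \notin flat m ++ r -> z \notin flat m by rewrite mem_cat negb_or => /andP[].
  have := fm _ xw; have := fm _ yw; elim: (m) => [|p m' IHm]; first by rewrite !big_nil.
  rewrite /= !inE !negb_or => /and3P[y1 y2 ym] /and3P[x1 x2 xm].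
  rewrite !big_cons IHm // /h2 /upf ![p.1 == _]eq_sym ![p.2 == _]eq_sym.
  by rewrite (negbTE x1) (negbTE x2) (negbTE y1) (negbTE y2).
have -> : isum bpair (flat ((x, y) :: m))
    (fun h => (\prod_(p <- (x, y) :: m) lam (h p.2).1 (h p.1).1) *:
       svalue [::] (ordered s) h) h =
  rho *: isum bpair (flat m) (fun h => (\prod_(p <- m) lam (h p.2).1 (h p.1).1) *:
       svalue [::] (ordered s') h) h.
  rewrite -isumZ /=; congr isum; apply/funext => h'.
  rewrite scalerA mulrC -scalerA -rhoE -(svalue_contract h' xy cx cy cj sP).
  rewrite scaler_sumr; apply: eq_bigr => j _; rewrite scaler_sumr.
  by apply: eq_bigr => i _; rewrite lamE [RHS]scalerA.
rewrite IH // /rho /svalue !scalerA.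
have [c2 _] := contracts_inv uw' c's s'P.
set s'' := contracts m s' in c2 *.
have WE : perm_eq (word (ordered s')) (flat m ++ word (ordered s'')).
  apply/allP => i _; apply/eqP; rewrite count_word c's !count_cat; congr (_ + _)%N.
  by rewrite count_word c2.
have uW : uniq (word (ordered s')).
  by apply: word_uniq => i; rewrite c's count_uniq_mem // leq_b1.
have := wsgn_map n [:: x; y] (f := id) (fun _ _ => id) uW WE; rewrite !map_id => ->.
by rewrite -mulrA wsgn_sq mulr1.
Qed.

Lemma svalue_relegs (I : eqType) k u (f1 f2 : I -> seq 'I_k) (dc : I -> nat * V) (s : seq I) h :
  (forall p, p \in s -> perm_eq (f1 p) (f2 p)) ->
  uniq (u ++ flatten (map f1 s)) ->
  svalue u [seq (f1 p, (dc p).1, (dc p).2) | p <- s] h =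
  svalue u [seq (f2 p, (dc p).1, (dc p).2) | p <- s] h.
Proof.
elim: s u => // p s IH u fE us.
have pE : perm_eq (f1 p) (f2 p) by apply: fE; exact: mem_head.
have us' : uniq (u ++ f2 p ++ flatten (map f1 s)).
  by rewrite -(perm_uniq (s1 := u ++ flatten (map f1 (p :: s)))) // perm_cat2l perm_cat2r.
have wE (f : I -> seq 'I_k) : word [seq (f p, (dc p).1, (dc p).2) | p <- s] = flatten (map f s).
  by rewrite /word -map_comp.
rewrite /= (svalue_legs _ _ _ _ pE) ?wE // !svalue_cons /= IH //.
  by move=> q qs; apply: fE; rewrite inE qs orbT.
by rewrite -catA.
Qed.

Definition moved l k (f : 'I_l -> 'I_k) (s : seq (part V l)) : seq (opart k) :=
  [seq (map f (enum (psupp p)), pdeg p, plab p) | p <- s].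

Lemma word_moved l k (f : 'I_l -> 'I_k) (s : seq (part V l)) :
  word (moved f s) = map f (word (ordered s)).
Proof. by rewrite /word map_flatten -!map_comp. Qed.

Lemma value_moved l k (f : 'I_l -> 'I_k) (s : seq (part V l)) h :
  value (moved f s) h = value (ordered s) (h \o f).
Proof.
rewrite /value !big_map; apply: eq_bigr => p _; congr T.
by rewrite /= -map_comp.
Qed.

(** This expands [phi] into products of the forms [lam (ash i)], and evaluates each product with
    legs [ash i]. The starting assignment 0 is overwritten at every leg. *)
Definition psi k (phi : mform g k) (s : seq (part V k)) : P :=
  isum bpair (enum 'I_k)
    (fun h => phi (fun i => (h i).1) *: svalue [::] (ordered s) h) (fun=> 0).

Lemma psi_form k (phi phi1 phi2 : mform g k) q s :
  (forall v, phi v = q * phi1 v + phi2 v) -> psi phi s = q *: psi phi1 s + psi phi2 s.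
Proof.
move=> E; rewrite /psi -isumP; congr isum; apply/funext => h.
by rewrite E scalerDl -scalerA.
Qed.

Lemma psi_perm k (phi : mform g k) (s t : seq (part V k)) : is_lpart n gr s ->
  perm_eq s t -> psi phi s = psi phi t.
Proof.
move=> [s1 s2] st; congr isum; apply/funext => h; congr (_ *: _).
apply: svalue_perm; last 1 first.
- by move=> p /mapP[q /s2 [gq _] ->].
- by apply: word_uniq => i; rewrite /cnt s1.
- exact: ordered_perm.
Qed.

Lemma psi_zero k (phi : mform g k) (s : seq (part V k)) p :
  p \in s -> plab p = 0 -> psi phi s = 0.
Proof.
move=> ps p0; rewrite /psi.
rewrite -[RHS](isum0 _ bpair (enum 'I_k) (fun=> 0)); congr isum; apply/funext => h.
case/splitPr: ps => s1 s2.
rewrite /svalue /value /ordered map_cat big_cat /= big_cons /= p0 T_zero.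
by rewrite mul0r mulr0 !scaler0.
Qed.

Hypothesis T_label : forall d c c' q w, gr d c -> gr d c' ->
  T d (q *: c + c') w = q *: T d c w + T d c' w.

Lemma psi_label k (phi : mform g k) l r (A : {set 'I_k}) d c1 c2 q :
  gr d c1 -> gr d c2 ->
  psi phi (l ++ (A, d, q *: c1 + c2) :: r) =
  q *: psi phi (l ++ (A, d, c1) :: r) + psi phi (l ++ (A, d, c2) :: r).
Proof.
move=> h1 h2; rewrite /psi -isumP; congr isum; apply/funext => h.
have -> : svalue [::] (ordered (l ++ (A, d, q *: c1 + c2) :: r)) h =
    q *: svalue [::] (ordered (l ++ (A, d, c1) :: r)) h +
    svalue [::] (ordered (l ++ (A, d, c2) :: r)) h.
  rewrite /svalue /value /ordered !map_cat !big_cat /= !big_cons /=.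
  rewrite /plab /pdeg /= T_label // /word !map_cat /=.
  by rewrite mulrDl mulrDr -scalerAl -scalerAr scalerDr !scalerA (mulrC q).
move: (svalue _ _ _) (svalue _ _ _) => X Y.
by rewrite scalerDr !scalerA (mulrC q).
Qed.

(** The second clause matches [usym0], which sends inadmissible partitions to 0: since contraction
    preserves [wadm], admissibility is lost only through a label 0, and then [psi] vanishes as
    well. *)
Lemma psi_coend k l (u : brmor k l) (phi : mform g l) (s : seq (part V k)) :
  is_lpart n gr s ->
  psi (dual n u phi) s = wsign (bword (bf u) (bm u)) ^+ n *: psi phi (act n e u s) /\
  (is_lpart n gr (act n e u s) \/ psi phi (act n e u s) = 0).
Proof.
move=> [s1 s2]; have sP p : p \in s -> wadm p by move=> /s2; exact: admissible_wadm.
set r := map (bf u) (enum 'I_l).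
have ubr : uniq (flat (bm u) ++ r).
  by apply: count_mem_uniq => i; have := brP u i; rewrite /bword => E; rewrite E -has_pred1 has_count E.
have enumE : perm_eq (enum 'I_k) (flat (bm u) ++ r).
  apply/allP => i _; apply/eqP; rewrite [RHS](brP u i).
  exact: count_enum.
have fI : injective (bf u).
  apply/injectiveP; move: ubr; rewrite cat_uniq => /and3P[_ _].
  by rewrite /injectiveb /dinjectiveb.
have fr t : bf u t \in r by rewrite map_f ?mem_enum.
have cs i : cnt s i = count_mem i (flat (bm u) ++ r) by rewrite [LHS]s1 [RHS](brP u i).
have [c2 s''P] := contracts_inv ubr cs sP.
set s'' := contracts (bm u) s in c2 s''P.
set t := act n e u s.
have tE : t = [seq (bf u @^-1: psupp p, pdeg p, plab p) | p <- s''] by [].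
have ct i : cnt t i = 1%N.
  transitivity (cnt s'' (bf u i)).
    by rewrite tE /cnt count_map; apply: eq_count => p /=; rewrite inE.
  rewrite c2 count_uniq_mem ?fr //.
  by move: ubr; rewrite cat_uniq => /and3P[].
have uW : uniq (word (ordered t)) by apply: word_uniq => i; rewrite ct.
have WE : perm_eq (word (ordered t)) (enum 'I_l).
  by apply/allP => i _; apply/eqP; rewrite [LHS]count_word ct [RHS]count_enum.
have preE p : p \in s'' ->
    perm_eq (enum (psupp p)) (map (bf u) (enum (bf u @^-1: psupp p))).
  move=> ps; apply: uniq_perm; rewrite ?(map_inj_uniq fI) ?enum_uniq // => i.
  rewrite mem_enum; apply/idP/mapP => [ip|[j + ->]]; last by rewrite mem_enum inE.
  have /mapP[j _ ij] : i \in r.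
    rewrite -has_pred1 has_count -c2 -has_count; apply/hasP; by exists p.
  by exists j => //; rewrite mem_enum inE -ij.
(* All remaining legs lie in the image of [bf u]. Renaming them turns the sign of the matching
   followed by the word into the sign of the Brauer morphism. *)
have svE h : svalue (flat (bm u)) (ordered s'') h =
    wsgn n (bword (bf u) (bm u)) *: svalue [::] (ordered t) (h \o bf u).
  have us'' : uniq (flat (bm u) ++ flatten [seq enum (psupp p) | p <- s'']).
    apply: count_mem_uniq => i; rewrite -has_pred1 has_count.
    have -> : flatten [seq enum (psupp p) | p <- s''] = word (ordered s'').
      by rewrite /word -map_comp.
    by rewrite count_cat count_word c2 -count_cat [count _ _](brP u i).
  rewrite [LHS](svalue_relegs (fun p => (pdeg p, plab p)) h preE us'').
  have -> : [seq (map (bf u) (enum (bf u @^-1: psupp p)), pdeg p, plab p) | p <- s''] =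
      moved (bf u) t by rewrite /moved tE -map_comp.
  rewrite /svalue word_moved value_moved scalerA; congr (_ *: _).
  have := wsgn_map n (flat (bm u)) fI uW WE; rewrite wsgn_enum mulr1 => <-.
  by rewrite -mulrA wsgn_sq mulr1.
split.
  rewrite /psi (isum_perm _ _ _ (enum_uniq _) enumE) isum_cat.
  have E h : isum bpair (flat (bm u)) (fun h => dual n u phi (fun i => (h i).1) *:
      svalue [::] (ordered s) h) h =
    phi (fun i => ((h \o bf u) i).1) *: (wsign (bword (bf u) (bm u)) ^+ n *:
      svalue [::] (ordered t) (h \o bf u)).
    rewrite wsgnE -svE -(svalue_contracts h ubr cs sP).
    rewrite -(@isum_scale _ _ _ _ bpair _ (fun h => phi (fun i => ((h \o bf u) i).1))) => [|h' x v xm].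
      by congr isum; apply/funext => h'; rewrite /= -scalerA.
    congr mf; apply/funext => i; rewrite /= /upf; case: eqP => // ix.
    move: ubr; rewrite cat_uniq => /and3P[_ /hasP[]]; exists x => //.
    by rewrite -ix.
  have -> : isum bpair (flat (bm u)) (fun h => dual n u phi (fun i => (h i).1) *:
      svalue [::] (ordered s) h) = fun h => phi (fun i => ((h \o bf u) i).1) *:
      (wsign (bword (bf u) (bm u)) ^+ n *: svalue [::] (ordered t) (h \o bf u)).
    by apply/funext => h; exact: E.
  rewrite (isum_map _ _ (fun h => phi (fun i => (h i).1) *: (_ *: svalue _ _ h))) //.
  rewrite -isumZ; congr isum; apply/funext => h.
  by move: (svalue _ _ _) => X; rewrite !scalerA mulrC.
have tP p : p \in t -> wadm p.
  rewrite tE => /mapP[q qs ->]; have [q1 q2] := s''P q qs.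
  have -> : wadm (bf u @^-1: psupp q, pdeg q, plab q) = wadm q.
    rewrite /wadm {1 4 6}/pdeg {1 2}/plab {1 2}/psupp /=.
    suff -> : #|bf u @^-1: psupp q| = #|psupp q| by [].
    by rewrite !cardE (perm_size (preE q qs)) size_map.
  exact: s''P.
have [[p pt p0]|np] := pselect (exists2 p, p \in t & plab p = 0).
  by right; exact: psi_zero pt p0.
left; split=> [i|p pt]; first exact: ct.
by apply: wadm_admissible (tP p pt) => p0; apply: np; exists p.
Qed.

Lemma isum_mulr k (w : seq 'I_k) (F c : ('I_k -> vpair) -> P) h :
  (forall h x v, x \in w -> c (upf h x v) = c h) ->
  isum bpair w (fun h => F h * c h) h = isum bpair w F h * c h.
Proof.
elim: w F => //= x w IH F cE; rewrite -IH => [|h' y v yw]; last first.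
  by rewrite cE // inE yw orbT.
congr isum; apply/funext => h'; rewrite mulr_suml; apply: eq_bigr => i _.
by rewrite cE // mem_head.
Qed.

Lemma wsgn_cat k l (w : seq 'I_k) (w' : seq 'I_l) :
  wsgn n (map (@lshift k l) w ++ map (@rshift k l) w') = wsgn n w * wsgn n w'.
Proof.
rewrite /wsgn /esgn map_cat map_val_l map_val_r inversions_cat inversions_shift.
rewrite big1_seq ?addn0 ?exprD // => x /andP[_ /mapP[j _ ->]].
apply/eqP; rewrite eqn0Ngt -has_count; apply/hasPn => y /mapP[z _ ->].
by rewrite -leqNgt (leq_trans (ltnW (ltn_ord j))) // leq_addr.
Qed.

Lemma svalue_lcat k l (s : seq (part V k)) (t : seq (part V l)) h :
  is_lpart n gr s -> is_lpart n gr t ->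
  svalue [::] (ordered (lcat s t)) h =
  svalue [::] (ordered s) (h \o @lshift k l) * svalue [::] (ordered t) (h \o @rshift k l).
Proof.
move=> sP tP; have stP := (is_lpart_lcat n gr s t).2 (conj sP tP).
have pmE r r' (f : 'I_r -> 'I_r') (p : part V r) : injective f ->
    perm_eq (enum (psupp (Defs.pmap f p))) (map f (enum (psupp p))).
  move=> fI; apply: uniq_perm; rewrite ?(map_inj_uniq fI) ?enum_uniq // => i.
  by rewrite mem_enum; apply/imsetP/mapP => -[j jp ->]; exists j => //;
    move: jp; rewrite mem_enum.
pose f2 (p : part V k + part V l) := match p with
  | inl p => map (@lshift k l) (enum (psupp p))
  | inr p => map (@rshift k l) (enum (psupp p)) end.
pose f1 (p : part V k + part V l) := match p with
  | inl p => enum (psupp (Defs.pmap (@lshift k l) p))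
  | inr p => enum (psupp (Defs.pmap (@rshift k l) p)) end.
pose dc (p : part V k + part V l) := match p with
  | inl p => (pdeg p, plab p) | inr p => (pdeg p, plab p) end.
pose st := map inl s ++ map inr t : seq (part V k + part V l).
have E1 : ordered (lcat s t) = [seq (f1 p, (dc p).1, (dc p).2) | p <- st].
  by rewrite /ordered /lcat /st !map_cat -!map_comp.
have E2 : [seq (f2 p, (dc p).1, (dc p).2) | p <- st] =
    moved (@lshift k l) s ++ moved (@rshift k l) t.
  by rewrite /moved /st !map_cat -!map_comp.
rewrite E1 (svalue_relegs dc (f2 := f2)); first last.
- have := word_uniq (s := lcat s t); rewrite E1 /word -map_comp; apply => i.
  by rewrite [cnt _ _]stP.1.
- case=> p _; apply: pmE; [exact: lshift_inj|exact: rshift_inj].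
rewrite E2 /svalue /= -scalerAl -scalerAr scalerA /value big_cat -!/(value _ _).
rewrite !value_moved -wsgn_cat; congr (_ *: _).
by rewrite /word map_cat flatten_cat -!/(word _) !word_moved.
Qed.

Lemma psi_cat k l (phi : mform g k) (chi : mform g l) (s : seq (part V k)) (t : seq (part V l)) :
  is_lpart n gr s -> is_lpart n gr t ->
  psi (tensor phi chi) (lcat s t) = psi phi s * psi chi t.
Proof.
move=> sP tP; rewrite /psi enum_ordD isum_cat.
pose F h := phi (fun i => (h i).1) *: svalue [::] (ordered s) h.
pose G h := chi (fun i => (h i).1) *: svalue [::] (ordered t) h.
have -> : (fun h => tensor phi chi (fun i => (h i).1) *: svalue [::] (ordered (lcat s t)) h) =
   fun h => F (h \o @lshift k l) * G (h \o @rshift k l).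
  apply/funext => h; rewrite svalue_lcat //= /F /G /=.
  move: (svalue _ (ordered s) _) (svalue _ (ordered t) _) => X Y.
  by rewrite -scalerAl -scalerAr scalerA.
have invl h x v : x \in map (@lshift k l) (enum 'I_k) ->
    upf h x v \o @rshift k l = h \o @rshift k l :> ('I_l -> vpair).
  move=> /mapP[j _ ->]; apply/funext => i; rewrite /= /upf.
  by rewrite eq_rlshift.
have invr h x v : x \in map (@rshift k l) (enum 'I_l) ->
    upf h x v \o @lshift k l = h \o @lshift k l :> ('I_k -> vpair).
  move=> /mapP[j _ ->]; apply/funext => i; rewrite /= /upf.
  by rewrite eq_lrshift.
have -> : isum bpair (map (@lshift k l) (enum 'I_k))
    (fun h => F (h \o @lshift k l) * G (h \o @rshift k l)) =
  fun h => isum bpair (enum 'I_k) F (fun=> 0) * G (h \o @rshift k l).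
  apply/funext => h; rewrite (@isum_mulr _ _ _ (fun h => G (h \o @rshift k l))); last first.
    by move=> h' x v xm; rewrite invl.
  rewrite (isum_map _ _ F) //; last exact: lshift_inj.
  congr (_ * _); apply: isum_eq_in => i; by rewrite mem_enum.
rewrite (isum_map _ _ (fun h => isum _ _ F _ * G h)); last exact: rshift_inj.
rewrite -/G; elim: (enum 'I_l) G {invl invr} => //= x w IH G.
rewrite -IH; congr isum; apply/funext => h; by rewrite mulr_sumr.
Qed.

Lemma psi_unit : psi (form1 g) [::] = 1.
Proof.
rewrite /psi; have -> : enum 'I_0 = [::] by apply/size0nil; rewrite size_enum_ord.
by rewrite /= /svalue /value big_nil /wsgn /esgn /= expr0 !scale1r.
Qed.

Lemma psi_full k (v : k.-tuple (H g)) d c :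
  psi (form_of n v) [:: ([set: 'I_k]%SET, d, c)] = T d c v.
Proof.
rewrite /psi.
(* [pre] collects the legs whose sums have been carried out. *)
have E w pre h : uniq w ->
    isum bpair w (fun h => (\prod_(i <- w) lam (tnth v i) (h i).1) *:
      T d c (pre ++ [seq (h i).2 | i <- w])) h = T d c (pre ++ [seq tnth v i | i <- w]).
  elim: w pre h => [|x w IH] pre h; first by rewrite /= big_nil scale1r.
  move=> /andP[xw uw]; rewrite /= -cat_rcons -(IH _ h uw).
  congr isum; apply/funext => h'.
  rewrite cat_rcons {1}(expand_ash ab adual (tnth v x)).
  rewrite (linear_sumZ (f := fun u => T d c (pre ++ u :: _))) => [|*]; last exact: T_linear.
  rewrite scaler_sumr; apply: eq_bigr => i _; rewrite big_cons scalerA mulrC.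
  have -> : upf h' x (bpair i) x = bpair i by rewrite /upf eqxx.
  rewrite map_upf //=; congr (_ * _ *: _).
  apply: eq_big_seq => j jw; rewrite /upf; case: eqP => // jx.
  by rewrite -jx jw in xw.
have := E (enum 'I_k) [::] (fun=> 0) (enum_uniq _); rewrite /= map_tnth_enum => <-.
congr isum; apply/funext => h; rewrite /= big_enum /=; congr (_ *: _).
rewrite /svalue /value /ordered /word /= big_seq1 /= /psupp /= cats0.
have -> : enum [set: 'I_k]%SET = enum 'I_k by apply: eq_enum => i; rewrite !inE.
by rewrite wsgn_enum scale1r.
Qed.

Variable D : nat -> P -> Prop.
Hypotheses (D0 : forall m, D m 0) (D1 : D 0%N 1).
Hypothesis DP : forall m q x y, D m x -> D m y -> D m (q *: x + y).
Hypothesis DM : forall m m' x y, D m x -> D m' y -> D (m + m')%N (x * y).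
Hypothesis DT : forall d c w, gr d c -> D (d + n * size w - 2 * n)%N (T d c w).

Lemma psi_deg k (phi : mform g k) (s : lpart n gr k) : D (lpdeg s) (psi phi s).
Proof.
have DZ m q x : D m x -> D m (q *: x).
  by move=> h; rewrite -[_ *: _]addr0; apply: DP.
have Dv h : D (lpdeg s) (value (ordered s) h).
  rewrite /lpdeg; case: s => s /= [_ s2]; elim: s s2 => [|p s IH] s2.
    by rewrite /value !big_nil.
  rewrite /value /= !big_cons; apply: DM; last first.
    by apply: IH => q qs; apply: s2; rewrite inE qs orbT.
  have [gp _] := s2 p (mem_head _ _).
  by have := DT [seq (h i).2 | i <- enum (psupp p)] gp; rewrite size_map -cardE.
have G w F h : (forall h, D (lpdeg s) (F h)) -> D (lpdeg s) (isum bpair (k := k) w F h).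
  elim: w F h => [|x w IH] F h DF //=; apply: IH => h'.
  elim: (index_enum _) => [|i r IHr]; first by rewrite big_nil; exact: D0.
  by rewrite big_cons -[F _]scale1r; apply: DP; [exact: DF|exact: IHr].
by apply: G => h; do 2!apply: (DZ).
Qed.

End States.

(** * Calculus in the coend *)

Section Quotients.
Variables (A : lalgType rat) (I : tsideal A).
Implicit Types (q : rat) (x y : A // I).

Lemma quot_piP q (u v : A) : \cls_I (q *: u + v) = q *: \cls_I u + \cls_I v.
Proof. by rewrite -[RHS]/(Quot.add (Quot.scale _ _) _) Quot.scaleE Quot.addE. Qed.

Lemma quot_piM (u v : A) : \cls_I (u * v) = \cls_I u * \cls_I v.
Proof. by rewrite -[RHS]/(Quot.mul _ _) Quot.mulE. Qed.

Lemma quot_piZ q (u : A) : \cls_I (q *: u) = q *: \cls_I u.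
Proof. by rewrite -[RHS]/(Quot.scale _ _) Quot.scaleE. Qed.

Lemma quot_scaleAl q x y : q *: (x * y) = q *: x * y.
Proof.
have [u ->] := Quot.pi_surj x; have [v ->] := Quot.pi_surj y.
by rewrite -quot_piM -!quot_piZ -quot_piM scalerAl.
Qed.

Lemma quot_scaleAr q x y :
  (forall p (u v : A), u * (p *: v) = p *: (u * v)) ->
  q *: (x * y) = x * (q *: y).
Proof.
move=> AZr; have [u ->] := Quot.pi_surj x; have [v ->] := Quot.pi_surj y.
by rewrite -quot_piM -!quot_piZ -quot_piM AZr.
Qed.

End Quotients.

(** * Classes of labelled partitions and their splitting into kappas *)

Section CoendCalculus.
Variables (n g : nat) (V : comAlgType rat) (gr : nat -> set V) (e : V).
Hypothesis (n_gt0 : (0 < n)%N).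
Hypothesis (hgr : even_grading gr).

Local Notation eps := ((-1) ^+ n : rat).
Local Notation lam := (@lam n g).
Local Notation R := (RV n g gr e).
Local Notation cls := (@cls_RV n g V gr e).

Lemma RV_scaleAl q (x y : R) : q *: (x * y) = q *: x * y.
Proof. exact: quot_scaleAl. Qed.

Lemma RV_scaleAr q (x y : R) : q *: (x * y) = x * (q *: y).
Proof. by apply: quot_scaleAr => *; exact: sym_mulZr. Qed.

Lemma clsP q x y : cls (q *: x + y) = q *: cls x + cls y.
Proof. exact: quot_piP. Qed.

Lemma cls0 : cls 0 = 0. Proof. by []. Qed.

Lemma clsM x y : cls (x * y) = cls x * cls y.
Proof. exact: quot_piM. Qed.

Lemma cls_rel x y : coend_rel e (x - y) -> cls x = cls y.
Proof. by move=> h; apply/Quot.pi_eq; exact: WR. Qed.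

(** Total in [s], with value 0 on inadmissible partitions, so that linearity in the form and
    products need no side condition. *)
Definition rv k (phi : mform g k) (s : seq (part V k)) : R := cls (usym0 n gr phi s).

Lemma rvE k (phi : mform g k) (s : lpart n gr k) : rv phi s = cls (usym (Defs.Sym phi s)).
Proof.
rewrite /rv /usym0; case: pselect => [sP|]; last by case; exact: lpP.
by do 3!congr (_ _); exact: lpart_eq.
Qed.

Lemma rv_out k (phi : mform g k) s : ~ is_lpart n gr s -> rv phi s = 0.
Proof. by rewrite /rv /usym0; case: pselect. Qed.

Lemma rv_form k (phi phi1 phi2 : mform g k) q s :
  (forall v, phi v = q * phi1 v + phi2 v) -> rv phi s = q *: rv phi1 s + rv phi2 s.
Proof.
move=> E; have [sP|sP] := pselect (is_lpart n gr s); last first.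
  by rewrite !rv_out // scaler0 addr0.
rewrite -[s]/(lp (LPart sP)) !rvE -clsP; apply: cls_rel.
exact: rel_form.
Qed.

Lemma sum_multilinear k (I : Type) (r : seq I) (F : I -> mform g k) :
  multilinear (fun z => \sum_(i <- r) F i z).
Proof.
move=> z i q x y; rewrite mulr_sumr -big_split; apply: eq_bigr => j _.
exact: mfP.
Qed.

Definition sum_form k (I : Type) (r : seq I) (F : I -> mform g k) : mform g k :=
  MForm (sum_multilinear r F).

Lemma rv_sum k (I : Type) (r : seq I) (F : I -> mform g k) s :
  rv (sum_form r F) s = \sum_(i <- r) rv (F i) s.
Proof.
elim: r => [|i r IH].
  rewrite big_nil; set phi := sum_form _ _.
  rewrite (rv_form (phi1 := phi) (phi2 := phi) (q := -1)) ?scaleN1r ?addNr // => v.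
  by rewrite /= !big_nil mulr0 addr0.
rewrite big_cons -IH -[rv (F i) s]scale1r; apply: rv_form => v.
by rewrite /= big_cons mul1r.
Qed.

Lemma rv_formZ k (phi phi1 : mform g k) q s :
  (forall v, phi v = q * phi1 v) -> rv phi s = q *: rv phi1 s.
Proof.
(* The empty sum supplies the zero form. *)
move=> E; have r0 : rv (sum_form (Nil nat) (fun=> phi)) s = 0 by rewrite rv_sum big_nil.
rewrite -[RHS]addr0 -r0; apply: rv_form => v.
by rewrite E /= big_nil addr0.
Qed.

Lemma rv_perm k (phi : mform g k) s t : perm_eq s t -> rv phi s = rv phi t.
Proof.
move=> st; have [sP|sP] := pselect (is_lpart n gr s); last first.
  rewrite !rv_out // => tP; apply: sP; apply: perm_is_lpart tP.
  by rewrite perm_sym.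
have tP := perm_is_lpart st sP.
rewrite -[s]/(lp (LPart sP)) -[t]/(lp (LPart tP)) !rvE; apply: cls_rel.
exact: rel_order.
Qed.

Lemma rv_label k (phi : mform g k) l r (A : {set 'I_k}) d c1 c2 q :
  gr d c1 -> gr d c2 ->
  rv phi (l ++ (A, d, q *: c1 + c2) :: r) =
  q *: rv phi (l ++ (A, d, c1) :: r) + rv phi (l ++ (A, d, c2) :: r).
Proof.
move=> h1 h2; have h12 : gr d (q *: c1 + c2) by apply: (gr_subspace hgr d).2.
have transf c c' : gr d c -> gr d c' -> is_lpart n gr (l ++ (A, d, c) :: r) ->
    is_lpart n gr (l ++ (A, d, c') :: r).
  move=> hc hc' [s1 s2]; split=> [i|p].
    by rewrite -(s1 i) !count_cat.
  rewrite mem_cat inE => /or3P[pl|/eqP ->|pr].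
  - by apply: s2; rewrite mem_cat pl.
  - have [//|_ h] := s2 (A, d, c) _; first by rewrite mem_cat mem_head orbT.
    by split.
  - by apply: s2; rewrite mem_cat inE pr !orbT.
have [sP|sP] := pselect (is_lpart n gr (l ++ (A, d, q *: c1 + c2) :: r)); last first.
  rewrite !rv_out ?scaler0 ?addr0 // => sP'; apply: sP; exact: transf sP'.
have s1P := transf _ _ h12 h1 sP; have s2P := transf _ _ h12 h2 sP.
rewrite -[_ ++ _]/(lp (LPart sP)) -[X in _ *: rv _ X]/(lp (LPart s1P)).
rewrite -[X in _ + rv _ X]/(lp (LPart s2P)) !rvE -clsP; apply: cls_rel.
exact: (@rel_label n g V gr e k phi (LPart sP) (LPart s1P) (LPart s2P) l r A d c1 c2 q).
Qed.

Lemma rv_zero k (phi : mform g k) l r (A : {set 'I_k}) d :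
  rv phi (l ++ (A, d, 0) :: r) = 0.
Proof.
have h := (gr_subspace hgr d).1.
by have := rv_label phi l r A (-1) h h; rewrite !scaleN1r !addNr.
Qed.

Lemma rv_coend k l (u : brmor k l) (phi : mform g l) s : is_lpart n gr s ->
  rv (dual n u phi) s = wsgn n (bword (bf u) (bm u)) *: rv phi (act n e u s).
Proof.
move=> sP; rewrite -[s]/(lp (LPart sP)) rvE -wsgnE.
set w := _ ^+ n; rewrite -[RHS]addr0 -cls0 -clsP; apply: cls_rel.
by rewrite addr0; exact: rel_coend.
Qed.

Lemma rv_cat k l (phi : mform g k) (chi : mform g l) s t :
  rv phi s * rv chi t = rv (tensor phi chi) (lcat s t).
Proof.
have [sP|sP] := pselect (is_lpart n gr s); last first.
  by rewrite (rv_out phi sP) mul0r rv_out // => /is_lpart_lcat[].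
have [tP|tP] := pselect (is_lpart n gr t); last first.
  by rewrite (rv_out chi tP) mulr0 rv_out // => /is_lpart_lcat[].
rewrite -[s]/(lp (LPart sP)) -[t]/(lp (LPart tP)) !rvE -clsM usymM.
by rewrite -(rvE (tensor _ _) (lunion _ _)).
Qed.

(** Legs form a list instead of a tuple, so that concatenation needs no casts. *)
Definition kap d c (w : seq (H g)) : R := kappa n gr e (in_tuple w) d c.

Lemma kappaE k (v : k.-tuple (H g)) d c : kappa n gr e v d c = kap d c v.
Proof.
case: v => w wk /=; have kE := eqP wk; case: k / kE wk => wk.
by congr kappa; exact: val_inj.
Qed.

Lemma kapE k (v : k.-tuple (H g)) d c :
  kap d c v = rv (form_of n v) [:: ([set: 'I_k]%SET, d, c)].
Proof. by rewrite -kappaE. Qed.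

Lemma kap_label d c1 c2 q w : gr d c1 -> gr d c2 ->
  kap d (q *: c1 + c2) w = q *: kap d c1 w + kap d c2 w.
Proof. exact: (rv_label _ [::] [::]). Qed.

Lemma kap_zero d w : kap d 0 w = 0.
Proof. exact: (rv_zero _ [::] [::]). Qed.

Lemma cover_part k (S : seq (opart V k)) (i : 'I_k) :
  count (fun p => i \in psupp p)
    [seq ([set j | j \in p.1.1]%SET, p.1.2, p.2) : part V k | p <- S] =
  count (fun p => i \in p.1.1) S.
Proof. by rewrite count_map; apply: eq_count => p /=; rewrite inE. Qed.

(** A product of kappas is a disjoint union, whose legs are numbered along the word of [S]; [f]
    recovers their names. *)
Lemma prod_kap k (S : seq (opart V k)) (v : 'I_k -> H g) : uniq (word S) ->
  exists N (f : 'I_N -> 'I_k) (phi : mform g N),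
  [/\ map f (enum 'I_N) = word S,
      forall x, phi x = \prod_t lam (v (f t)) (x t) &
      \prod_(p <- S) kap p.1.2 p.2 (map v p.1.1) =
      rv phi [seq (f @^-1: [set j | j \in p.1.1]%SET, p.1.2, p.2) | p <- S]].
Proof.
elim: S => [|[[w d] c] S IH] /=.
  move=> _; exists 0%N, (fun i : 'I_0 => False_rect _ (notF (ltn_ord i))).
  exists (form1 g); split.
  - have -> : enum 'I_0 = [::] by apply/size0nil; rewrite size_enum_ord.
    by [].
  - by move=> x; rewrite big_ord0.
  - rewrite big_nil /= -[[::]]/(lp (lpart0 n gr)) rvE.
    by [].
rewrite /word /= cat_uniq => /and3P[uw /hasPn wS uS].
have [N [f [phi [fE phiE SE]]]] := IH uS.
pose F (i : 'I_(size w + N)) : 'I_k :=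
  match fintype.split i with inl i => tnth (in_tuple w) i | inr i => f i end.
have Fl i : F (lshift N i) = tnth (in_tuple w) i.
  by rewrite /F (unsplitK (inl i : 'I_(size w) + 'I_N)).
have Fr i : F (rshift (size w) i) = f i.
  by rewrite /F (unsplitK (inr i : 'I_(size w) + 'I_N)).
exists (size w + N)%N, F, (tensor (form_of n (map_tuple v (in_tuple w))) phi); split.
- rewrite enum_ordD map_cat -!(map_comp F); congr (_ ++ _); last first.
    by rewrite -[RHS]/(word S) -fE; apply: eq_map => i; exact: Fr.
  rewrite -[RHS](map_tnth_enum (in_tuple w)); apply: eq_map => i; exact: Fl.
- move=> x; rewrite big_split_ord /= phiE; congr (_ * _); apply: eq_bigr => i _.
    by rewrite tnth_map Fl.
  by rewrite Fr.
rewrite big_cons SE /= -[map v w]/(tval (map_tuple v (in_tuple w))) kapE rv_cat.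
congr rv; rewrite /lcat /= /Defs.pmap /psupp /pdeg /plab /=; congr (_ :: _).
  congr (_, _, _); apply/setP => i; rewrite !inE.
  case: (split_ordP i) => j ->.
    by rewrite Fl mem_tnth mem_imset ?inE //; exact: lshift_inj.
  rewrite Fr; transitivity false.
    by apply/imsetP => -[t _ /eqP]; rewrite eq_rlshift.
  apply/esym/negbTE/wS; rewrite -/(word S) -fE; apply: map_f.
  by rewrite mem_enum.
rewrite -map_comp; apply/eq_in_map => p pS /=; congr (_, _, _).
apply/setP => i; rewrite !inE; case: (split_ordP i) => j ->.
  rewrite Fl; transitivity false.
    by apply/imsetP => -[t _ /eqP]; rewrite eq_lrshift.
  apply/esym/negbTE/negP => jp.
  have : tnth (in_tuple w) j \in flatten [seq q.1.1 | q <- S].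
    by apply/flattenP; exists p.1.1 => //; apply/mapP; exists p.
  by move=> /wS; rewrite mem_tnth.
by rewrite Fr mem_imset ?inE //; exact: rshift_inj.
Qed.

(** Renumbering the legs along [word S] is a Brauer morphism with empty matching. Its coend relation
    turns the product of kappas into the given class, with the sign of the word. *)
Lemma rv_split k (vt : k.-tuple (H g)) (s : seq (part V k)) (S : seq (opart V k)) :
  is_lpart n gr s ->
  s = [seq ([set j | j \in p.1.1]%SET, p.1.2, p.2) | p <- S] ->
  perm_eq (word S) (enum 'I_k) ->
  rv (form_of n vt) s =
  wsgn n (word S) *: \prod_(p <- S) kap p.1.2 p.2 (map (tnth vt) p.1.1).
Proof.
move=> sP sE WE.
have uW : uniq (word S) by rewrite (perm_uniq WE) enum_uniq.
have [N [f [phi [fE phiE ->]]]] := prod_kap (tnth vt) uW.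
have uP i : count_mem i (bword f [::]) = 1%N.
  by rewrite /bword /= fE (seq.permP WE) count_enum.
have -> : form_of n vt = dual n (BrMor uP) phi.
  apply: mform_eq => x /=; rewrite big_nil mulr1 phiE.
  transitivity (\prod_(i <- map f (enum 'I_N)) lam (tnth vt i) (x i)).
    by rewrite fE (perm_big _ WE) big_enum.
  by rewrite big_map big_enum.
rewrite (rv_coend (BrMor uP) phi sP) /bword /= fE; congr (_ *: rv _ _).
by rewrite /act /= sE -map_comp.
Qed.

Definition adm (d : nat) (c : V) (m : nat) : Prop :=
  gr d c /\ match m with
            | 0 => (2 * n < d)%N | 1 => (n <= d)%N | 2 => (0 < d)%N | _ => True
            end.

Lemma adm_admissible k (A : {set 'I_k}) d c : adm d c #|A| -> admissible n gr (A, d, c).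
Proof. by []. Qed.

Lemma kap_out d c w : ~ adm d c (size w) -> kap d c w = 0.
Proof.
move=> nadm; rewrite -[w]/(tval (in_tuple w)) kapE rv_out // => -[_ s2].
apply: nadm; have := s2 _ (mem_head _ _).
by rewrite /admissible /psupp /= cardsT card_ord.
Qed.

Lemma single_lpart k d c : adm d c k -> is_lpart n gr [:: ([set: 'I_k]%SET, d, c)].
Proof.
move=> h; split=> [i|p]; first by rewrite /= /psupp /= inE.
by rewrite inE => /eqP ->; apply: adm_admissible; rewrite cardsT card_ord.
Qed.

Lemma map_eq_cat2 (T1 T2 : Type) (f : T1 -> T2) E l x y r :
  map f E = l ++ x :: y :: r -> exists E1 i j E2,
  [/\ E = E1 ++ i :: j :: E2, map f E1 = l, f i = x, f j = y & map f E2 = r].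
Proof.
elim: l E => [|z l IH] [|u E] //=.
  by case: E => [|u' E] // [<- <- <-]; exists [::], u, u', E.
by case=> <- /IH [E1 [i [j [E2 [-> <- <- <- <-]]]]]; exists (u :: E1), i, j, E2.
Qed.

Lemma set_perm_enum k (w : seq 'I_k) : perm_eq w (enum 'I_k) ->
  [set j | j \in w]%SET = [set: 'I_k]%SET.
Proof. by move=> wE; apply/setP => i; rewrite !inE (perm_mem wE) mem_enum. Qed.

(** A single part records no order of its legs, so [rv_split] may list them with two neighbours
    exchanged, at the cost of the sign. *)
Lemma kap_swap d c l x y r :
  kap d c (l ++ x :: y :: r) = eps *: kap d c (l ++ y :: x :: r).
Proof.
have [h|h] := pselect (adm d c (size (l ++ x :: y :: r))); last first.
  by rewrite !kap_out ?scaler0 //; move: h; rewrite !size_cat.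
set w := l ++ _ in h *.
have [E1 [i [j [E2 [EE <- <- <- <-]]]]] := map_eq_cat2 (map_tnth_enum (in_tuple w)).
have pE : perm_eq (E1 ++ j :: i :: E2) (enum 'I_(size w)) by rewrite EE perm_swap2.
have ij : i != j by apply: (@uniq_neq2 _ E1 i j E2); rewrite -EE enum_uniq.
rewrite -[w in LHS]/(tval (in_tuple w)) kapE.
rewrite (@rv_split _ _ _ [:: (E1 ++ j :: i :: E2, d, c)]).
- rewrite /word /= cats0 big_seq1 /= map_cat /=; congr (_ *: _).
  have := wsgn_enum n (size w); rewrite EE (wsgn_swap n E1 E2 ij) => wE.
  by rewrite -[LHS]mul1r -{1}(eps_sq n) -mulrA wE mulr1.
- exact: single_lpart.
- by rewrite /= set_perm_enum.
- by rewrite /word /= cats0.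
Qed.

(** Both products come from one partition with two parts, listed in either order; [rv_split]
    provides the two signs. *)
Lemma kap_comm d c d' c' w w' :
  kap d c w * kap d' c' w' = eps ^+ (size w * size w') *: (kap d' c' w' * kap d c w).
Proof.
have [h|h] := pselect (adm d c (size w)); last first.
  by rewrite (kap_out h) mul0r mulr0 scaler0.
have [h'|h'] := pselect (adm d' c' (size w')); last first.
  by rewrite (kap_out h') mul0r mulr0 scaler0.
pose vt := cat_tuple (in_tuple w) (in_tuple w').
pose W1 := map (@lshift (size w) (size w')) (enum 'I_(size w)).
pose W2 := map (@rshift (size w) (size w')) (enum 'I_(size w')).
have W1E : map (tnth vt) W1 = w.
  rewrite -map_comp -[RHS](map_tnth_enum (in_tuple w)); apply: eq_map => i /=.
  by rewrite tnth_lshift.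
have W2E : map (tnth vt) W2 = w'.
  rewrite -map_comp -[RHS](map_tnth_enum (in_tuple w')); apply: eq_map => i /=.
  by rewrite tnth_rshift.
have card1E : #|[set j | j \in W1]%SET| = size w.
  have u1 : uniq W1 by rewrite (map_inj_uniq (@lshift_inj _ _)) enum_uniq.
  by rewrite cardsE (card_uniqP u1) [size W1]size_map size_enum_ord.
have card2E : #|[set j | j \in W2]%SET| = size w'.
  have u2 : uniq W2 by rewrite (map_inj_uniq (@rshift_inj _ _)) enum_uniq.
  by rewrite cardsE (card_uniqP u2) [size W2]size_map size_enum_ord.
pose set_of (p : opart V (size w + size w')) : part V (size w + size w') :=
  ([set j | j \in p.1.1]%SET, p.1.2, p.2).
pose p1 : opart V (size w + size w') := (W1, d, c).
pose p2 : opart V (size w + size w') := (W2, d', c').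
have lE : is_lpart n gr (map set_of [:: p1; p2]).
  split=> [i|p].
    rewrite cover_part /= addn0; case: (split_ordP i) => j ->.
      rewrite mem_map ?mem_enum; last exact: lshift_inj.
      suff /negbTE -> : lshift (size w') j \notin W2 by [].
      by apply/mapP => -[t _ /eqP]; rewrite eq_lrshift.
    rewrite [in X in (_ + X)%N]mem_map ?mem_enum; last exact: rshift_inj.
    suff /negbTE -> : rshift (size w) j \notin W1 by [].
    by apply/mapP => -[t _ /eqP]; rewrite eq_rlshift.
  rewrite !inE => /orP[] /eqP ->; apply: adm_admissible.
    by rewrite -[p1.1.1]/W1 card1E.
  by rewrite -[p2.1.1]/W2 card2E.
have E1 := @rv_split _ vt _ [:: p1; p2] lE erefl.
have E2 := @rv_split _ vt _ [:: p2; p1]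
  (perm_is_lpart (perm_swap2 [::] _ _ [::]) lE) erefl.
have W12 : word [:: p1; p2] = enum 'I_(size w + size w').
  by rewrite /word /= cats0 enum_ordD.
have W21 : word [:: p2; p1] = W2 ++ W1 by rewrite /word /= cats0.
have W12E : perm_eq (word [:: p1; p2]) (enum 'I_(size w + size w')) by rewrite W12.
have W21E : perm_eq (word [:: p2; p1]) (enum 'I_(size w + size w')).
  by rewrite W21 -W12 /word /= cats0; exact/permEl/perm_catC.
have := rv_perm (form_of n vt) (perm_swap2 [::] (set_of p1) (set_of p2) [::]).
rewrite [LHS](E1 W12E) [RHS](E2 W21E) !big_cons !big_nil !mulr1 /= W1E W2E W12 W21.
rewrite wsgn_enum scale1r => ->; congr (_ *: _).
have u21 : uniq (W2 ++ W1) by rewrite -W21 (perm_uniq W21E) enum_uniq.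
have := wsgn_block n [::] [::] u21; rewrite !cat0s !cats0 => ->.
have -> : W1 ++ W2 = enum 'I_(size w + size w') by rewrite -W12 /word /= cats0.
rewrite wsgn_enum mulr1 mulnC; congr (_ ^+ (_ * _)).
  by rewrite [LHS]size_map size_enum_ord.
by rewrite [LHS]size_map size_enum_ord.
Qed.

(** * Gluing rules for the kappas, and expansion of forms in dual bases *)

Section Contraction.
Variables a ash : 'I_(g + g) -> H g.
Hypothesis (ab : basis_of fullv [tuple a i | i < g + g]).
Hypothesis (adual : forall i j, lam (ash i) (a j) = (i == j)%:R).

Section Pair.
Variable l : nat.
Let x : 'I_(2 + l) := lshift l ord0.
Let y : 'I_(2 + l) := lshift l ord_max.
Let f : 'I_l -> 'I_(2 + l) := @rshift 2 l.

Lemma pair_word : bword f [:: (x, y)] = enum 'I_(2 + l).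
Proof.
rewrite enum_ordD -[LHS]/([:: x; y] ++ map f (enum 'I_l)); congr (_ ++ _).
by apply: (inj_map val_inj); rewrite map_val_l val_enum_ord.
Qed.

Lemma pair_count i : count_mem i (bword f [:: (x, y)]) = 1%N.
Proof. by rewrite pair_word count_enum. Qed.

Definition pair_mor : brmor (2 + l) l := BrMor pair_count.

(** Contracting the first two legs has sign 1, and by [sum_lam_dual] the dual of this morphism
    inserts the dual bases there. *)
Lemma rv_pair (vt : l.-tuple (H g)) (s : seq (part V (2 + l))) :
  is_lpart n gr s ->
  \sum_i rv (form_of n [tuple of a i :: ash i :: vt]) s =
  rv (form_of n vt) (act n e pair_mor s).
Proof.
move=> sP; have := rv_coend pair_mor (form_of n vt) sP.
rewrite pair_word wsgn_enum scale1r => <-.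
have vE i (z : 'I_(2 + l) -> H g) :
    form_of n [tuple of a i :: ash i :: vt] z =
    lam (a i) (z x) * lam (ash i) (z y) * form_of n vt (fun t => z (f t)).
  have hx : tnth [tuple of a i :: ash i :: vt] x = a i by [].
  have hy : tnth [tuple of a i :: ash i :: vt] y = ash i by [].
  have x0 : x = ord0 by exact: val_inj.
  have y1 : y = lift ord0 ord0 by exact: val_inj.
  rewrite -hx -hy x0 y1 /= 2!big_ord_recl mulrA; congr (_ * _).
  apply: eq_bigr => t _; rewrite !(tnth_nth 0) /=; congr (lam _ (z _)).
  exact: val_inj.
rewrite -rv_sum; congr rv; apply: mform_eq => z /=.
rewrite big_seq1 -(sum_lam_dual ab adual) mulr_sumr; apply: eq_bigr => i _.
by rewrite [LHS]vE mulrC.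
Qed.

End Pair.

Lemma kap_loop d c w : adm d c (2 + size w) ->
  \sum_i kap d c (a i :: ash i :: w) = kap (2 * n + d) (e * c) w.
Proof.
move=> h; have := rv_pair (in_tuple w) (single_lpart h).
under eq_bigr do rewrite -kapE.
move=> ->; rewrite -[w in RHS]/(tval (in_tuple w)) kapE; congr rv.
rewrite /act /= /contract /= {1}/psupp /= inE /=; congr [:: (_, _, _)].
by apply/setP => t; rewrite !inE !eq_rlshift.
Qed.

Lemma kap_glue d c d' c' w1 w2 :
  adm d c (size w1).+1 -> adm d' c' (size w2).+1 ->
  \sum_i kap d c (rcons w1 (a i)) * kap d' c' (ash i :: w2) =
  kap (d + d') (c * c') (w1 ++ w2).
Proof.
move=> h h'; set l := (size w1 + size w2)%N.
pose vt : l.-tuple (H g) := cat_tuple (in_tuple w1) (in_tuple w2).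
pose x : 'I_(2 + l) := lshift l ord0.
pose y : 'I_(2 + l) := lshift l ord_max.
pose f : 'I_l -> 'I_(2 + l) := @rshift 2 l.
pose W1 := map f (map (@lshift (size w1) (size w2)) (enum 'I_(size w1))).
pose W2 := map f (map (@rshift (size w1) (size w2)) (enum 'I_(size w2))).
have fI : injective f by exact: rshift_inj.
have fx t : (f t == x) = false by rewrite eq_rlshift.
have fy t : (f t == y) = false by rewrite eq_rlshift.
have fW1 t : (f t \in W1) = (t \in map (@lshift (size w1) (size w2)) (enum 'I_(size w1))).
  by rewrite mem_map.
have fW2 t : (f t \in W2) = (t \in map (@rshift (size w1) (size w2)) (enum 'I_(size w2))).
  by rewrite mem_map.
have wE : [:: x; y] ++ W1 ++ W2 = enum 'I_(2 + l).
  by rewrite -[RHS]pair_word /bword /= -map_cat -enum_ordD.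
have uE : uniq ([:: x; y] ++ W1 ++ W2) by rewrite wE enum_uniq.
(* Placing [x] last and [y] first matches [rcons w1 (a i)] and [ash i :: w2]. The sign of this word
   is 1, as the pair moves past [W1] freely. *)
pose S : seq (opart V (2 + l)) := [:: (rcons W1 x, d, c); (y :: W2, d', c')].
have SE : word S = W1 ++ [:: x; y] ++ W2.
  by rewrite /word /= cats0 cat_rcons.
have Sp : perm_eq (word S) (enum 'I_(2 + l)).
  by rewrite SE -wE; apply/permEl/perm_catCA.
have u1 : uniq (W1 ++ [:: x; y]).
  rewrite (perm_uniq (permEl (perm_catC W1 [:: x; y]))).
  by rewrite catA cat_uniq in uE; case/andP: uE.
have Ssgn : wsgn n (word S) = 1.
  rewrite SE; have := wsgn_block n [::] W2 u1; rewrite !cat0s => ->.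
  by rewrite wE wsgn_enum mulr1 /= -exprM mulnA exprM sqrr_sign.
have sW1 : size W1 = size w1 by rewrite [LHS]size_map size_map size_enum_ord.
have sW2 : size W2 = size w2 by rewrite [LHS]size_map size_map size_enum_ord.
pose s : seq (part V (2 + l)) := [seq ([set j | j \in p.1.1]%SET, p.1.2, p.2) | p <- S].
have uS : uniq (word S) by rewrite (perm_uniq Sp) enum_uniq.
have sP : is_lpart n gr s.
  split=> [i|p].
    rewrite cover_part; have := count_enum i; rewrite -(seq.permP Sp) /word /= cats0.
    rewrite count_cat !count_uniq_mem ?addn0 //.
      by move: uS; rewrite /word /= cats0 cat_uniq => /and3P[].
    by move: uS; rewrite /word /= cats0 cat_uniq => /and3P[].
  move: uS; rewrite /word /= cats0 cat_uniq => /and3P[ua _ ub].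
  rewrite !inE => /orP[] /eqP ->; apply: adm_admissible.
    by rewrite cardsE (card_uniqP ua) size_rcons sW1.
  by rewrite cardsE (card_uniqP ub) /= sW2.
have := rv_pair vt sP.
have -> : rv (form_of n vt) (act n e (pair_mor l) s) = kap (d + d') (c * c') (w1 ++ w2).
  rewrite -[w1 ++ w2]/(tval vt) kapE; congr rv.
  rewrite /act /= /contract /= /psupp /= !inE !mem_rcons !inE !eqxx !orbT /=.
  congr [:: (_, _, _)]; apply/setP => t; rewrite !inE mem_rcons !inE !fx !fy /=.
  rewrite fW1 fW2 -mem_cat -enum_ordD mem_enum.
  by [].
move=> <-; apply: eq_bigr => i _; rewrite (rv_split _ sP erefl Sp) Ssgn scale1r.
set T := [tuple of _]; have Tf t : tnth T (f t) = tnth vt t.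
  by rewrite !(tnth_nth 0).
have T1 : map (tnth T) W1 = w1.
  rewrite -map_comp -map_comp -[RHS](map_tnth_enum (in_tuple w1)).
  by apply: eq_map => t; rewrite /= Tf tnth_lshift.
have T2 : map (tnth T) W2 = w2.
  rewrite -map_comp -map_comp -[RHS](map_tnth_enum (in_tuple w2)).
  by apply: eq_map => t; rewrite /= Tf tnth_rshift.
by rewrite !big_cons big_nil mulr1 /= map_rcons T1 T2.
Qed.

Local Notation bp := (bpair a ash).

Lemma rv_isum k (w : seq 'I_k) (phi : mform g k) (G : ('I_k -> vpair g) -> mform g k) s h :
  (forall z, phi z = isum (M := rat^o) bp w (fun h => G h z) h) ->
  rv phi s = isum bp w (fun h => rv (G h) s) h.
Proof.
elim: w phi G h => [|x w IH] phi G h E /=.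
  by congr rv; apply: mform_eq.
rewrite (IH phi (fun h => sum_form (index_enum _) (fun i => G (upf h x (bp i)))) h) //.
by congr isum; apply/funext => h'; rewrite rv_sum.
Qed.

Lemma mform_expand k (phi : mform g k) z (h : 'I_k -> vpair g) :
  phi z = isum (M := rat^o) bp (enum 'I_k)
    (fun h => phi (fun i => (h i).1) * \prod_i lam (h i).2 (z i)) h.
Proof.
(* An intermediate stage: the arguments in [w] are expanded, the others are still those of [z]. *)
have E w : uniq w -> phi z = isum (M := rat^o) bp w
    (fun h => phi (fun i => if i \in w then (h i).1 else z i) *
              \prod_(i <- w) lam (h i).2 (z i)) h.
  elim: w => [|x w IH]; first by rewrite /= big_nil mulr1.
  move=> /andP[xw uw]; rewrite /= {1}(IH uw).
  apply: (congr1 (fun F => isum (M := rat^o) bp w F h)); apply/funext => h'.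
  pose v i := if i \in w then (h' i).1 else z i.
  have vE u : phi (fun i => if i \in x :: w then (upf h' x u i).1 else z i) = phi (upd v x u.1).
    congr mf; apply/funext => i; rewrite /upd /upf inE /v.
    by case: (i =P x).
  have -> : phi (fun i => if i \in w then (h' i).1 else z i) =
      \sum_i lam (ash i) (z x) * phi (upd v x (a i)).
    rewrite -(linear_sumZ (W := rat^o) (f := fun u => phi (upd v x u))); last first.
      by move=> *; exact: mfP.
    rewrite -(expand_a ab adual); congr mf; apply/funext => i; rewrite /upd.
    by case: eqP => // ->; rewrite (negbTE xw).
  rewrite mulr_suml; apply: eq_bigr => i _; rewrite vE big_cons /upf eqxx /=.
  rewrite (mulrC (lam _ _)) -mulrA; congr (_ * (_ * _)).
  apply: eq_big_seq => j jw; case: eqP => // jx.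
  by rewrite -jx jw in xw.
rewrite {1}(E _ (enum_uniq 'I_k)).
apply: (congr1 (fun F => isum (M := rat^o) bp (enum 'I_k) F h)); apply/funext => h'.
rewrite big_enum /=; congr (phi _ * _); apply/funext => i.
by rewrite mem_enum.
Qed.

Lemma rv_expand k (phi : mform g k) s h :
  rv phi s = isum bp (enum 'I_k) (fun h => phi (fun i => (h i).1) *:
    rv (form_of n [tuple (h i).2 | i < k]) s) h.
Proof.
pose G (h : 'I_k -> vpair g) := phi (fun i => (h i).1).
have GP (h' : 'I_k -> vpair g) :
    multilinear (fun z => G h' * form_of n [tuple (h' i).2 | i < k] z).
  by move=> v i q x y; rewrite mfP mulrDr mulrCA.
rewrite (rv_isum (G := fun h => MForm (GP h)) _ (w := enum 'I_k) (h := h)).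
  apply: (congr1 (fun F => isum bp (enum 'I_k) F h)); apply/funext => h'.
  exact: rv_formZ.
move=> z; rewrite (mform_expand phi z h).
apply: (congr1 (fun F => isum (M := rat^o) bp (enum 'I_k) F h)); apply/funext => h' /=.
by congr (_ * _); apply: eq_bigr => i _; rewrite tnth_mktuple.
Qed.

End Contraction.

End CoendCalculus.

(** * The presented ring *)

Lemma malg_scaleAr (K : monomType) (q : rat) (x y : {malg rat[K]}) :
  x * (q *: y) = q *: (x * y).
Proof.
have Z c c' k : c *: << c' *g k >> = << c * c' *g k >> :> {malg rat[K]}.
  apply/malgP => k'; rewrite mcoeffZ !mcoeffU.
  by case: eqP => _; rewrite ?mulr1n ?mulr0n ?mulr0.
have UU (c c' : rat) (k k' : K) :
    << c *g k >> * << c' *g k' >> = << c * c' *g mmul k k' >> :> {malg rat[K]}.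
  by rewrite malgM_def fgmulUU.
elim/MonoidAlg.malg_ind: x => [|p k x IHx]; first by rewrite !mul0r scaler0.
rewrite !mulrDl IHx scalerDr; congr (_ + _) => {x IHx}.
elim/MonoidAlg.malg_ind: y => [|p' k' y IHy]; first by rewrite scaler0 mulr0 scaler0.
rewrite scalerDr !mulrDr IHy scalerDr; congr (_ + _).
by rewrite !Z !UU Z !mulr1 mulrCA.
Qed.

Section PresentedAlgebra.
Variables (n g : nat) (V : comAlgType rat) (gr : nat -> set V) (e : V).
Variables a ash : 'I_(g + g) -> H g.

Local Notation F := (freealg n g gr).
Local Notation P := (Pres n gr e a ash).
Local Notation pc := (@cls_Pres n g V gr e a ash).
Local Notation mon k := (<< k >> : F).

Lemma monM k k' : mon k * mon k' = mon (mmul k k').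
Proof. by rewrite [LHS]malgM_def fgmulUU mulr1. Qed.

Lemma monE (m : {fmonom gen n g gr}) : mon m = \prod_(y <- m) ugen y.
Proof.
case: m => s; elim: s => [|y s IH].
  rewrite big_nil -[RHS]/(mon mone); congr mkmalgU; apply/eqP.
  by rewrite fmP fm1.
rewrite big_cons -IH monM; congr mkmalgU; apply/eqP.
by rewrite fmP fmM fmU.
Qed.

Lemma free_scaleAr q (x y : F) : x * (q *: y) = q *: (x * y).
Proof. exact: malg_scaleAr. Qed.

Lemma pres_relE x y : pres_rel e a ash (x - y) -> pc x = pc y.
Proof. by move=> h; apply/Quot.pi_eq; exact: sub_gen_smallest. Qed.

(** The coefficient of the empty monomial is multiplicative and kills all generators, hence all
    relations, but not 1. This makes [Pres] a nonzero ring, over which the trees can be built as an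
    [algType]. *)
Lemma pres_nonzero : (1 : P) != 0.
Proof.
have [co [coP coM co1 coG]] : exists co : F -> rat,
    [/\ forall q x y, co (q *: x + y) = q * co x + co y,
        forall x y, co (x * y) = co x * co y, co 1 = 1 & forall y, co (ugen y) = 0].
  have [M1 M2] := mcoeff1g_is_multiplicative {fmonom gen n g gr} rat.
  exists (mcoeff mone); split=> [q x y|x y||y].
  - by rewrite mcoeffD mcoeffZ.
  - exact: M1.
  - exact: M2.
  - rewrite mcoeffU; case: eqP => // /(congr1 (fun m : {fmonom _} => size m)).
    by rewrite fmU fm1.
have coD x y : co (x + y) = co x + co y.
  by have := coP 1 x y; rewrite scale1r mul1r.
have co0 : co 0 = 0.
  by have := coP (-1) 0 0; rewrite scaler0 addr0 mulN1r addNr.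
have coZ q x : co (q *: x) = q * co x by rewrite -[_ *: _]addr0 coP co0 addr0.
have coB x y : co (x - y) = co x - co y by rewrite addrC -scaleN1r coP mulN1r addrC.
have coS (I : finType) (f : I -> F) : (forall i, co (f i) = 0) -> co (\sum_i f i) = 0.
  by move=> f0; elim/big_rec: _ => // i x _ cx; rewrite coD f0 cx addr0.
have coS2 (I : finType) (f f' : I -> F) : (forall i, co (f i) = 0) ->
    (forall i, co (f' i) = 0) -> co (\sum_i f i) - co (\sum_i f' i) = 0.
  by move=> f0 f0'; rewrite !coS ?subrr.
have coGG x y : co (ugen x * ugen y) = 0 by rewrite coM coG mul0r.
have z0 d c (h : gr d c) hd : co (k0 g h hd) = 0 by exact: coG.
have z1 d c (h : gr d c) hd v : co (k1 h hd v) = 0 by exact: coG.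
have z3 v1 v2 v3 : co (k3 n gr v1 v2 v3) = 0 by exact: coG.
pose K : set F := [set x | co x = 0].
apply/eqP => /Quot.pi_eq; rewrite subr0 => h.
suff : K 1 by rewrite /K /= co1; apply/eqP/oner_neq0.
have : ideal_gen (pres_rel e a ash) `<=` K.
  apply: smallest_sub.
    split; first by split; [exact: co0|move=> q x y Kx Ky; rewrite /K /= coP Kx Ky mulr0 addr0].
    move=> b x Kx; split; rewrite /K /=.
      by rewrite (coM b x) Kx mulr0.
    by rewrite (coM x b) Kx mul0r.
  move=> x; rewrite /K /=; case=> *; rewrite coB.
  - by rewrite coGG coZ coGG mulr0 subrr.
  - by rewrite z0 coP !z0 mulr0 addr0 ?subrr.
  - by rewrite z1 coP !z1 mulr0 addr0 ?subrr.
  - by rewrite z1 coP !z1 mulr0 addr0 ?subrr.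
  - by rewrite z3 coP !z3 mulr0 addr0 ?subrr.
  - by rewrite z3 coP !z3 mulr0 addr0 ?subrr.
  - by rewrite z3 coP !z3 mulr0 addr0 ?subrr.
  - by rewrite coG coZ coG mulr0 subrr.
  - by rewrite z0 coS ?subrr // => i; rewrite coM z1 mul0r.
  - rewrite z1 coS ?subrr // => i; apply: coS => j.
    by rewrite coM z1 mulr0.
  - by rewrite z1 coS ?subrr // => i; exact: z3.
  - by apply: coS2 => i; exact: coGG.
exact.
Qed.

HB.instance Definition _ := GRing.PzSemiRing_isNonZero.Build P pres_nonzero.
HB.instance Definition _ := GRing.Lmodule_isLalgebra.Build rat P
  (@quot_scaleAl _ (pres_ideal n gr e a ash)).
HB.instance Definition _ := GRing.Lalgebra_isAlgebra.Build rat P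
  (fun q x y => @quot_scaleAr _ (pres_ideal n gr e a ash) q x y free_scaleAr).

Lemma pcP q x y : pc (q *: x + y) = q *: pc x + pc y.
Proof. exact: quot_piP. Qed.

Lemma pcM x y : pc (x * y) = pc x * pc y.
Proof. exact: quot_piM. Qed.

Lemma pc_sum (I : Type) (r : seq I) (f : I -> F) :
  pc (\sum_(i <- r) f i) = \sum_(i <- r) pc (f i).
Proof.
elim: r => [|i r IH]; first by rewrite !big_nil.
by rewrite !big_cons -IH -[f i]scale1r pcP !scale1r.
Qed.

End PresentedAlgebra.

(** * The kappas of the presentation and their images in the coend *)

Section Comparison.
Variables (n g : nat) (V : comAlgType rat) (gr : nat -> set V) (e : V).
Hypothesis (n_gt0 : (0 < n)%N).
Hypothesis (hgr : even_grading gr) (he : gr (2 * n)%N e) (hV : unit_plus_gt gr n).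
Variables a ash : 'I_(g + g) -> H g.
Hypothesis (ab : basis_of fullv [tuple a i | i < g + g]).
Hypothesis (adual : forall i j, lam n (ash i) (a j) = (i == j)%:R).

Local Notation eps := ((-1) ^+ n : rat).
Local Notation F := (freealg n g gr).
Local Notation P := (Pres n gr e a ash).
Local Notation R := (RV n g gr e).
Local Notation pc := (@cls_Pres n g V gr e a ash).

(* Extended by [0] to the labels that are not allowed. *)
Definition pK0 d c : P :=
  match pselect (gr d c), pselect (2 * n < d)%N with
  | left h, left h' => pc (k0 g h h') | _, _ => 0 end.

Definition pK1 d c v : P :=
  match pselect (gr d c), pselect (n < d)%N with
  | left h, left h' => pc (k1 h h' v) | _, _ => 0 end.

Definition pK3 x y z : P := pc (k3 n gr x y z).

Lemma pK0E d c (h : gr d c) hd : pK0 d c = pc (k0 g h hd).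
Proof.
rewrite /pK0; case: pselect => [h1|]; last by case.
case: pselect => [h2|]; last by case.
by rewrite (Prop_irrelevance h1 h) (Prop_irrelevance h2 hd).
Qed.

Lemma pK1E d c (h : gr d c) hd v : pK1 d c v = pc (k1 h hd v).
Proof.
rewrite /pK1; case: pselect => [h1|]; last by case.
case: pselect => [h2|]; last by case.
by rewrite (Prop_irrelevance h1 h) (Prop_irrelevance h2 hd).
Qed.

Lemma pK0_out d c : ~~ (2 * n < d)%N -> pK0 d c = 0.
Proof.
move=> /negP h; rewrite /pK0; case: pselect => [h1|_] //.
by case: pselect => [h2|_] //; case: (h h2).
Qed.

Lemma pK1_out d c v : ~~ (n < d)%N -> pK1 d c v = 0.
Proof.
move=> /negP h; rewrite /pK1; case: pselect => [h1|_] //.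
by case: pselect => [h2|_] //; case: (h h2).
Qed.

Definition pgen (b : bool) (x : P) : Prop :=
  exists2 y : gen n g gr, b = odd (gdeg y) & x = pc (ugen y).

Lemma pgenC b b' x y : pgen b x -> pgen b' y -> x * y = (-1) ^+ (b && b') *: (y * x).
Proof.
move=> [u -> ->] [w -> ->]; rewrite -!pcM -oddM signr_odd -quot_piZ.
by apply: pres_relE; exact: rel_comm.
Qed.

Lemma pK0hom d c : gr d c -> ~~ odd d -> hom pgen false (pK0 d c).
Proof.
move=> h od; have [hd|hd] := boolP (2 * n < d)%N; last by rewrite pK0_out //; exact: hom0.
rewrite (pK0E h hd); apply: hom_gen; exists (Gen0 g h hd) => //.
by rewrite /= oddB ?(ltnW hd) // oddM (negbTE od).
Qed.

Lemma pK1hom d c v : gr d c -> (n < d)%N -> ~~ odd d -> hom pgen (odd n) (pK1 d c v).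
Proof.
move=> h hd od; rewrite (pK1E h hd); apply: hom_gen; exists (Gen1 h hd v) => //.
by rewrite /= oddB ?(ltnW hd) // (negbTE od).
Qed.

Lemma pK3hom x y z : hom pgen (odd n) (pK3 x y z).
Proof. by apply: hom_gen; exists (Gen3 n gr [tuple x; y; z]). Qed.

Lemma pK0lin d c c' q : gr d c -> gr d c' ->
  pK0 d (q *: c + c') = q *: pK0 d c + pK0 d c'.
Proof.
move=> h h'; have h'' := (gr_subspace hgr d).2 q _ _ h h'.
have [hd|hd] := boolP (2 * n < d)%N; last by rewrite !pK0_out // scaler0 addr0.
rewrite (pK0E h hd) (pK0E h' hd) (pK0E h'' hd) -pcP.
by apply: pres_relE; exact: rel_lin0.
Qed.

Lemma pK1lin d c c' q v : gr d c -> gr d c' ->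
  pK1 d (q *: c + c') v = q *: pK1 d c v + pK1 d c' v.
Proof.
move=> h h'; have h'' := (gr_subspace hgr d).2 q _ _ h h'.
have [hd|hd] := boolP (n < d)%N; last by rewrite !pK1_out // scaler0 addr0.
rewrite (pK1E h hd) (pK1E h' hd) (pK1E h'' hd) -pcP.
by apply: pres_relE; exact: rel_lin1.
Qed.

Lemma pK1linv d c q v w : pK1 d c (q *: v + w) = q *: pK1 d c v + pK1 d c w.
Proof.
rewrite /pK1; case: pselect => [h|_]; last by rewrite scaler0 addr0.
case: pselect => [hd|_]; last by rewrite scaler0 addr0.
by rewrite -pcP; apply: pres_relE; exact: rel_lin1v.
Qed.

Lemma pK3lin1 q v w y z : pK3 (q *: v + w) y z = q *: pK3 v y z + pK3 w y z.
Proof. by rewrite /pK3 -pcP; apply: pres_relE; exact: rel_lin31. Qed.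

Lemma pK3lin2 q v w x z : pK3 x (q *: v + w) z = q *: pK3 x v z + pK3 x w z.
Proof. by rewrite /pK3 -pcP; apply: pres_relE; exact: rel_lin32. Qed.

Lemma pK3lin3 q v w x y : pK3 x y (q *: v + w) = q *: pK3 x y v + pK3 x y w.
Proof. by rewrite /pK3 -pcP; apply: pres_relE; exact: rel_lin33. Qed.

Lemma pK3_tperm (v : 3.-tuple (H g)) i j : i != j ->
  pc (ugen (Gen3 n gr [tuple tnth v (tperm i j k) | k < 3])) =
  eps *: pc (ugen (Gen3 n gr v)).
Proof.
move=> ij; rewrite -quot_piZ; apply: pres_relE.
by have := rel_alpha n gr e a ash (tperm i j) v; rewrite odd_tperm ij.
Qed.

Lemma pK3C12 x y z : pK3 x y z = eps *: pK3 y x z.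
Proof.
pose i1 : 'I_3 := Ordinal (isT : (1 < 3)%N).
have <- := pK3_tperm [tuple y; x; z] (isT : ord0 != i1).
rewrite /pK3 /k3; congr (pc (ugen (Gen3 n gr _))); apply: eq_from_tnth => k.
rewrite tnth_mktuple; case: tpermP => [->|->|/eqP k0 /eqP k1] //.
by case: k k0 k1 => [[|[|[|m]]] hm].
Qed.

Lemma pK3C23 x y z : pK3 x y z = eps *: pK3 x z y.
Proof.
pose i1 : 'I_3 := Ordinal (isT : (1 < 3)%N).
pose i2 : 'I_3 := Ordinal (isT : (2 < 3)%N).
have <- := pK3_tperm [tuple x; z; y] (isT : i1 != i2).
rewrite /pK3 /k3; congr (pc (ugen (Gen3 n gr _))); apply: eq_from_tnth => k.
rewrite tnth_mktuple; case: tpermP => [->|->|/eqP k0 /eqP k1] //.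
by case: k k0 k1 => [[|[|[|m]]] hm].
Qed.

Lemma pKbeta d x d' y : gr d x -> (n < d)%N -> gr d' y -> (n < d')%N ->
  pK0 (d + d') (x * y) = \sum_i pK1 d x (a i) * pK1 d' y (ash i).
Proof.
move=> hx hd hy hd'; have hxy := gr_mul hgr hx hy.
have hdd : (2 * n < d + d')%N by lia.
rewrite (pK0E hxy hdd) (pres_relE (rel_beta e a ash hx hd hy hd' hxy hdd)) pc_sum.
by apply: eq_bigr => i _; rewrite pcM (pK1E hx hd) (pK1E hy hd').
Qed.

Lemma pKgamma d x d' y v : gr d x -> (n < d)%N -> gr d' y -> (n < d')%N ->
  pK1 (d + d') (x * y) v =
  \sum_i \sum_j pK3 v (a j) (a i) * pK1 d x (ash i) * pK1 d' y (ash j).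
Proof.
move=> hx hd hy hd'; have hxy := gr_mul hgr hx hy.
have hdd : (n < d + d')%N by rewrite ltn_addr.
rewrite (pK1E hxy hdd) (pres_relE (rel_gamma e a ash hx hd hy hd' hxy hdd v)) pc_sum.
apply: eq_bigr => i _; rewrite pc_sum; apply: eq_bigr => j _.
by rewrite !pcM (pK1E hx hd) (pK1E hy hd').
Qed.

Lemma pKdelta v : \sum_i pK3 v (a i) (ash i) = pK1 (2 * n) e v.
Proof.
have hd : (n < 2 * n)%N by lia.
by rewrite (pK1E he hd) -(pres_relE (rel_delta a ash he hd v)) pc_sum.
Qed.

Lemma pKeps v1 v2 v5 v6 :
  \sum_i pK3 v1 v2 (a i) * pK3 (ash i) v5 v6 =
  \sum_i pK3 v1 v5 (a i) * pK3 (ash i) v6 v2.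
Proof.
have L u1 u2 u5 u6 : \sum_i pK3 u1 u2 (a i) * pK3 (ash i) u5 u6 =
    pc (\sum_i k3 n gr u1 u2 (a i) * k3 n gr (ash i) u5 u6).
  by rewrite pc_sum; apply: eq_bigr => i _; rewrite pcM.
apply: etrans (L _ _ _ _) (etrans _ (esym (L _ _ _ _))).
exact: (pres_relE (rel_epsilon n gr e a ash v1 v2 v5 v6)).
Qed.

Definition gval (y : gen n g gr) : R :=
  match y with
  | Gen0 d c _ _ => kappa n gr e [tuple] d c
  | Gen1 d c _ _ v => kappa n gr e [tuple v] d c
  | Gen3 t => kappa n gr e t 0 1
  end.

Definition ev (x : F) : R :=
  MonoidAlg.lext (fun m : {fmonom gen n g gr} => \prod_(y <- m) gval y) x.

Lemma evP q x y : ev (q *: x + y) = q *: ev x + ev y.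
Proof. exact: MonoidAlg.lextP. Qed.

Lemma ev0 : ev 0 = 0.
Proof. by have := evP (-1) 0 0; rewrite scaler0 addr0 scaleN1r addNr. Qed.

Lemma evD x y : ev (x + y) = ev x + ev y.
Proof. by have := evP 1 x y; rewrite !scale1r. Qed.

Lemma evZ q x : ev (q *: x) = q *: ev x.
Proof. by have := evP q x 0; rewrite ev0 !addr0. Qed.

Lemma ev_sum (I : Type) (r : seq I) (f : I -> F) :
  ev (\sum_(i <- r) f i) = \sum_(i <- r) ev (f i).
Proof.
elim: r => [|i r IH]; first by rewrite !big_nil ev0.
by rewrite !big_cons evD IH.
Qed.

Lemma ev_mon (m : {fmonom gen n g gr}) : ev << m >> = \prod_(y <- m) gval y.
Proof. exact: MonoidAlg.lextU. Qed.

Lemma ev_gen y : ev (ugen y) = gval y.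
Proof. by rewrite ev_mon fmU big_seq1. Qed.

Lemma ev1 : ev 1 = 1.
Proof. by rewrite [LHS]ev_mon fm1 big_nil. Qed.

Lemma evM x y : ev (x * y) = ev x * ev y.
Proof.
pose Q x := forall y, ev (x * y) = ev x * ev y.
suff : Q x by apply.
elim/MonoidAlg.malg_ind: x => [|q k x IHx] z; first by rewrite mul0r ev0 mul0r.
rewrite (evP q << k >> x) (mulrDl (q *: ev << k >>)).
rewrite mulrDl evD; congr (_ + _); last exact: IHx.
rewrite -scalerAl evZ -RV_scaleAl; congr (_ *: _).
pose Q' z := ev ((<< k >> : F) * z) = ev << k >> * ev z.
suff : Q' z by apply.
elim/MonoidAlg.malg_ind: z => [|p k' z IHz]; first by rewrite /Q' mulr0 ev0 mulr0.
rewrite /Q' (evP p << k' >> z) (mulrDr (ev _)).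
rewrite mulrDr evD; congr (_ + _); last exact: IHz.
rewrite free_scaleAr evZ -RV_scaleAr; congr (_ *: _).
by rewrite (ev_mon k) (ev_mon k') monM ev_mon fmM big_cat.
Qed.

Local Notation kap := (@kap n g V gr e).

Lemma ev_k0 d c (h : gr d c) hd : ev (k0 g h hd) = kap d c [::].
Proof. by rewrite [LHS]ev_gen /= kappaE. Qed.

Lemma ev_k1 d c (h : gr d c) hd v : ev (k1 h hd v) = kap d c [:: v].
Proof. by rewrite [LHS]ev_gen /= kappaE. Qed.

Lemma ev_k3 v1 v2 v3 : ev (k3 n gr v1 v2 v3) = kap 0 1 [:: v1; v2; v3].
Proof. by rewrite [LHS]ev_gen /= kappaE. Qed.

Lemma adm03 : adm n gr 0 1 3.
Proof. by split=> //; exact: gr_one hgr. Qed.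

Lemma adm1 d c : gr d c -> (n < d)%N -> adm n gr d c 1.
Proof. by move=> h hd; split=> //; exact: ltnW. Qed.

Lemma kap_linear1 d c q v w : kap d c [:: q *: v + w] = q *: kap d c [:: v] + kap d c [:: w].
Proof.
have E u : kap d c [:: u] = kappa n gr e [tuple u] d c by rewrite kappaE.
rewrite !E; apply: rv_form => u.
by rewrite /= !big_ord_recl !big_ord0 !mulr1 !(tnth_nth 0) /= lamPl.
Qed.

Lemma kap_linear31 d c q v w x y :
  kap d c [:: q *: v + w; x; y] = q *: kap d c [:: v; x; y] + kap d c [:: w; x; y].
Proof.
have E u : kap d c [:: u; x; y] = kappa n gr e [tuple u; x; y] d c by rewrite kappaE.
rewrite !E; apply: rv_form => u.
rewrite /= !big_ord_recl !big_ord0 !(tnth_nth 0) /= lamPl.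
by rewrite mulrDl -!mulrA.
Qed.

(** A label of odd degree is 0; otherwise the parity of the generator is that of [n] times its
    number of legs. This reduces the commutation relation to [kap_comm]. *)
Lemma gval_kap y : exists d c w, gval y = kap d c w /\
  (c = 0 \/ odd (gdeg y) = odd n && odd (size w)).
Proof.
case: y => [d c h hd|d c h hd v|t] /=.
- exists d, c, [::]; rewrite kappaE; split=> //.
  have [od|od] := boolP (odd d); first by left; exact: gr_even od h.
  by right; rewrite oddB ?(ltnW hd) // oddM (negbTE od) andbF.
- exists d, c, [:: v]; rewrite kappaE; split=> //.
  have [od|od] := boolP (odd d); first by left; exact: gr_even od h.
  by right; rewrite oddB ?(ltnW hd) // (negbTE od) andbT.
- by exists 0%N, 1, t; rewrite kappaE size_tuple andbT; split=> //; right.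
Qed.

Lemma gval_comm x y : gval x * gval y = (-1) ^+ (gdeg x * gdeg y) *: (gval y * gval x).
Proof.
have [d [c [w [-> hx]]]] := gval_kap x; have [d' [c' [w' [-> hy]]]] := gval_kap y.
case: hx => [->|hx]; first by rewrite kap_zero // mul0r mulr0 scaler0.
case: hy => [->|hy]; first by rewrite kap_zero // mul0r mulr0 scaler0.
rewrite kap_comm; congr (_ *: _); rewrite -exprM -[LHS]signr_odd -[RHS]signr_odd.
by rewrite !oddM hx hy; case: (odd n); rewrite ?andbF.
Qed.

Let ksw d c l x y r : kap d c (l ++ x :: y :: r) = eps *: kap d c (l ++ y :: x :: r).
Proof. exact: kap_swap. Qed.

Lemma gval_tperm (v : 3.-tuple (H g)) (i j : 'I_3) : i != j ->
  gval (Gen3 n gr [tuple tnth v (tperm i j k) | k < 3]) = eps *: gval (Gen3 n gr v).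
Proof.
wlog ij : i j / (i < j)%N => [W ne|_].
  have := ne; rewrite neq_ltn => /orP[ij|ji]; first exact: W.
  by rewrite tpermC; apply: W => //; rewrite eq_sym.
pose i1 : 'I_3 := Ordinal (isT : (1 < 3)%N).
pose i2 : 'I_3 := Ordinal (isT : (2 < 3)%N).
have [x [y [z ->]]] : exists x y z, v = [tuple x; y; z].
  exists (tnth v ord0), (tnth v i1), (tnth v i2); apply: eq_from_tnth => k.
  by case: k => [[|[|[|m]]] hm] //; congr tnth; exact: val_inj.
have tE (r s t : H g) : r = tnth [tuple x; y; z] (tperm i j ord0) ->
    s = tnth [tuple x; y; z] (tperm i j i1) -> t = tnth [tuple x; y; z] (tperm i j i2) ->
    [tuple tnth [tuple x; y; z] (tperm i j k) | k < 3] = [tuple r; s; t].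
  move=> -> -> ->; apply: eq_from_tnth => k; rewrite tnth_mktuple.
  by case: k => [[|[|[|m]]] hm] //; congr (tnth _ (tperm i j _)); exact: val_inj.
rewrite /= !kappaE.
have [[i0 j1]|[i0 j2]|[ii1 j2]] : [\/ i = ord0 /\ j = i1, i = ord0 /\ j = i2 | i = i1 /\ j = i2].
  move: i j ij {tE} => [[|[|[|i]]] hi] [[|[|[|j]]] hj] //= _.
  - by apply: Or31; split; exact: val_inj.
  - by apply: Or32; split; exact: val_inj.
  - by apply: Or33; split; exact: val_inj.
- rewrite (tE y x z) ?i0 ?j1 ?tpermL ?tpermR ?tpermD //.
  exact: (ksw _ _ [::]).
- rewrite (tE z y x) ?i0 ?j2 ?tpermL ?tpermR ?tpermD //.
  (* The transposition of the outer legs is a product of three adjacent ones, and the cube of (-1)^n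
     is (-1)^n. *)
  rewrite [LHS](ksw _ _ [::]) [kap _ _ _](ksw _ _ [:: y] z x) [kap _ _ _](ksw _ _ [::] y x).
  by rewrite !scalerA eps_sq mul1r.
- rewrite (tE x z y) ?ii1 ?j2 ?tpermL ?tpermR ?tpermD //.
  exact: (ksw _ _ [:: x]).
Qed.

Lemma gval_perm (s : 'S_3) (v : 3.-tuple (H g)) :
  gval (Gen3 n gr [tuple tnth v (s i) | i < 3]) = ((-1) ^+ s) ^+ n *: gval (Gen3 n gr v).
Proof.
have [ts -> dts] := prod_tpermP s.
elim: ts dts v => [|[i j] ts IH] dts v.
  rewrite big_nil odd_perm1 expr0 expr1n scale1r; congr (gval (Gen3 n gr _)).
  by apply: eq_from_tnth => k; rewrite tnth_mktuple perm1.
have /andP[ij' dts'] := dts; have ij : i != j := ij'.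
rewrite big_cons odd_mul_tperm ij.
have := IH dts' v; set w := [tuple _ | _ < 3] => E.
have -> : [tuple tnth v ((tperm i j * \prod_(t <- ts) tperm t.1 t.2)%g k) | k < 3] =
    [tuple tnth w (tperm i j k) | k < 3].
  by apply: eq_from_tnth => k; rewrite !tnth_mktuple permM.
rewrite gval_tperm // E scalerA signr_addb expr1 exprMn.
by [].
Qed.

Lemma ev_eq (x y : F) : ev x = ev y -> ev (x - y) = 0.
Proof. by move=> E; rewrite addrC -scaleN1r evP E scaleN1r addNr. Qed.

Lemma ev_pres_rel r : pres_rel e a ash r -> ev r = 0.
Proof.
have glue := @kap_glue n g V gr e a ash ab adual.
case=> [x y|d c c' q h h' h'' hd|d c c' q h h' h'' hd v|d c h hd q v w
  |q v w v2 v3|q v w v1 v3|q v w v1 v2|s v|d x hx hd d' y hy hd' hxy hdd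
  |d x hx hd d' y hy hd' hxy hdd v|he' hn v|v1 v2 v5 v6]; apply: ev_eq.
- by rewrite (evM (ugen x) (ugen y)) evZ (evM (ugen y)) !ev_gen gval_comm.
- by rewrite evP !ev_k0 kap_label.
- by rewrite evP !ev_k1 kap_label.
- by rewrite evP !ev_k1 kap_linear1.
- by rewrite evP !ev_k3 kap_linear31.
- have sw u w' z : kap 0 1 [:: u; w'; z] = eps *: kap 0 1 [:: w'; u; z].
    exact: (ksw _ _ [::]).
  rewrite evP !ev_k3 !(sw v1) kap_linear31.
  by rewrite scalerDr !scalerA mulrC.
- have sw u : kap 0 1 [:: v1; v2; u] = (eps * eps) *: kap 0 1 [:: u; v1; v2].
    rewrite -scalerA; apply: etrans (ksw _ _ [:: v1] _ _ [::]) _; congr (_ *: _).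
    exact: (ksw _ _ [::]).
  rewrite evP !ev_k3 !sw kap_linear31 eps_sq.
  by rewrite !scale1r.
- by rewrite evZ !ev_gen gval_perm.
- rewrite ev_k0 ev_sum.
  rewrite -(glue _ _ _ _ [::] [::] (adm1 hx hd) (adm1 hy hd')).
  by apply: eq_bigr => i _; rewrite evM ev_k1 ev_k1.
- rewrite ev_k1 ev_sum.
  have adm2 : adm n gr d x 2 by split=> //; exact: leq_trans hd.
  rewrite -(glue _ _ _ _ [:: v] [::] adm2 (adm1 hy hd')).
  (* For (gamma): the sum over [i] glues [kappa_1] to a single leg and rebuilds [kap d x
     [:: v; a j]], which the sum over [j] glues to the class of [y]. *)
  transitivity (\sum_j \sum_i kap 0 1 [:: v; a j; a i] * kap d x [:: ash i] * kap d' y [:: ash j]).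
    apply: eq_bigr => j _; rewrite -mulr_suml; congr (_ * _).
    have := glue _ _ _ _ [:: v; a j] [::] adm03 (adm1 hx hd).
    by rewrite add0n mul1r => ->.
  rewrite exchange_big; apply: eq_bigr => i _; rewrite ev_sum; apply: eq_bigr => j _.
  by rewrite [RHS]evM [ev (_ * _)]evM ev_k3 ev_k1 ev_k1.
- rewrite ev_sum ev_k1.
  have := @kap_loop n g V gr e a ash ab adual 0 1 [:: v] adm03; rewrite addn0 mulr1 => <-.
  apply: eq_bigr => i _; rewrite ev_k3 (ksw _ _ [::] v) (ksw _ _ [:: a i] v _ [::]).
  by rewrite scalerA eps_sq scale1r.
(* For (epsilon): both sides glue to [kappa_1] with four legs, and their last three legs differ by a
   cyclic permutation, which is two swaps. *)
- have E u1 u2 u5 u6 : ev (\sum_i k3 n gr u1 u2 (a i) * k3 n gr (ash i) u5 u6) =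
      kap 0 1 [:: u1; u2; u5; u6].
    have := glue _ _ _ _ [:: u1; u2] [:: u5; u6] adm03 adm03.
    rewrite add0n mul1r => <-; rewrite ev_sum; apply: eq_bigr => i _.
    by rewrite evM !ev_k3.
  apply: etrans (E v1 v2 v5 v6) (etrans _ (esym (E v1 v5 v6 v2))).
  rewrite (ksw _ _ [:: v1] v2) (ksw _ _ [:: v1; v5] v2 _ [::]).
  by rewrite scalerA eps_sq scale1r.
Qed.

End Comparison.

(** * The isomorphism *)

Lemma span_bilinear (M1 M2 M : lmodType rat) (f : M1 -> M2 -> M) X Y (W : set M) :
  (forall q x x' y, f (q *: x + x') y = q *: f x y + f x' y) ->
  (forall q x y y', f x (q *: y + y') = q *: f x y + f x y') ->
  (forall x y, X x -> Y y -> Defs.span W (f x y)) ->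
  forall x y, Defs.span X x -> Defs.span Y y -> Defs.span W (f x y).
Proof.
move=> fl fr fXY x y Xx Yy; have [W0 WP] := span_subspace W.
have fx0 x' : f x' 0 = 0 by have := fr (-1) x' 0 0; rewrite !scaleN1r !addNr.
have f0y y' : f 0 y' = 0 by have := fl (-1) 0 0 y'; rewrite !scaleN1r !addNr.
have : Defs.span X `<=` [set x | forall y, Defs.span Y y -> Defs.span W (f x y)].
  apply: smallest_sub => [|{Xx}x Xx y' Yy'].
    split=> [y' _|q u v hu hv y' Yy']; first by rewrite f0y.
    by rewrite fl; apply: WP; [exact: hu|exact: hv].
  have : Defs.span Y `<=` [set y | Defs.span W (f x y)].
    apply: smallest_sub => [|y'' Yy'']; last exact: fXY.
    by split=> [|q u v hu hv] /=; rewrite ?fx0 // fr; apply: WP.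
  exact.
by move=> h; exact: h.
Qed.

Section Isomorphism.
Variables (n g : nat) (V : comAlgType rat) (gr : nat -> set V) (e : V).
Hypothesis (n_gt0 : (0 < n)%N).
Hypothesis (hgr : even_grading gr) (he : gr (2 * n)%N e) (hV : unit_plus_gt gr n).
Variables a ash : 'I_(g + g) -> H g.
Hypothesis (ab : basis_of fullv [tuple a i | i < g + g]).
Hypothesis (adual : forall i j, lam n (ash i) (a j) = (i == j)%:R).

Local Notation eps := ((-1) ^+ n : rat).
Local Notation F := (freealg n g gr).
Local Notation P := (Pres n gr e a ash).
Local Notation R := (RV n g gr e).
Local Notation pc := (@cls_Pres n g V gr e a ash).
Local Notation ev := (@ev n g V gr e).
Local Notation kap := (@kap n g V gr e).
Local Notation gval := (@gval n g V gr e).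
Local Notation pK0 := (@pK0 n g V gr e a ash).
Local Notation pK1 := (@pK1 n g V gr e a ash).
Local Notation pK3 := (@pK3 n g V gr e a ash).

Lemma ev_ideal (x : F) : ts_set (pres_ideal n gr e a ash) x -> ev x = 0.
Proof.
have : ideal_gen (pres_rel e a ash) `<=` [set x | ev x = 0].
  apply: smallest_sub => [|y yr]; last exact: (ev_pres_rel hgr ab adual yr).
  split; first by split=> [|q u v u0 v0] /=; rewrite ?ev0 // evP u0 v0 scaler0 addr0.
  by move=> b u u0; split; rewrite /= evM u0 ?mulr0 ?mul0r.
exact.
Qed.

Definition Phi (x : P) : R := ev (repr x).

Lemma Phi_pc y : Phi (pc y) = ev y.
Proof.
have := ev_ideal (@Quot.repr_pi _ (pres_ideal n gr e a ash) y).
rewrite addrC -scaleN1r evP scaleN1r => /eqP; rewrite addrC subr_eq0 => /eqP E.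
exact: E.
Qed.

Lemma pc_surj x : exists y, x = pc y.
Proof. exact: Quot.pi_surj. Qed.

Lemma PhiP q x y : Phi (q *: x + y) = q *: Phi x + Phi y.
Proof.
have [u ->] := pc_surj x; have [v ->] := pc_surj y.
by rewrite -pcP !Phi_pc evP.
Qed.

Lemma PhiM x y : Phi (x * y) = Phi x * Phi y.
Proof.
have [u ->] := pc_surj x; have [v ->] := pc_surj y.
by rewrite -pcM !Phi_pc evM.
Qed.

Lemma Phi1 : Phi 1 = 1.
Proof. by rewrite -ev1 -Phi_pc. Qed.

Lemma Phi_gen y : Phi (pc (ugen y)) = gval y.
Proof. by rewrite Phi_pc ev_gen. Qed.

Definition T : nat -> V -> seq (H g) -> P := ptree a ash pK0 pK1 pK3 hV.

Lemma T_linear d c u r q v w :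
  T d c (u ++ (q *: v + w) :: r) = q *: T d c (u ++ v :: r) + T d c (u ++ w :: r).
Proof.
by apply: ptree_linear => *; [exact: pK1linv|exact: pK3lin1|exact: pK3lin2].
Qed.

Lemma T_label d c c' q w : gr d c -> gr d c' ->
  T d (q *: c + c') w = q *: T d c w + T d c' w.
Proof.
by move=> h h'; apply: ptree_label => // *; [exact: pK0lin|exact: pK1lin].
Qed.

Lemma T_zero d w : T d 0 w = 0.
Proof. by apply: ptree0 => // *; [exact: pK0lin|exact: pK1lin]. Qed.

Lemma T_swap d c u x y r :
  T d c (u ++ x :: y :: r) = eps *: T d c (u ++ y :: x :: r).
Proof.
apply: (ptree_swap ab adual) => *; [exact: pK3lin3|exact: pK3C12|exact: pK3C23|exact: pKeps].
Qed.

Lemma T_comm d c d' c' w w' : gr d c -> gr d' c' ->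
  T d c w * T d' c' w' = eps ^+ (size w * size w') *: (T d' c' w' * T d c w).
Proof.
move=> h h'; apply: (ptree_comm hgr a ash (@pgenC n g V gr e a ash)) => // *.
- exact: pK0hom.
- exact: pK1hom.
- exact: pK3hom.
- exact: pK0lin.
- exact: pK1lin.
Qed.

Lemma T_glue d c d' c' w1 w2 :
  (c <> 0 -> (n < d)%N || (w1 != [::])) ->
  (c' <> 0 -> (n < d')%N || (w2 != [::])) ->
  gr d c -> gr d' c' ->
  \sum_i T d c (rcons w1 (a i)) * T d' c' (ash i :: w2) =
  T (d + d') (c * c') (w1 ++ w2).
Proof.
move=> dp dp' h h'; apply: (@ptree_glue n g V gr hgr a ash ab adual P pK0 pK1 pK3 (@pgen n g V gr e a ash)).
- by move=> *; exact: pgenC.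
- by move=> *; exact: pK0hom.
- by move=> *; exact: pK1hom.
- by move=> *; exact: pK3hom.
- by move=> *; exact: pK0lin.
- by move=> *; exact: pK1lin.
- by move=> *; exact: pK1linv.
- by move=> *; exact: pK3lin1.
- by move=> *; exact: pK3lin2.
- by move=> *; exact: pK3lin3.
- by move=> *; exact: pK3C12.
- by move=> *; exact: pK3C23.
- by move=> *; exact: pKbeta.
- by move=> *; exact: pKgamma.
- by move=> *; exact: pKeps.
- exact: h.
- exact: h'.
- exact: dp.
- exact: dp'.
Qed.

Lemma T_loop d c w :
  (c <> 0 -> (n < d)%N || (w != [::])) -> gr d c ->
  \sum_i T d c (a i :: ash i :: w) = T (2 * n + d) (e * c) w.
Proof.
move=> dp h; apply: (@ptree_loop n g V gr e n_gt0 hgr he a ash ab adual P pK0 pK1 pK3 (@pgen n g V gr e a ash)).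
- by move=> *; exact: pgenC.
- by move=> *; exact: pK0hom.
- by move=> *; exact: pK1hom.
- by move=> *; exact: pK3hom.
- by move=> *; exact: pK0lin.
- by move=> *; exact: pK1lin.
- by move=> *; exact: pK1linv.
- by move=> *; exact: pK3lin1.
- by move=> *; exact: pK3lin2.
- by move=> *; exact: pK3lin3.
- by move=> *; exact: pK3C12.
- by move=> *; exact: pK3C23.
- by move=> *; exact: pKbeta.
- by move=> *; exact: pKgamma.
- by move=> *; exact: pKdelta.
- by move=> *; exact: pKeps.
- exact: h.
- exact: dp.
Qed.

Local Notation psi phi s := (@psi n g V a ash P T _ phi s).
Local Notation S := (symalg n g gr).
Local Notation cls := (@cls_RV n g V gr e).

Definition psiL (x : S) : P := MonoidAlg.lext (fun z : sym n g gr => psi (sf z) (sl z)) x.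

Lemma psiLP q x y : psiL (q *: x + y) = q *: psiL x + psiL y.
Proof. exact: MonoidAlg.lextP. Qed.

Lemma psiL0 : psiL 0 = 0.
Proof. by have := psiLP (-1) 0 0; rewrite scaler0 addr0 scaleN1r addNr. Qed.

Lemma psiLD x y : psiL (x + y) = psiL x + psiL y.
Proof. by have := psiLP 1 x y; rewrite !scale1r. Qed.

Lemma psiLZ q x : psiL (q *: x) = q *: psiL x.
Proof. by have := psiLP q x 0; rewrite psiL0 !addr0. Qed.

Lemma psiLB x y : psiL (x - y) = psiL x - psiL y.
Proof. by have := psiLP (-1) y x; rewrite !scaleN1r addrC (addrC (psiL x)). Qed.

Lemma psiLU k (phi : mform g k) (s : lpart n gr k) :
  psiL (usym (Defs.Sym phi s)) = psi phi s.
Proof. exact: MonoidAlg.lextU. Qed.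

Lemma psiL_rel r : coend_rel e r -> psiL r = 0.
Proof.
case=> [k phi phi1 phi2 q s E|k phi s s1 s2 l r' A d c1 c2 q sE s1E s2E|k phi s t st
  |k l u phi s]; rewrite psiLB.
- by rewrite psiLP !psiLU (psi_form _ _ _ _ _ E) subrr.
- have gc (t : lpart n gr k) c : t = l ++ (A, d, c) :: r' :> seq _ -> gr d c.
    move=> tE; have [_ h] := lpP t; have [] // := h (A, d, c).
    by rewrite tE mem_cat mem_head orbT.
  rewrite psiLP !psiLU sE s1E s2E.
  by rewrite (psi_label n a ash T_label) ?subrr //; [exact: gc s1E|exact: gc s2E].
- by rewrite !psiLU (psi_perm a ash T_comm phi (lpP s) st) subrr.
- have [psE tP] := psi_coend n_gt0 hgr he hV ab adual T_linear T_zero T_swap T_comm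
    T_glue T_loop u phi (lpP s).
  rewrite psiLZ psiLU psE /usym0; case: pselect => [tL|ntL].
    by rewrite psiLU subrr.
  by case: tP => [//|->]; rewrite psiL0 scaler0 subrr.
Qed.

Lemma psiL_ideal x : ts_set (coend_ideal n g gr e) x -> psiL x = 0.
Proof.
have : Defs.span (@coend_rel n g V gr e) `<=` [set x | psiL x = 0].
  apply: smallest_sub => [|y yr]; last exact: psiL_rel yr.
  split; first exact: psiL0.
  move=> q u v u0 v0; apply: (etrans (psiLP q u v)).
  by rewrite [psiL u]u0 [psiL v]v0 scaler0 addr0.
exact.
Qed.

Definition Psi (x : R) : P := psiL (repr x).

Lemma Psi_cls y : Psi (cls y) = psiL y.
Proof.
have := psiL_ideal (@Quot.repr_pi _ (coend_ideal n g gr e) y).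
by rewrite psiLB => /eqP; rewrite subr_eq0 => /eqP E; exact: E.
Qed.

Lemma cls_surj x : exists y, x = cls y.
Proof. exact: Quot.pi_surj. Qed.

Lemma PsiP q x y : Psi (q *: x + y) = q *: Psi x + Psi y.
Proof.
have [u ->] := cls_surj x; have [v ->] := cls_surj y.
by rewrite -clsP !Psi_cls psiLP.
Qed.

Lemma Psi0 : Psi 0 = 0.
Proof. by have := PsiP (-1) 0 0; rewrite scaler0 addr0 scaleN1r addNr. Qed.

Lemma psiLM x y : psiL (x * y) = psiL x * psiL y.
Proof.
pose Q x := forall y, psiL (x * y) = psiL x * psiL y.
suff : Q x by apply.
elim/MonoidAlg.malg_ind: x {y} => [|q z x IHx] y; first by rewrite mul0r psiL0 mul0r.
rewrite (psiLP q << z >> x) (mulrDl (q *: psiL << z >>)).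
rewrite mulrDl psiLD; congr (_ + _); last exact: IHx.
rewrite -scalerAl psiLZ -scalerAl; congr (_ *: _).
pose Q' y := psiL ((<< z >> : S) * y) = psiL << z >> * psiL y.
suff : Q' y by apply.
elim/MonoidAlg.malg_ind: y => [|p z' y IHy]; first by rewrite /Q' mulr0 psiL0 mulr0.
rewrite /Q' (psiLP p << z' >> y) (mulrDr (psiL _)).
rewrite mulrDr psiLD; congr (_ + _); last exact: IHy.
rewrite sym_mulZr psiLZ -scalerAr; congr (_ *: _).
case: z {Q Q' IHx IHy} => k phi s; case: z' => l chi t.
rewrite -[<< Defs.Sym phi s >>]/(usym _) -[<< Defs.Sym chi t >>]/(usym _) usymM.
rewrite -[mulsym _ _]/(Defs.Sym (tensor phi chi) (lunion s t)) !psiLU.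
exact: (psi_cat a ash T_swap phi chi (lpP s) (lpP t)).
Qed.

Lemma PsiM x y : Psi (x * y) = Psi x * Psi y.
Proof.
have [u ->] := cls_surj x; have [v ->] := cls_surj y.
by rewrite -clsM !Psi_cls psiLM.
Qed.

Lemma Psi1 : Psi 1 = 1.
Proof.
rewrite -[1]/(cls (usym (Defs.Sym (form1 g) (lpart0 n gr)))) Psi_cls psiLU.
exact: psi_unit.
Qed.

Lemma Psi_kap d c w : adm n gr d c (size w) -> Psi (kap d c w) = T d c w.
Proof.
move=> h; have := rvE e (form_of n (in_tuple w)) (LPart (single_lpart h)).
rewrite -kapE => ->; rewrite Psi_cls psiLU.
exact: (psi_full ab adual T_linear).
Qed.

Lemma T_nil d c : (2 * n < d)%N -> T d c [::] = pK0 d c.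
Proof. by move=> h; rewrite /T ptree_pos //; lia. Qed.

Lemma T_one d c v : (n < d)%N -> T d c [:: v] = pK1 d c v.
Proof. by move=> h; rewrite /T ptree_pos. Qed.

Lemma T_three q x y z : T 0 q%:A [:: x; y; z] = q *: pK3 x y z.
Proof.
rewrite /T ptree_unit (tree3 ab adual); last by move=> *; exact: pK3lin3.
by rewrite aug_scalar.
Qed.

Lemma Psi_gval y : Psi (gval y) = pc (ugen y).
Proof.
case: y => [d c h hd|d c h hd v|t]; rewrite [gval _]kappaE Psi_kap.
- by rewrite [LHS]T_nil // (pK0E _ _ _ h hd).
- by split.
- by rewrite [LHS]T_one // (pK1E _ _ _ h hd).
- exact: adm1.
- case: t => [[|x [|y [|z [|]]]] // tP]; rewrite /= -[1]scale1r T_three scale1r.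
  congr (pc (ugen (Gen3 n gr _))); exact: val_inj.
- by rewrite size_tuple; exact: adm03.
Qed.

Lemma PsiK x : Psi (Phi x) = x.
Proof.
have [y ->] := pc_surj x; rewrite Phi_pc.
elim/MonoidAlg.malg_ind: y => [|q m y IH].
  apply: (etrans (congr1 Psi (@ev0 n g V gr e))).
  exact: Psi0.
pose z : F := << m >>.
have E : Psi (ev z) = pc z.
  rewrite /z ev_mon monE.
  elim: (fmonom_val m) => [|t r IHr]; first by rewrite !big_nil Psi1.
  by rewrite !big_cons PsiM IHr Psi_gval -pcM.
rewrite (evP e q z y).
rewrite (PsiP q (ev z) (ev y)).
rewrite IH E.
exact: (esym (@pcP n g V gr e a ash q z y)).
Qed.

Lemma Phi0 : Phi 0 = 0.
Proof. by have := PhiP (-1) 0 0; rewrite !scaleN1r !addNr. Qed.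

Lemma Phi_sum (I : Type) (r : seq I) (f : I -> P) :
  Phi (\sum_(i <- r) f i) = \sum_(i <- r) Phi (f i).
Proof.
elim: r => [|i r IH].
  by rewrite !big_nil Phi0.
by rewrite !big_cons -IH -[f i]scale1r PhiP !scale1r.
Qed.

Lemma PhiZ q x : Phi (q *: x) = q *: Phi x.
Proof.
by have := PhiP q x 0; rewrite Phi0 !addr0.
Qed.

Lemma Phi_K3 x y z : Phi (pK3 x y z) = kap 0 1 [:: x; y; z].
Proof. by rewrite [LHS]Phi_gen [LHS]kappaE. Qed.

Lemma T_step d c x y w : (n < d)%N || (w != [::]) ->
  T d c (x :: y :: w) = \sum_i pK3 x y (a i) * T d c (ash i :: w).
Proof.
rewrite /T /ptree; case: (n < d)%N => dp.
  exact: (@treeE n g V a ash P pK0 pK1 pK3 (Some (d, c)) x y w isT).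
rewrite (@treeE n g V a ash P pK0 pK1 pK3 None x y w dp) scaler_sumr.
by apply: eq_bigr => i _; rewrite scalerAr.
Qed.

(** The kappas obey the recursion of the trees: [kap_glue] splits off a [kappa_1] that carries the
    first two legs. Admissibility of the shorter class has to be carried along. *)
Lemma Phi_T d c w : adm n gr d c (size w) -> Phi (T d c w) = kap d c w.
Proof.
have step x y w' : (n < d)%N || (w' != [::]) -> adm n gr d c (size w').+1 ->
    (forall i, Phi (T d c (ash i :: w')) = kap d c (ash i :: w')) ->
    Phi (T d c (x :: y :: w')) = kap d c (x :: y :: w').
  move=> dp h IH; have := kap_glue e ab adual (w1 := [:: x; y]) (adm03 n hgr) h.
  rewrite add0n mul1r => <-; rewrite T_step // Phi_sum; apply: eq_bigr => i _.
  by rewrite PhiM Phi_K3 IH.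
move=> h; have [hc _] := h; case: (labelP hgr hV hc) step h.
- move=> -> _ _; rewrite T_zero kap_zero //.
  exact: Phi0.
(* For a label of degree 0 admissibility excludes fewer than three legs, so the recursion ends at a
   multiple of [kappa_1] with three legs, before the auxiliary value [lam]. *)
- move=> -> cE step; case: w => [|x [|y [|z w]]]; try by case=> _ /= h; exfalso; lia.
  elim: w x y z => [|t w IH] x y z [hc0 _]; last first.
    by apply: step => [||i]; [rewrite orbT|split|apply: IH; split].
  rewrite cE T_three PhiZ Phi_K3 -[_%:A]addr0 kap_label ?kap_zero ?addr0 //.
    exact: gr_one hgr.
  exact: (gr_subspace hgr 0).1.
move=> nd ok step; case: w => [|x w] h.
  rewrite T_nil; last exact: h.2.
  by rewrite (pK0E _ _ _ hc h.2) Phi_gen [LHS]kappaE.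
elim: w x {h} => [|y w IH] x.
  by rewrite T_one // (pK1E _ _ _ hc nd) Phi_gen [LHS]kappaE.
apply: step => [||i]; [by rewrite nd| |exact: IH].
by split=> //; case: (w) => [|? []] //=; [exact: ltnW|exact: leq_trans nd].
Qed.

Lemma Phi_isum k (w : seq 'I_k) (f : ('I_k -> vpair g) -> P) h :
  Phi (isum (bpair a ash) w f h) = isum (bpair a ash) w (fun h => Phi (f h)) h.
Proof.
elim: w f => //= x w IH f; rewrite IH.
apply: (congr1 (fun f => isum (bpair a ash) w f h)); apply/funext => h'.
exact: Phi_sum.
Qed.

(** [rv_expand] writes the class by the same iterated sum that defines [psi]; [rv_split] and [Phi_T]
    then compare the terms part by part. *)
Lemma Phi_psi k (phi : mform g k) (s : lpart n gr k) :
  Phi (psi phi s) = cls (usym (Defs.Sym phi s)).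
Proof.
have [s1 s2] := lpP s.
rewrite -rvE (rv_expand gr e ab adual phi s (fun=> 0)) Phi_isum.
apply: (congr1 (fun f => isum (bpair a ash) (enum 'I_k) f (fun=> 0))); apply/funext => h.
rewrite PhiZ; congr (_ *: _).
have sE : s = [seq ([set j | j \in p.1.1]%SET, p.1.2, p.2) | p <- ordered s] :> seq _.
  rewrite /ordered -map_comp -[LHS]map_id; apply: eq_map => -[[A d] c] /=.
  by congr (_, _, _); apply/setP => i; rewrite inE mem_enum.
have WE : perm_eq (word (ordered s)) (enum 'I_k).
  by apply/allP => i _; apply/eqP; rewrite count_word count_enum; exact: s1.
rewrite (rv_split e _ (lpP s) sE WE) PhiZ; congr (_ *: _).
rewrite /value /ordered !big_map.
(* The induction runs over a list of parts, while their admissibility is still read off from [s]. *)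
have : {subset lp s <= lp s} by [].
elim: {-2}(lp s) => [|p r IH] rs; first by rewrite !big_nil Phi1.
rewrite !big_cons PhiM IH => [|q qr]; last by apply: rs; rewrite inE qr orbT.
congr (_ * _); rewrite Phi_T /=.
  by congr (kap _ _ _); apply: eq_map => i; rewrite tnth_mktuple.
have [hp ap] := s2 p (rs p (mem_head _ _)).
by rewrite size_map -cardE; split.
Qed.

Lemma PhiK x : Phi (Psi x) = x.
Proof.
have [y ->] := cls_surj x; rewrite Psi_cls.
elim/MonoidAlg.malg_ind: y => [|q z y IH].
  by apply: (etrans (congr1 Phi psiL0)); exact: Phi0.
case: z => k phi s; pose u : S := usym (Defs.Sym phi s).
have E : Phi (psiL u) = cls u by rewrite psiLU Phi_psi.
apply: (etrans (congr1 Phi (psiLP q u y))).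
apply: (etrans (PhiP q (psiL u) (psiL y))).
apply: (etrans (congr2 (fun x1 x2 => q *: x1 + x2) E IH)).
exact: (esym (clsP e q u y)).
Qed.

(** * Compatibility with the gradings *)

Local Notation PD := (@Pres_deg n g V gr e a ash).
Local Notation RD := (@RV_deg n g V gr e).

Lemma PD_gen y : PD (gdeg y) (pc (ugen y)).
Proof. by apply: sub_gen_smallest; exists [:: y]; rewrite big_seq1. Qed.

Lemma PD1 : PD 0 1.
Proof. by apply: sub_gen_smallest; exists [::]; rewrite big_nil. Qed.

Lemma PDM m m' x y : PD m x -> PD m' y -> PD (m + m') (x * y).
Proof.
apply: span_bilinear => [q u u' v|q u v v'|_ _ [w wm ->] [w' wm' ->]].
- by rewrite mulrDl scalerAl.
- by rewrite mulrDr scalerAr.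
- apply: sub_gen_smallest; exists (w ++ w'); first by rewrite big_cat wm wm'.
  by rewrite -pcM big_cat.
Qed.

Lemma T_deg d c w : gr d c -> PD (d + n * size w - 2 * n)%N (T d c w).
Proof.
have sub m : subspace (PD m) by exact: span_subspace.
apply: (@ptree_deg n g V gr n_gt0 hgr a ash ab P pK0 pK1 pK3 _ _ hV PD).
- by move=> *; exact: pK0lin.
- by move=> *; exact: pK1lin.
- by move=> m; exact: (sub m).1.
- exact: PD1.
- by move=> m; exact: (sub m).2.
- exact: PDM.
(* For [d'] at most [2 * n] the subtraction gives 0 by truncation, but there [pK0] is 0, which lies
   in every degree. *)
- move=> d' c' h; have [hd|hd] := boolP (2 * n < d')%N.
    by rewrite (pK0E _ _ _ h hd); exact: (@PD_gen (Gen0 g h hd)).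
  by rewrite pK0_out //; exact: (sub _).1.
- by move=> d' c' v h hd; rewrite (pK1E _ _ _ h hd); exact: (@PD_gen (Gen1 h hd v)).
- by move=> x y z; exact: (@PD_gen (Gen3 n gr [tuple x; y; z])).
Qed.

Lemma Psi_deg m x : RD m x -> PD m (Psi x).
Proof.
have sub k : subspace (PD k) by exact: span_subspace.
have : RD m `<=` [set x | PD m (Psi x)].
  apply: smallest_sub => [|_ [[k phi s] <- ->]].
    split; first by apply: (eq_ind_r (PD m) _ Psi0); exact: (sub m).1.
    by move=> q u v hu hv; apply: (eq_ind_r (PD m) _ (PsiP q u v)); exact: ((sub m).2 q _ _ hu hv).
  rewrite /= Psi_cls psiLU; apply: (@psi_deg n g V gr a ash P T PD).
  - by move=> k'; exact: (sub k').1.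
  - exact: PD1.
  - by move=> k'; exact: (sub k').2.
  - exact: PDM.
  - exact: T_deg.
exact.
Qed.

Lemma RD_rv k (phi : mform g k) (s : lpart n gr k) : RD (lpdeg s) (@rv n g V gr e k phi s).
Proof. by rewrite rvE; apply: sub_gen_smallest; exists (Defs.Sym phi s). Qed.

Lemma RDM m m' x y : RD m x -> RD m' y -> RD (m + m') (x * y).
Proof.
apply: span_bilinear => [q u u' v|q u v v'|_ _ [[k phi s] <- ->] [[l chi t] <- ->]].
- by rewrite mulrDl RV_scaleAl.
- by rewrite mulrDr RV_scaleAr.
- have -> : (lpdeg s + lpdeg t)%N = lpdeg (lunion s t).
    rewrite /lpdeg /= /lcat big_cat !big_map; congr (_ + _)%N; apply: eq_bigr => p _;
      by rewrite /psupp /= card_imset //; first [exact: lshift_inj|exact: rshift_inj].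
  rewrite -clsM usymM; apply: sub_gen_smallest.
  by exists (mulsym (Defs.Sym phi s) (Defs.Sym chi t)).
Qed.

Lemma RD_kap d c w : adm n gr d c (size w) -> RD (d + n * size w - 2 * n) (kap d c w).
Proof.
move=> h; have := @RD_rv _ (form_of n (in_tuple w)) (LPart (single_lpart h)).
by rewrite -kapE /lpdeg /= big_seq1 /psupp /= cardsT card_ord.
Qed.

Lemma RD_gval y : RD (gdeg y) (gval y).
Proof.
case: y => [d c h hd|d c h hd v|t]; rewrite [gval _]kappaE /=.
- have := @RD_kap d c [::] (conj h hd).
  by rewrite muln0 addn0.
- have := @RD_kap d c [:: v] (adm1 h hd).
  by have -> : (d + n * 1 - 2 * n = d - n)%N by lia.
- have := @RD_kap 0 1 t; rewrite size_tuple => /(_ (adm03 n hgr)).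
  by have -> : (0 + n * 3 - 2 * n = n)%N by lia.
Qed.

Lemma Phi_deg m x : PD m x -> RD m (Phi x).
Proof.
have sub : subspace (RD m) by exact: span_subspace.
have : PD m `<=` [set x | RD m (Phi x)].
  apply: smallest_sub => [|_ [w <- ->]].
    split; first by apply: (eq_ind_r (RD m) _ Phi0); exact: sub.1.
    by move=> q u v hu hv; apply: (eq_ind_r (RD m) _ (PhiP q u v)); exact: (sub.2 q _ _ hu hv).
  rewrite /= Phi_pc; elim: w => [|y w IH].
    rewrite !big_nil ev1; apply: sub_gen_smallest; exists (onesym n g gr) => //.
    by rewrite /lpdeg big_nil.
  rewrite !big_cons evM ev_gen; apply: RDM => //; exact: (@RD_gval y).
exact.
Qed.

(** The inverse respects degrees too, so surjectivity holds within each degree. *)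
Lemma Phi_bij m : set_bij (PD m) (RD m) Phi.
Proof.
split=> [x|x y _ _ E|y my]; first exact: Phi_deg.
- by rewrite -(PsiK x) E PsiK.
- by exists (Psi y); [exact: Psi_deg|exact: PhiK].
Qed.

Lemma Phi_additive : {morph Phi : x y / x - y}.
Proof. by move=> x y; rewrite addrC -scaleN1r PhiP scaleN1r addrC. Qed.

Lemma Phi_multiplicative : GRing.monoid_morphism Phi.
Proof. by split; [exact: Phi1|exact: PhiM]. Qed.

End Isomorphism.

Theorem theorem5p2 (n : nat) (hn : (1 <= n)%N)
    (V : comAlgType rat) (gr : nat -> set V) (hgr : even_grading gr)
    (e : V) (he : gr (2 * n)%N e)
    (hV : unit_plus_gt gr n) :
  forall d : nat, exists g0 : nat, forall g : nat, (g0 <= g)%N ->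
  forall a ash : 'I_(g + g) -> H g,
    basis_of fullv [tuple a i | i < g + g] ->
    (forall i j, lam n (ash i) (a j) = (i == j)%:R) ->
  exists Phi : {rmorphism Pres n gr e a ash -> RV n g gr e},
    natural_map Phi /\
    forall m : nat, (m <= d)%N -> set_bij (Pres_deg m) (RV_deg m) Phi.
Proof.
(* The maps and the identities between them are available for every [g], whence the threshold 0. *)
move=> d; exists 0%N => g _ a ash ab adual.
pose Ad := GRing.isZmodMorphism.Build _ _ _ (@Phi_additive n g V gr e hgr a ash ab adual).
pose Mu := GRing.isMonoidMorphism.Build _ _ _ (@Phi_multiplicative n g V gr e hgr a ash ab adual).
pose PhiR : {rmorphism Pres n gr e a ash -> RV n g gr e} := HB.pack (@Phi n g V gr e a ash) Ad Mu.
exists PhiR; split=> [|m _]; last exact: (@Phi_bij n g V gr e hn hgr he hV a ash ab adual m).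
have gen := @Phi_gen n g V gr e hgr a ash ab adual.
split=> [d' c hc hd|d' c hc hd v|v1 v2 v3].
- exact: (gen (Gen0 g hc hd)).
- exact: (gen (Gen1 hc hd v)).
- exact: (gen (Gen3 n gr [tuple v1; v2; v3])).
Qed.
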